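(* Every finitary Lie algebra has a Levi component.
   Context: Ground field $\mathbb C$; all Lie algebras are of at most countable dimension. A Lie algebra is locally finite if every finite subset lies in a finite-dimensional subalgebra. A representation $W$ of a locally finite Lie algebra is finitary if $W$ has a basis in which every element acts by a finite matrix (finitely many nonzero entries); a locally finite Lie algebra is finitary if it has a faithful finitary representation (equivalently, it is isomorphic to a subalgebra of $\mathfrak{gl}_\infty=\mathfrak{gl}(V,V_* )$). The locally solvable radical $\mathfrak r$ of a locally finite Lie algebra $\mathfrak g$ is its largest locally solvable ideal (locally solvable: every finite subset lies in a solvable finite-dimensional subalgebra). A subalgebra $\mathfrak l\subset\mathfrak g$ is a Levi component of $\mathfrak g$ if $[\mathfrak g,\mathfrak g]=(\mathfrak r\cap[\mathfrak g,\mathfrak g])\rtimes\mathfrak l$, i.e. $[\mathfrak g,\mathfrak g]$ is the vector space direct sum of the ideal $\mathfrak r\cap[\mathfrak g,\mathfrak g]$ and the subalgebra $\mathfrak l$. *)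

(* Defs.v *)
From HB Require Import structures.
From Stdlib Require Import Reals Lra ClassicalEpsilon FunctionalExtensionality PropExtensionality.
From mathcomp Require Import all_boot all_order all_algebra.
Import GRing.Theory.
Set Implicit Arguments. Unset Strict Implicit. Unset Printing Implicit Defensive.

Record complex := Cplx { cre : R; cim : R }.

Definition complex_eqb (x y : complex) : bool :=
  if Req_EM_T (cre x) (cre y) then (if Req_EM_T (cim x) (cim y) then true else false) else false.

Lemma complex_eqP : Equality.axiom complex_eqb.
Proof.
move=> [a b] [c d]; rewrite /complex_eqb /=.
destruct (Req_EM_T a c) as [e1|h]; last by constructor; case.
destruct (Req_EM_T b d) as [e2|h]; last by constructor; case.
by constructor; subst.
Qed.

HB.instance Definition _ := hasDecEq.Build complex complex_eqP.

Definition C0 := Cplx R0 R0.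
Definition complex_find (P : pred complex) (_ : nat) : option complex :=
  let x := epsilon (inhabits (C0)) (fun x => P x) in
  if P x then Some x else None.

Lemma complex_find_correct P n x : complex_find P n = Some x -> P x.
Proof. by rewrite /complex_find; case: ifP => // Px [<-]. Qed.

Lemma complex_find_complete (P : pred complex) : (exists x, P x) -> exists n, complex_find P n.
Proof.
move=> ex; exists 0%N; rewrite /complex_find.
by have := epsilon_spec (inhabits (C0)) (fun x => P x) ex => ->.
Qed.

Lemma complex_find_ext (P Q : pred complex) : P =1 Q -> complex_find P =1 complex_find Q.
Proof.
move=> PQ n; have E : P = Q by apply: functional_extensionality.
by rewrite E.
Qed.

HB.instance Definition _ := hasChoice.Build complex complex_find_correct
  complex_find_complete complex_find_ext.

Definition C1 := Cplx R1 R0.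
Definition Cadd x y := Cplx (Rplus (cre x) (cre y)) (Rplus (cim x) (cim y)).
Definition Copp x := Cplx (Ropp (cre x)) (Ropp (cim x)).
Definition Cmul x y := Cplx (Rminus (Rmult (cre x) (cre y)) (Rmult (cim x) (cim y)))
  (Rplus (Rmult (cre x) (cim y)) (Rmult (cim x) (cre y))).
Definition Cinv x := let n := Rplus (Rmult (cre x) (cre x)) (Rmult (cim x) (cim x)) in
  Cplx (Rdiv (cre x) n) (Rdiv (Ropp (cim x)) n).

Lemma Cext a b c d : a = c -> b = d -> Cplx a b = Cplx c d.
Proof. by move=> -> ->. Qed.

Lemma CaddA : associative Cadd.
Proof. by move=> [a b] [c d] [e f]; apply: Cext => /=; ring. Qed.
Lemma CaddC : commutative Cadd.
Proof. by move=> [a b] [c d]; apply: Cext => /=; ring. Qed.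
Lemma Cadd0 : left_id C0 Cadd.
Proof. by move=> [a b]; apply: Cext => /=; ring. Qed.
Lemma CaddN : left_inverse C0 Copp Cadd.
Proof. by move=> [a b]; apply: Cext => /=; ring. Qed.

HB.instance Definition _ := GRing.isZmodule.Build complex CaddA CaddC Cadd0 CaddN.

Lemma CmulA : associative Cmul.
Proof. by move=> [a b] [c d] [e f]; apply: Cext => /=; ring. Qed.
Lemma CmulC : commutative Cmul.
Proof. by move=> [a b] [c d]; apply: Cext => /=; ring. Qed.
Lemma Cmul1 : left_id C1 Cmul.
Proof. by move=> [a b]; apply: Cext => /=; ring. Qed.
Lemma CmulDl : left_distributive Cmul Cadd.
Proof. by move=> [a b] [c d] [e f]; apply: Cext => /=; ring. Qed.
Lemma C1_neq0 : C1 != C0.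
Proof. by apply/eqP; case; apply: R1_neq_R0. Qed.

HB.instance Definition _ := GRing.Zmodule_isComNzRing.Build complex CmulA CmulC Cmul1 CmulDl C1_neq0.

Lemma CmulV (x : complex) : x != C0 -> Cmul (Cinv x) x = C1.
Proof.
case: x => a b /eqP nz.
have hn : Rplus (Rmult a a) (Rmult b b) <> R0.
  move=> h; apply: nz.
  have ha : a = R0 by nra.
  have hb : b = R0 by nra.
  by rewrite /C0 ha hb.
by apply: Cext => /=; field.
Qed.

Lemma Cinv0 : Cinv C0 = C0.
Proof. rewrite /Cinv /C0 /=; apply: Cext; rewrite /Rdiv ?Ropp_0 !Rmult_0_l //. Qed.

HB.instance Definition _ := GRing.ComNzRing_isField.Build complex CmulV Cinv0.


Local Open Scope ring_scope.

Definition lincomb (K : fieldType) (V : lmodType K) (c : seq K) (s : seq V) : V :=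
  \sum_(i < size s) c`_i *: s`_i.

Definition in_span (K : fieldType) (V : lmodType K) (s : seq V) (v : V) : Prop :=
  exists c : seq K, v = lincomb c s.

Definition span_set (K : fieldType) (V : lmodType K) (P : V -> Prop) (v : V) : Prop :=
  exists s : seq V, (forall w, w \in s -> P w) /\ in_span s v.

Definition subspace (K : fieldType) (V : lmodType K) (P : V -> Prop) : Prop :=
  P 0 /\ (forall x y, P x -> P y -> P (x + y)) /\ (forall (a : K) x, P x -> P (a *: x)).

Definition finite_dim (K : fieldType) (V : lmodType K) (P : V -> Prop) : Prop :=
  exists s : seq V, forall v, P v <-> in_span s v.

Definition countable_dim (K : fieldType) (V : lmodType K) : Prop :=
  exists e : nat -> V, forall v, exists n, in_span (mkseq e n) v.

Definition is_lie_bracket (K : fieldType) (L : lmodType K) (br : L -> L -> L) : Prop :=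
  (forall (a : K) x y z, br (a *: x + y) z = a *: br x z + br y z) /\
  (forall (a : K) x y z, br x (a *: y + z) = a *: br x y + br x z) /\
  (forall x, br x x = 0) /\
  (forall x y z, br x (br y z) + br y (br z x) + br z (br x y) = 0).

Definition subalgebra (K : fieldType) (L : lmodType K) (br : L -> L -> L)
  (S : L -> Prop) : Prop :=
  subspace S /\ (forall x y, S x -> S y -> S (br x y)).

Definition lie_ideal (K : fieldType) (L : lmodType K) (br : L -> L -> L)
  (I : L -> Prop) : Prop :=
  subspace I /\ (forall x y, I y -> I (br x y)).

Definition locally_finite (K : fieldType) (L : lmodType K) (br : L -> L -> L) : Prop :=
  forall s : seq L, exists S : L -> Prop,
    [/\ subalgebra br S, finite_dim S & forall x, x \in s -> S x].

Fixpoint derived (K : fieldType) (L : lmodType K) (br : L -> L -> L)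
  (S : L -> Prop) (k : nat) : L -> Prop :=
  match k with
  | 0 => S
  | k'.+1 => span_set (fun w => exists a b,
               [/\ derived br S k' a, derived br S k' b & w = br a b])
  end.

Definition solvable_subalg (K : fieldType) (L : lmodType K) (br : L -> L -> L)
  (S : L -> Prop) : Prop :=
  exists k, forall v, derived br S k v -> v = 0.

Definition locally_solvable (K : fieldType) (L : lmodType K) (br : L -> L -> L)
  (I : L -> Prop) : Prop :=
  forall s : seq L, (forall x, x \in s -> I x) ->
    exists S : L -> Prop,
      [/\ subalgebra br S, finite_dim S, solvable_subalg br S,
          (forall x, S x -> I x) & forall x, x \in s -> S x].

Definition loc_solv_radical (K : fieldType) (L : lmodType K) (br : L -> L -> L)
  (r : L -> Prop) : Prop :=
  [/\ lie_ideal br r, locally_solvable br r &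
      forall I, lie_ideal br I -> locally_solvable br I -> forall x, I x -> r x].

Definition derived_alg (K : fieldType) (L : lmodType K) (br : L -> L -> L) : L -> Prop :=
  span_set (fun w => exists a b, w = br a b).

Definition levi_component (K : fieldType) (L : lmodType K) (br : L -> L -> L)
  (r l : L -> Prop) : Prop :=
  [/\ subalgebra br l,
      (forall x, l x -> derived_alg br x),
      (forall x, derived_alg br x ->
         exists a b, [/\ r a, derived_alg br a, l b & x = a + b]) &
      (forall x, r x -> derived_alg br x -> l x -> x = 0)].

Definition lie_rep (K : fieldType) (L : lmodType K) (br : L -> L -> L)
  (W : lmodType K) (rho : L -> W -> W) : Prop :=
  [/\ (forall (a : K) x y w, rho (a *: x + y) w = a *: rho x w + rho y w),
      (forall x (a : K) v w, rho x (a *: v + w) = a *: rho x v + rho x w) &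
      (forall x y w, rho (br x y) w = rho x (rho y w) - rho y (rho x w))].

Definition faithful_rep (K : fieldType) (L : lmodType K) (W : lmodType K)
  (rho : L -> W -> W) : Prop :=
  forall x, (forall w, rho x w = 0) -> x = 0.

Definition is_basis (K : fieldType) (W : lmodType K) (B : W -> Prop) : Prop :=
  (forall s : seq W, uniq s -> (forall b, b \in s -> B b) ->
     forall c : seq K, lincomb c s = 0 -> forall i, (i < size s)%N -> c`_i = 0) /\
  (forall w, span_set B w).

(* every rho x is given, in the basis B, by a finite matrix: there is a finite
   set F of basis vectors outside of which the columns vanish and inside of
   which all columns are supported *)
Definition finite_matrices (K : fieldType) (L : lmodType K) (W : lmodType K)
  (B : W -> Prop) (rho : L -> W -> W) : Prop :=
  forall x, exists F : seq W,
    [/\ (forall b, b \in F -> B b),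
        (forall b, B b -> b \notin F -> rho x b = 0) &
        (forall b, B b -> in_span F (rho x b))].

Definition finitary_lie (K : fieldType) (L : lmodType K) (br : L -> L -> L) : Prop :=
  exists (W : lmodType K) (rho : L -> W -> W) (B : W -> Prop),
    [/\ lie_rep br rho, faithful_rep rho, is_basis B & finite_matrices B rho].

(* Main.v *)
(* A finitary Lie algebra g of countable dimension is the union of a chain of
   Lie algebras S_n of matrices of growing size.  Semisimplicity, also relative to
   an ideal, is used in the form of the vanishing of H^1 (Whitehead's first lemma);
   it gives Levi decompositions inside S_n, with a complement that contains a
   prescribed semisimple subalgebra.  Levi complements of [S_n, S_n] chosen one after
   the other need not exhaust [g, g] modulo its radical, because the radical of S_n
   is in general not contained in that of g.

   Let A be the associative envelope of q = [S_n, S_n], and let K be the set of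
   elements of A orthogonal, for the trace form, to the upper left corners of the
   envelopes of all the [S_m, S_m] with m >= n.  Then q meets K inside the radical of g.
   Given a finite set X in [g, g], for large n the corners of later envelopes act on
   X like elements of A.  Modulo K, the elements of X are then conjugate by some
   1 + v, with v in the nil radical of A, to elements of an ideal of a Levi complement
   of q, so that X lies in a subalgebra H of q for which H/(H :&: K) is semisimple and
   H :&: K consists of nilpotent matrices.  A complement of H :&: K in H that contains
   the semisimple subalgebra built so far represents X modulo the radical of g.
   Repeating this along a spanning sequence of [g, g] and taking the union of the
   complements gives the Levi component; it meets the radical trivially because a
   semisimple algebra has no solvable ideal. *)

From HB Require Import structures.
From Stdlib Require Import Reals Lra.
From mathcomp Require Import all_boot all_order all_algebra.
From mathcomp Require Import closed_field boolp complex Rstruct zify ring.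
Require Import Defs.
Set Implicit Arguments. Unset Strict Implicit. Unset Printing Implicit Defensive.
Import GRing.Theory Num.Theory.
Local Open Scope ring_scope.

(** * The complex numbers *)

(** The obstacle is that the conjugation has to happen inside [q], whereas [1 + w] with [w] in the
    radical [R] of the trace form on [A] leads out of [q] in general. Hence [w] is replaced, without
    changing its effect modulo [K], by an element [v] of the ideal [N] of brackets of [S] with its
    solvable radical. For such [v] the element [y + [v, y] + [v, [v, y]]/2] stays in [q] and agrees
    with [(1 + v) y (1 - v)] modulo [K]. The truncation is harmless because there is an ideal [J] of
    the envelope of the Levi complement with [J R J] inside [K], so [v v] disappears between
    elements of [J]. This containment comes from idempotent one-sided units for [X], through which
    traces against later corners can be computed inside [A]. Later corners act on [X] like elements
    of [A] for a reason of dimension: corners of a fixed size form an increasing chain of subspaces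
    of one matrix space, which becomes stationary. H^1 relative to an ideal makes it possible to
    speak of [H/P] without forming it: the condition passes to images, ideals and complements, and
    Bourbaki's trick turns it into invariant projections. *)

Definition to_Ri (x : complex) : complex.complex R := complex.Complex (cre x) (cim x).
Definition of_Ri (z : complex.complex R) : complex := let: complex.Complex a b := z in Cplx a b.

Lemma of_RiD x y : of_Ri (x + y) = of_Ri x + of_Ri y.
Proof. by case: x => a b; case: y. Qed.
Lemma of_RiM x y : of_Ri (x * y) = of_Ri x * of_Ri y.
Proof. by case: x => a b; case: y. Qed.
Lemma to_RiK : cancel to_Ri of_Ri.
Proof. by case. Qed.

Lemma of_RiX x n : of_Ri (x ^+ n) = of_Ri x ^+ n.
Proof. by elim: n => [|n IH] //; rewrite !exprS of_RiM IH. Qed.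

(** The two models of the complex numbers have the same operations by computation, so roots are
    transported along [of_Ri]. *)
Lemma complex_closed : GRing.closed_field_axiom complex.
Proof.
move=> n P n0; have [z Hz] := @complex_acf_axiom R n (fun i => to_Ri (P i)) n0.
exists (of_Ri z); rewrite -of_RiX Hz.
have -> : of_Ri (\sum_(i < n) to_Ri (P i) * z ^+ i) =
  \sum_(i < n) of_Ri (to_Ri (P i) * z ^+ i).
  by apply: (big_morph _ of_RiD).
by apply: eq_bigr => i _; rewrite of_RiM to_RiK of_RiX.
Qed.

HB.instance Definition _ := Field_isAlgClosed.Build complex complex_closed.

Lemma natr_complex k : (k%:R : complex) = Cplx (INR k) R0.
Proof.
elim: k => [|k IH] //; rewrite -addn1 natrD IH addn1 S_INR; apply: Cext => //=; lra.
Qed.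

Lemma complex_pchar0 : [pchar complex] =i pred0.
Proof.
apply/pcharf0P => k; apply/eqP/eqP; last by move=> ->.
by rewrite natr_complex => -[h]; apply: INR_eq.
Qed.

(** * Linear identities in matrix Lie algebras *)

(** Syntax for a reflexive decision procedure: an identity holds in every abelian group once the
    integer coefficients of each atom agree. *)
Inductive zexp := ZVar of nat | ZZero | ZAdd of zexp & zexp | ZOpp of zexp.

Fixpoint zcoef (e : zexp) (i : nat) : int :=
  match e with
  | ZVar j => if i == j then 1 else 0
  | ZZero => 0
  | ZAdd e1 e2 => zcoef e1 i + zcoef e2 i
  | ZOpp e1 => - zcoef e1 i
  end.

Fixpoint zeval (V : zmodType) (env : seq V) (e : zexp) : V :=
  match e with
  | ZVar j => env`_j
  | ZZero => 0
  | ZAdd e1 e2 => zeval env e1 + zeval env e2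
  | ZOpp e1 => - zeval env e1
  end.

Lemma zevalE (V : zmodType) (env : seq V) (e : zexp) :
  zeval env e = \sum_(i < size env) env`_i *~ zcoef e i.
Proof.
elim: e => [j||e1 IH1 e2 IH2|e IH] /=.
- have [jlt|jge] := ltnP j (size env).
    rewrite (bigD1 (Ordinal jlt)) //= eqxx mulr1z big1 ?addr0 // => i ne.
    by rewrite -[_ == j]/(i == Ordinal jlt) (negbTE ne) mulr0z.
  rewrite nth_default // big1 // => i _; case: eqP => [ij|]; last by rewrite mulr0z.
  by have := ltn_ord i; rewrite ij ltnNge jge.
- by rewrite big1 // => i _; rewrite mulr0z.
- by rewrite IH1 IH2 -big_split; apply: eq_bigr => i _; rewrite mulrzDr.
- by rewrite IH -sumrN; apply: eq_bigr => i _; rewrite mulrNz.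
Qed.

Lemma zmodP (V : zmodType) (env : seq V) (e1 e2 : zexp) :
  all (fun i => zcoef e1 i == zcoef e2 i) (iota 0 (size env)) ->
  zeval env e1 = zeval env e2.
Proof.
move=> /allP h; rewrite !zevalE; apply: eq_bigr => i _; congr (_ *~ _).
by apply/eqP/h; rewrite mem_iota /= ltn_ord.
Qed.

Fact lie_key : unit. Proof. exact: tt. Qed.
(** Locked, so that a bracket stays an opaque atom for rewriting and unification. *)
Definition lie (R : pzRingType) (x y : R) : R := locked_with lie_key (x * y - y * x).
Lemma lieE (R : pzRingType) (x y : R) : lie x y = x * y - y * x.
Proof. by rewrite /lie unlock. Qed.

Ltac zeq_syn a b :=
  match constr:(Set) with
  | _ => let _ := match goal with _ => constr_eq a b end in constr:(true)
  | _ => constr:(false)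
  end.
(* syntactic equality up to the choice of canonical instances *)
Ltac zeq a b :=
  lazymatch zeq_syn a b with
  | true => constr:(true)
  | false =>
    lazymatch a with
    | @GRing.one _ => lazymatch b with @GRing.one _ => constr:(true) | _ => constr:(false) end
    | @GRing.mul _ ?x ?y => lazymatch b with
      | @GRing.mul _ ?z ?t => zeq2 x y z t | _ => constr:(false) end
    | @lie _ ?x ?y => lazymatch b with
      | @lie _ ?z ?t => zeq2 x y z t | _ => constr:(false) end
    | @GRing.add _ ?x ?y => lazymatch b with
      | @GRing.add _ ?z ?t => zeq2 x y z t | _ => constr:(false) end
    | @GRing.opp _ ?x => lazymatch b with @GRing.opp _ ?z => zeq x z | _ => constr:(false) end
    | @GRing.scale _ _ ?x ?y => lazymatch b with
      | @GRing.scale _ _ ?z ?t => zeq2 x y z t | _ => constr:(false) end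
    | @mulmx _ _ _ _ ?x ?y => lazymatch b with
      | @mulmx _ _ _ _ ?z ?t => zeq2 x y z t | _ => constr:(false) end
    | @fun_of_lfun _ _ _ ?x ?y => lazymatch b with
      | @fun_of_lfun _ _ _ ?z ?t => zeq2 x y z t | _ => constr:(false) end
    | @GRing.exp _ ?x ?y => lazymatch b with
      | @GRing.exp _ ?z ?t => zeq2 x y z t | _ => constr:(false) end
    | ?f _ => match constr:(Set) with
      | _ => let _ := match goal with _ => unify a b end in constr:(true)
      | _ => constr:(false)
      end
    | _ => constr:(false)
    end
  end
with zeq2 x y z t :=
  lazymatch zeq x z with true => zeq y t | false => constr:(false) end.
Ltac zmem a l :=
  lazymatch l with
  | nil => constr:(false)
  | ?b :: ?t => lazymatch zeq a b with true => constr:(true) | false => zmem a t end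
  end.
Ltac zindex a l :=
  lazymatch l with
  | ?b :: ?t => lazymatch zeq a b with
    | true => constr:(0%N)
    | false => let i := zindex a t in constr:(S i)
    end
  end.
Ltac zatoms t l :=
  lazymatch t with
  | (?a + ?b)%R => let l := zatoms a l in zatoms b l
  | (- ?a)%R => zatoms a l
  | (0%R) => l
  | _ => lazymatch zmem t l with true => l | false => constr:(t :: l) end
  end.
Ltac zreify t l :=
  lazymatch t with
  | (?a + ?b)%R => let u := zreify a l in let v := zreify b l in constr:(ZAdd u v)
  | (- ?a)%R => let u := zreify a l in constr:(ZOpp u)
  | (0%R) => constr:(ZZero)
  | _ => let i := zindex t l in constr:(ZVar i)
  end.
(* decides linear identities with integer coefficients in an abelian group *)
Ltac zmod :=
  match goal with
  | |- @eq ?V ?a ?b =>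
    let l := zatoms a (@nil V) in let l := zatoms b l in
    let u := zreify a l in let v := zreify b l in
    let H := fresh in
    have H := @zmodP _ l u v erefl; exact: H
  end.

Ltac ncring := rewrite ?(mulrDl, mulrDr, mulrN, mulNr, opprD, opprK, mul1r, mulr1, mulrA); zmod.

(** Classical comprehension for subspaces: a subspace inside [P] is enlarged by vectors of [P]
    outside it until the codimension [k] is exhausted. The kernels, radicals and stabilizers below
    are produced in this way. *)
Lemma vspace_of_pred (F : fieldType) (V : vectType F) (P : V -> Prop) :
  P 0 -> (forall a u v, P u -> P v -> P (a *: u + v)) ->
  exists U : {vspace V}, forall v, v \in U <-> P v.
Proof.
move=> P0 PD.
suff H k : forall U : {vspace V}, (forall u, u \in U -> P u) ->
    (\dim {:V} <= \dim U + k)%N -> exists U' : {vspace V}, forall v, v \in U' <-> P v.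
  apply: (H (\dim {:V}) 0%VS) => [u|]; last exact: leq_addl.
  by rewrite memv0 => /eqP ->.
elim: k => [|k IH] U UP dU.
  exists U => v; split; first exact: UP.
  move=> _; suff -> : U = fullv by rewrite memvf.
  by apply/eqP; rewrite eqEdim subvf /= -(addn0 (\dim U)).
have [[v [Pv vU]]|nex] := pselect (exists v, P v /\ v \notin U); last first.
  exists U => v; split; first exact: UP.
  by move=> Pv; apply: contrapT => /negP vU; apply: nex; exists v.
apply: (IH (<[v]> + U)%VS) => [u /memv_addP [x /vlineP [a ->]] [y yU ->]|].
  by apply: PD => //; apply: UP.
have dl : (\dim U < \dim (<[v]> + U))%N.
  rewrite (ltn_leqif (dimv_leqif_sup (addvSr _ _))).
  by apply: contra vU => /subvP; apply; apply: (subvP (addvSl _ _)); rewrite memv_line.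
by apply: leq_trans dU _; rewrite addnS -addSn leq_add2r.
Qed.

Section LieRing.
Context (R : pzRingType).
Implicit Types x y z : R.
Lemma lieC x y : lie x y = - lie y x.
Proof. by rewrite !lieE; ncring. Qed.
Lemma liexx x : lie x x = 0.
Proof. by rewrite lieE subrr. Qed.
Lemma lieDl x y z : lie (x + y) z = lie x z + lie y z.
Proof. by rewrite !lieE; ncring. Qed.
Lemma lieDr x y z : lie z (x + y) = lie z x + lie z y.
Proof. by rewrite !lieE; ncring. Qed.
Lemma lieNl x y : lie (- x) y = - lie x y.
Proof. by rewrite !lieE; ncring. Qed.
Lemma lieNr x y : lie y (- x) = - lie y x.
Proof. by rewrite !lieE; ncring. Qed.
Lemma lie0x x : lie 0 x = 0.
Proof. by rewrite !lieE mul0r mulr0 subr0. Qed.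
Lemma liex0 x : lie x 0 = 0.
Proof. by rewrite !lieE mul0r mulr0 subr0. Qed.
Lemma jacobi x y z : lie x (lie y z) = lie (lie x y) z + lie y (lie x z).
Proof. by rewrite !lieE; ncring. Qed.
Lemma lieM x y z : lie x (y * z) = lie x y * z + y * lie x z.
Proof. by rewrite !lieE; ncring. Qed.
Lemma lieMl x y z : lie (x * y) z = x * lie y z + lie x z * y.
Proof. by rewrite !lieE; ncring. Qed.
End LieRing.

Lemma lieZl (F : comNzRingType) (R : algType F) (a : F) (x y : R) :
  lie (a *: x) y = a *: lie x y.
Proof. by rewrite !lieE scalerBr -scalerAl -scalerAr. Qed.
Lemma lieZr (F : comNzRingType) (R : algType F) (a : F) (x y : R) :
  lie x (a *: y) = a *: lie x y.
Proof. by rewrite !lieE scalerBr -scalerAl -scalerAr. Qed.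

(** * Nilpotency, idempotents and traces *)

Section Trace.
Context (F : fieldType) (n : nat).
Implicit Types x y z e : 'M[F]_n.+1.

Definition nil x := exists k, x ^+ k = 0.

Lemma trC x y : \tr (x * y) = \tr (y * x).
Proof. exact: mxtrace_mulC. Qed.

Lemma tr_lie x y z : \tr (lie x y * z) = \tr (x * lie y z).
Proof.
rewrite !lieE mulrBl mulrBr !linearB /= !mulrA; congr (_ - _).
by rewrite -!mulrA trC mulrA.
Qed.

(** The Fitting projection. The characteristic polynomial is ['X ^+ m * d] with [d] prime to ['X],
    and Bezout for ['X ^+ m.+1] and [d] gives the idempotent. The exponent [m.+1] instead of [m]
    makes it a multiple of [x] also when [m = 0]. *)
Lemma nonnil_idem x : ~ nil x ->
  exists p : {poly F}, x * horner_mx x p != 0 /\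
    (x * horner_mx x p) * (x * horner_mx x p) = x * horner_mx x p.
Proof.
move=> nnil; set c := char_poly x.
have c0 : c != 0 by rewrite monic_neq0 // char_poly_monic.
have [m [d d0 cE]] := multiplicity_XsubC c 0.
move: d0; rewrite c0 /= => d0; rewrite subr0 in cE.
have cop : coprimep ('X ^+ m.+1) d.
  by apply: coprimep_expl; rewrite coprimep_sym -['X]subr0 -polyC0 coprimep_XsubC.
have [[u v] /= uv] := Bezout_eq1_coprimepP _ _ cop.
have hX : horner_mx x ('X) = x by rewrite horner_mx_X.
exists (u * 'X ^+ m); set e := x * _.
have eE : e = horner_mx x (u * 'X ^+ m.+1).
  by rewrite exprSr mulrA rmorphM /= hX /e; apply/comm_mx_horner/comm_mx_refl.
have zE : horner_mx x (v * d) = 1 - e.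
  by rewrite eE -[1](rmorph1 (horner_mx x)) -uv rmorphD /= addrC addKr.
have Hc : horner_mx x ('X ^+ m * (v * d)) = 0.
  by rewrite mulrCA [_ * d]mulrC -cE rmorphM /= Cayley_Hamilton mulr0.
split.
  apply/eqP => e0; apply: nnil; exists m.
  by move: Hc; rewrite rmorphM /= zE e0 subr0 mulr1 rmorphXn /= hX.
apply/eqP; rewrite -subr_eq0 -opprB oppr_eq0 -{1}[e]mulr1 -mulrBr -zE eE -rmorphM /=.
by rewrite exprS -!mulrA rmorphM /= rmorphM /= Hc !mulr0.
Qed.

(** In a rank factorization [e = A *m B] of an idempotent, [B *m A] is the identity of size
    [\rank e]. *)
Lemma tr_idem (e : 'M[F]_n.+1) : e * e = e -> \tr e = (\rank e)%:R.
Proof.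
move=> ee; move: (mulmx_base e) (row_base_free e) (col_base_full e).
move: (\rank e) (col_base e) (row_base e) => r A B eE /row_freeP [D BD] /row_fullP [D' DA].
have E : B *m A = 1%:M.
  have : D' *m (e *m e) *m D = D' *m e *m D by rewrite -mulmxE in ee; rewrite ee.
  by rewrite -eE !mulmxA DA !mul1mx -!mulmxA BD !mulmx1.
by rewrite -eE mxtrace_mulC E mxtrace1.
Qed.

Hypothesis char0 : [pchar F] =i pred0.

Lemma tr_idem_eq0 (e : 'M[F]_n.+1) : e * e = e -> \tr e = 0 -> e = 0.
Proof.
move=> ee; rewrite tr_idem // => /eqP.
by rewrite ((pcharf0P F).1 char0) mxrank_eq0 => /eqP.
Qed.

(** Otherwise the Fitting idempotent of [x], a polynomial in [x] without constant term, would have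
    trace 0, hence rank 0 in characteristic 0. *)
Lemma tr_pow_nil x : (forall k, \tr (x ^+ k.+1) = 0) -> nil x.
Proof.
move=> trx; apply: contrapT => /nonnil_idem [p [e0 ee]].
case/eqP: e0; apply: tr_idem_eq0 => //.
rewrite -[p]coefK poly_def rmorph_sum mulr_sumr raddf_sum big1 // => i _.
by rewrite /= linearZ /= rmorphXn /= horner_mx_X -scalerAr -exprS linearZ /= trx mulr0.
Qed.
End Trace.

Section ClosedTrace.
Context (F : closedFieldType) (n : nat).

Lemma nil_tr0 (x : 'M[F]_n.+1) : nil x -> \tr x = 0.
Proof.
move=> [k xk0]; apply/eqP; rewrite -oppr_eq0 -(char_poly_trace x) //.
have [rs E] := closed_field_poly_normal (char_poly x).
have /monicP lc := char_poly_monic x.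
rewrite lc scale1r in E.
have r0 z : z \in rs -> z = 0.
  move=> zrs; have : eigenvalue x z.
    by rewrite eigenvalue_root_char E root_prod_XsubC.
  case/eigenvalueP => v vx v0.
  have Hj j : v *m (x ^+ j) = z ^+ j *: v.
    elim: j => [|j IH]; first by rewrite mulmx1 scale1r.
    by rewrite exprS -mulmxE mulmxA vx -scalemxAl IH scalerA exprS.
  have /eqP := Hj k; rewrite xk0 mulmx0 eq_sym scaler_eq0 (negbTE v0) orbF.
  by rewrite expf_eq0 => /andP [_ /eqP].
have E2 : char_poly x = 'X ^+ size rs.
  rewrite E big_seq (eq_bigr (fun _ => 'X)); last by move=> z /r0 ->; rewrite subr0.
  by rewrite -big_seq big_const_seq count_predT iter_mulr_1.
have : size rs = n.+1.
  by apply: succn_inj; rewrite -(size_char_poly x) E2 size_polyXn.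
by rewrite E2 => ->; rewrite coefXn /= ltn_eqF.
Qed.
End ClosedTrace.

(** * Engel's theorem *)

Section Engel.
Context (F : fieldType) (n : nat).
Local Notation E := 'M[F]_n.+1.
Implicit Types (x y z p q : E) (P Q S C : {vspace E}) (s u w : seq E).

Definition lie_closed P := forall x y, x \in P -> y \in P -> lie x y \in P.

Definition word_nil P k := forall s, all (mem P) s -> size s = k -> \prod_(x <- s) x = 0.

Lemma word_nil_ge P k s : word_nil P k -> all (mem P) s -> (k <= size s)%N ->
  \prod_(x <- s) x = 0.
Proof.
move=> H sP ks; rewrite -(cat_take_drop k s) big_cat /= H ?mul0r //.
  by apply/allP => x /mem_take; apply/allP.
by rewrite size_takel.
Qed.

Definition ads s z := foldr (fun q v => lie q v) z s.

Lemma ads_word P k s u w z : word_nil P k ->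
  all (mem P) s -> all (mem P) u -> all (mem P) w ->
  (k.*2.-1 <= size u + size w + size s)%N ->
  (\prod_(x <- u) x) * ads s z * (\prod_(x <- w) x) = 0.
Proof.
move=> H; elim: s u w => [|q s IH] u w /= sP uP wP.
  rewrite addn0 => sz; have [ku|] := leqP k (size u).
    by rewrite (word_nil_ge H) ?mul0r.
  move=> uk; rewrite (word_nil_ge (s := w) H) ?mulr0 //.
  by move: sz uk; clear; lia.
move=> sz; case/andP: sP => qP sP.
rewrite !lieE mulrBr mulrBl.
have := IH (rcons u q) w sP; rewrite -cats1 big_cat big_seq1 /= all_cat uP /= qP.
rewrite size_cat /= => /(_ isT wP) h1; rewrite mulrA h1; last first.
  by apply: leq_trans sz _; lia.
have := IH u (q :: w) sP uP; rewrite big_cons /= qP wP => /(_ isT) h2.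
by rewrite !mulrA in h2 *; rewrite h2 ?subrr //; apply: leq_trans sz _; lia.
Qed.

Lemma ads_mem P s z : lie_closed P -> z \in P -> all (mem P) s -> ads s z \in P.
Proof.
move=> PL zP; elim: s => //= q s IH /andP [qP sP].
by apply: PL => //; apply: IH.
Qed.

(** For the least [t] such that all [t]-fold brackets with [Q] send [P] into [Q], some
    [(t - 1)]-fold bracket lies outside [Q], and it normalizes [Q]. *)
Lemma normalizing_elt P Q t : lie_closed P -> (Q <= P)%VS -> ~~ (P <= Q)%VS ->
  (forall s z, all (mem Q) s -> size s = t -> z \in P -> ads s z \in Q) ->
  exists2 p, p \in P /\ p \notin Q & forall q, q \in Q -> lie q p \in Q.
Proof.
move=> PL QP PQ; elim: t => [|t IH] H.
  case/negP: PQ; apply/subvP => z zP; exact: (H [::]).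
have [Ht|] := pselect (forall s z, all (mem Q) s -> size s = t -> z \in P -> ads s z \in Q).
  exact: IH.
move=> nH; apply: contrapT => nex; apply: nH => s z sQ st zP.
apply: contrapT => /negP nQ; apply: nex; exists (ads s z).
  split=> //; apply: ads_mem => //; apply/allP => x /(allP sQ) xQ; exact: (subvP QP).
by move=> q qQ; apply: (H (q :: s)) => //=; rewrite ?qQ ?st.
Qed.

(** Moves [q] to the left through [p ^+ i] by [p q = q p + [p, q]]; the brackets stay in [Q] and the
    exponent of [p] does not grow. *)
Lemma exp_shift Q p i q v y : (forall q, q \in Q -> lie p q \in Q) -> q \in Q ->
  (forall q' j, q' \in Q -> (j <= i)%N -> v * (q' * (p ^+ j * y)) = 0) ->
  v * (p ^+ i * (q * y)) = 0.
Proof.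
move=> Hp; elim: i q y => [|i IH] q y qQ H.
  by have := H q 0%N qQ isT; rewrite !expr0 !mul1r.
have -> : v * (p ^+ i.+1 * (q * y)) = v * (p ^+ i * (q * (p * y))) + v * (p ^+ i * (lie p q * y)).
  by rewrite exprSr !lieE; ncring.
rewrite (IH q (p * y)) //; last first.
  move=> q' j q'Q ji; rewrite [p ^+ j * _]mulrA -exprSr; exact: H.
rewrite (IH (lie p q) y) ?addr0 //; first exact: Hp.
by move=> q' j q'Q ji; apply: H => //; apply: leqW.
Qed.

(** With [p ^+ m = 0], words of length [k * m] vanish: among [m] consecutive letters either all
    contribute [p], or one contributes an element of [Q] that can be moved to the left end, and [k]
    such moves suffice. *)
Lemma word_nil_add_line Q p k : (forall q, q \in Q -> lie p q \in Q) ->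
  nil p -> word_nil Q k -> exists k', word_nil (<[p]> + Q)%VS k'.
Proof.
move=> Hp [m pm] HQ; set P := (_ + _)%VS.
have pP : p \in P by apply: (subvP (addvSl _ _)); rewrite memv_line.
(* [d] bounds the number of letters of [Q] still missing in the left part [u]. *)
suff main d : forall u w, all (mem Q) u -> (k <= size u + d)%N ->
    all (mem P) w -> (d * m <= size w)%N -> (\prod_(x <- u) x) * (\prod_(x <- w) x) = 0.
  exists (k * m)%N => s sP sk; have := main k [::] s; rewrite big_nil mul1r.
  by apply=> //; rewrite sk.
elim: d => [|d IH] u w uQ ku wP mw.
  by rewrite (word_nil_ge HQ uQ) ?mul0r // -(addn0 (size u)).
have step i : (i <= m)%N -> forall w, all (mem P) w -> (d * m + (m - i) <= size w)%N ->
    (\prod_(x <- u) x) * (p ^+ i * (\prod_(x <- w) x)) = 0.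
  elim: {i}(m - i)%N {-2}i (erefl (m - i)%N) => [|e IHe] i ei im {mw wP} w wP mw.
    have -> : i = m by apply/eqP; rewrite eqn_leq im -subn_eq0 ei.
    by rewrite pm mul0r mulr0.
  case: w wP mw => [|x w] /=; first by rewrite ei addnS.
  rewrite -[x \in P]/(x \in P) => /andP [/memv_addP [_ /vlineP [a ->] [q qQ ->]] wP] mw.
  rewrite big_cons mulrDl mulrDr mulrDr -scalerAl -!scalerAr.
  rewrite [p ^+ i * (p * _)]mulrA -exprSr.
  have im' : (i < m)%N by rewrite -subn_gt0 ei.
  have e' : (m - i.+1)%N = e by rewrite subnS ei.
  rewrite (IHe i.+1 e' im' w wP) ?scaler0 ?add0r; last first.
    by rewrite e'; move: mw; rewrite ei addnS ltnS.
  rewrite (exp_shift (Q := Q)) ?addr0 // => q' j q'Q ji.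
  have := IH (rcons u q') (nseq j p ++ w).
  rewrite -cats1 !big_cat big_seq1 /= !all_cat uQ /= q'Q wP !size_cat /= all_nseq /= pP orbT.
  rewrite big_nseq iter_mulr_1 size_nseq -mulrA => -> //; first by move: ku; lia.
  by move: mw; rewrite ei; clear; lia.
have := step 0%N (leq0n m) w wP; rewrite expr0 mul1r => -> //.
by move: mw; rewrite mulSn; clear; lia.
Qed.

(** Starting from 0, [Q] is enlarged by one normalizing nilpotent element at a time, and the
    vanishing of long words survives each enlargement. *)
Theorem engel P : lie_closed P -> (forall x, x \in P -> nil x) -> exists k, word_nil P k.
Proof.
move=> PL Pnil.
suff H d : forall Q, (Q <= P)%VS -> lie_closed Q -> (exists k, word_nil Q k) ->
    (\dim P <= \dim Q + d)%N -> exists k, word_nil P k.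
  apply: (H (\dim P) 0%VS).
  - exact: sub0v.
  - by move=> x y; rewrite !memv0 => /eqP -> _; rewrite lie0x.
  - exists 1%N => -[|x []] //= /andP [+ _] _; rewrite big_seq1.
    by move=> x0; apply/eqP; rewrite -memv0.
  - exact: leq_addl.
elim: d => [|d IH] Q QP QL [k Qk] dQ.
  exists k; suff -> : P = Q by [].
  by apply/esym/eqP; rewrite eqEdim QP -(addn0 (\dim Q)).
have [PQ|PQ] := boolP (P <= Q)%VS.
  by exists k; suff -> : P = Q by []; apply/eqP; rewrite eqEsubv PQ.
have [|p [pP pQ] Hp] := @normalizing_elt P Q k.*2.-1 PL QP PQ.
  move=> s z sQ sk zP; have := @ads_word Q k s [::] [::] z Qk sQ isT isT.
  by rewrite !big_nil mul1r mulr1 sk add0n => /(_ (leqnn _)) ->; rewrite mem0v.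
have Hp' q : q \in Q -> lie p q \in Q by move=> qQ; rewrite lieC rpredN Hp.
apply: (IH (<[p]> + Q)%VS).
- by rewrite subv_add QP andbT -memvE.
- move=> _ _ /memv_addP [_ /vlineP [a ->] [x xQ ->]] /memv_addP [_ /vlineP [b ->] [y yQ ->]].
  apply: (subvP (addvSr _ _)); rewrite lieDl !lieDr !lieZl !lieZr liexx !scaler0 add0r.
  apply: rpredD; first by apply/rpredZ/Hp'.
  by apply: rpredD; [apply/rpredZ/Hp | apply: QL].
- by apply: word_nil_add_line Qk => //; apply: Pnil.
- have dl : (\dim Q < \dim (<[p]> + Q))%N.
    rewrite (ltn_leqif (dimv_leqif_sup (addvSr _ _))).
    by apply: contra pQ => /subvP; apply; apply: (subvP (addvSl _ _)); rewrite memv_line.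
  by move: dQ dl; clear; lia.
Qed.
End Engel.

(** * Envelopes and the derived series *)

Section Derived.
Context (F : fieldType) (n : nat).
Local Notation E := 'M[F]_n.+1.
Implicit Types (x y z p q a b c : E) (A B P Q S C R : {vspace E}) (s u w : seq E).

Definition brv A B : {vspace E} := <<[seq lie x y | x <- vbasis A, y <- vbasis B]>>%VS.

Lemma lie_suml (I : Type) (r : seq I) (f : I -> E) y :
  lie (\sum_(i <- r) f i) y = \sum_(i <- r) lie (f i) y.
Proof. by apply: (big_morph (fun x => lie x y)) => [x z|]; rewrite ?lieDl ?lie0x. Qed.
Lemma lie_sumr (I : Type) (r : seq I) (f : I -> E) y :
  lie y (\sum_(i <- r) f i) = \sum_(i <- r) lie y (f i).
Proof. by apply: (big_morph (fun x => lie y x)) => [x z|]; rewrite ?lieDr ?liex0. Qed.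

Lemma mem_brv A B x y : x \in A -> y \in B -> lie x y \in brv A B.
Proof.
move=> /coord_vbasis -> /coord_vbasis ->; rewrite lie_suml rpred_sum // => i _.
rewrite lie_sumr rpred_sum // => j _; rewrite lieZl lieZr !rpredZ // memv_span //.
by apply/allpairsP; exists ((vbasis A)`_i, (vbasis B)`_j); rewrite !memt_nth.
Qed.

Lemma brv_sub A B P : (forall x y, x \in A -> y \in B -> lie x y \in P) -> (brv A B <= P)%VS.
Proof.
move=> H; apply/span_subvP => _ /allpairsP [[x y] [/= xA yB ->]].
by apply: H; apply: vbasis_mem.
Qed.

Lemma brv_ind A B (P : E -> Prop) : P 0 -> (forall (k : F) x y, P x -> P y -> P (k *: x + y)) ->
  (forall x y, x \in A -> y \in B -> P (lie x y)) -> forall x, x \in brv A B -> P x.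
Proof.
move=> P0 PD PL x xAB; have [U UP] := vspace_of_pred P0 PD; apply/UP.
by apply: (subvP _ _ xAB); apply: brv_sub => y z yA zB; apply/UP/PL.
Qed.

Definition lie_ideal_in S A := forall x y, x \in S -> y \in A -> lie x y \in A.

Lemma brv_ideal S A B : lie_ideal_in S A -> lie_ideal_in S B -> lie_ideal_in S (brv A B).
Proof.
move=> HA HB x y xS; apply: (brv_ind (P := fun y => lie x y \in brv A B)).
- by rewrite liex0 mem0v.
- by move=> a u v Hu Hv; rewrite lieDr lieZr rpredD ?rpredZ.
- by move=> u v uA vB; rewrite jacobi rpredD // mem_brv // ?HA ?HB.
Qed.

Lemma brvS A B A' B' : (A <= A')%VS -> (B <= B')%VS -> (brv A B <= brv A' B')%VS.
Proof.
move=> AA BB; apply: brv_sub => x y xA yB; apply: mem_brv; first exact: (subvP AA).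
exact: (subvP BB).
Qed.

Definition dser A k := iter k (fun B => brv B B) A.

Lemma dserS A k : dser A k.+1 = dser (brv A A) k.
Proof. exact: iterSr. Qed.

Lemma dser_ideal S A k : lie_ideal_in S A -> lie_ideal_in S (dser A k).
Proof. by move=> SA; elim: k => //= k IH; apply: brv_ideal. Qed.

Lemma dser_sub A k : lie_closed A -> (dser A k <= A)%VS.
Proof.
move=> AL; elim: k => [|k IH] /=; first exact: subvv.
apply: brv_sub => x y xA yA; apply: AL; exact: (subvP IH).
Qed.

Lemma dser_mono A B k : (A <= B)%VS -> (dser A k <= dser B k)%VS.
Proof. by move=> AB; elim: k => [|k IH] //=; apply: brvS. Qed.

(** The unital associative algebra generated by [S]; the inductive form allows proofs by induction
    on how an element is generated. *)
Inductive env S : E -> Prop :=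
| env_one : env S 1
| env_gen x of x \in S : env S x
| env_lin (k : F) x y of env S x & env S y : env S (k *: x + y)
| env_mul x y of env S x & env S y : env S (x * y).

Lemma envD S x y : env S x -> env S y -> env S (x + y).
Proof. by move=> ex ey; rewrite -[x]scale1r; apply: env_lin. Qed.
Lemma env0 S : env S 0.
Proof.
by rewrite -[0](addNr 1) -[- 1]scaleN1r; apply: env_lin; apply: env_one.
Qed.
Lemma envZ S k x : env S x -> env S (k *: x).
Proof. by move=> ex; rewrite -[_ *: _]addr0; apply: env_lin => //; apply: env0. Qed.
Lemma envN S x : env S x -> env S (- x).
Proof. by move=> ex; rewrite -scaleN1r; apply: envZ. Qed.
Lemma envX S x k : env S x -> env S (x ^+ k).
Proof.
by move=> ex; elim: k => [|k IH]; rewrite ?expr0 ?exprS; [apply: env_one | apply: env_mul].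
Qed.
Lemma env_sub S S' x : (S <= S')%VS -> env S x -> env S' x.
Proof.
move=> SS; elim=> [|y yS|k y z _ IH1 _ IH2|y z _ IH1 _ IH2].
- exact: env_one.
- by apply/env_gen/(subvP SS).
- exact: env_lin.
- exact: env_mul.
Qed.

(* Elements killed by right multiplication with every C-word of length i are
   stable under right multiplication by the envelope of S, so each factor c
   lowers i by one. *)
Section NilIdeal.
Variables (S C : {vspace E}) (k : nat).
Hypotheses (CI : lie_ideal_in S C) (Ck : word_nil C k).

Let V i a := forall u, all (mem C) u -> size u = i -> a * \prod_(x <- u) x = 0.

Lemma V_gen i a (s : E) : s \in S -> V i a -> V i (a * s).
Proof.
move=> sS.
suff H u : forall w, all (mem C) w -> all (mem C) u -> V (size w + size u) a ->
    a * \prod_(x <- w) x * s * \prod_(x <- u) x = 0.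
  move=> Va u uC ui; have := H u [::] isT uC; rewrite big_nil mulr1; apply.
  by rewrite add0n ui.
elim: u => [|c u IH] w wC /=.
  by rewrite addn0 big_nil mulr1 => _ Vw; rewrite Vw ?mul0r.
move=> /andP [cC uC] Vw; rewrite big_cons.
have -> : a * \prod_(x <- w) x * s * (c * \prod_(x <- u) x) =
    a * (\prod_(x <- w) x * c) * s * \prod_(x <- u) x
    + a * (\prod_(x <- w) x * (lie s c * \prod_(x <- u) x)) by rewrite !lieE; ncring.
have := IH (rcons w c); rewrite -cats1 big_cat big_seq1 /= all_cat wC /= cC => -> //; last first.
  by rewrite size_cat /= -addnA add1n.
have := Vw (w ++ lie s c :: u); rewrite big_cat /= big_cons => -> //; first by rewrite addr0.
  by rewrite all_cat wC /= CI.
by rewrite size_cat.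
Qed.

Lemma V_env i a b : env S b -> V i a -> V i (a * b).
Proof.
move=> eb; elim: eb a => [|x xS|l x y _ IH1 _ IH2|x y _ IH1 _ IH2] a Va.
- by rewrite mulr1.
- exact: V_gen.
- move=> u uC ui; rewrite mulrDr -scalerAr mulrDl -scalerAl.
  by rewrite (IH1 _ Va) // (IH2 _ Va) // scaler0 addr0.
- by rewrite mulrA; apply/IH2/IH1.
Qed.

Lemma nil_ideal_nil c b : c \in C -> env S b -> nil (c * b).
Proof.
move=> cC eb; exists k.
suff H j : (j <= k)%N -> V (k - j) ((c * b) ^+ j).
  have := H k (leqnn k) [::] isT; rewrite big_nil mulr1 subnn; exact.
elim: j => [|j IH] jk.
  by rewrite subn0 expr0 => u uC uk; rewrite mul1r Ck.
rewrite exprSr mulrA; apply: V_env => // u uC uk.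
have := IH (ltnW jk) (c :: u); rewrite big_cons /= cC uC uk subnSK // => /(_ isT erefl).
by rewrite mulrA.
Qed.
End NilIdeal.

(** Bracketing with [r] is a derivation, and cyclicity of the trace moves the surplus factors [z]
    into the test element [b]. *)
Lemma tr_pow_lie S z r : (forall b, env S b -> \tr (lie z r * b) = 0) -> env S z ->
  forall j b, env S b -> \tr (lie (z ^+ j) r * b) = 0.
Proof.
move=> H ez; elim=> [|j IH] b eb.
  by rewrite expr0 !lieE mul1r mulr1 subrr mul0r linear0.
rewrite exprS lieMl mulrDl linearD /= -!mulrA trC -!mulrA IH ?H ?addr0 //; last exact: env_mul.
by apply/env_mul=> //; apply: envX.
Qed.
End Derived.

(** * Trace-null ideals from solvable ideals *)

Section Solvable.
Context (F : closedFieldType) (n : nat).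
Hypothesis char0 : [pchar F] =i pred0.
Local Notation E := 'M[F]_n.+1.
Implicit Types (x y z r b : E) (S C R : {vspace E}).

Lemma nil_ideal_tr S C : (C <= S)%VS -> lie_ideal_in S C -> (forall x, x \in C -> nil x) ->
  forall c b, c \in C -> env S b -> \tr (c * b) = 0.
Proof.
move=> CS CI Cnil c b cC eb.
have [|k Ck] := @engel _ _ C _ Cnil.
  by move=> x y xC yC; apply: CI => //; apply: (subvP CS).
by apply: nil_tr0; apply: nil_ideal_nil CI Ck _ _ cC eb.
Qed.

(** This takes the place of Lie's theorem and uses no common eigenvector. By induction on the
    derived length, [[S, R']] with [R' = [R, R]] is trace-null. Then [\tr (z ^+ j * [x, y]) = \tr
    ([z ^+ j, x] * y)] shows that [R'] consists of nilpotent matrices, hence is trace-null by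
    Engel's theorem, and the same computation one step higher gives this for [[S, R]]. *)
Lemma tr_lie_solvable S R k : lie_closed S -> (R <= S)%VS -> lie_ideal_in S R -> dser R k = 0%VS ->
  forall z b, z \in brv S R -> env S b -> \tr (z * b) = 0.
Proof.
move=> SL; elim: k R => [|k IH] R RS RI.
  move=> R0 z b; suff /subvP H : (brv S R <= 0)%VS.
    by move=> /H; rewrite memv0 => /eqP -> _; rewrite mul0r linear0.
  apply: brv_sub => x y xS; rewrite -[R]/(dser R 0) R0 !memv0 => /eqP ->.
  by rewrite liex0.
rewrite dserS => Rk; set R' := brv R R.
have R'I : lie_ideal_in S R' by apply: brv_ideal.
have R'R : (R' <= R)%VS by apply: brv_sub => x y xR yR; apply: RI => //; apply: (subvP RS).
have R'S := subv_trans R'R RS.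
have {}IH := IH R' R'S R'I Rk.
have BRR : (brv S R <= R)%VS by apply: brv_sub.
have R'tr c b : c \in R' -> env S b -> \tr (c * b) = 0.
  apply: nil_ideal_tr => // z zR'; apply: tr_pow_nil => // j.
  have ez : env S z by apply/env_gen/(subvP R'S).
  rewrite exprSr; move: {-2}z (zR'); apply: brv_ind.
  - by rewrite mulr0 linear0.
  - by move=> a x y hx hy; rewrite mulrDr -scalerAr linearD /= linearZ /= hx hy mulr0 addr0.
  - move=> x y xR yR; rewrite -tr_lie (@tr_pow_lie _ _ S) //.
      move=> b' eb; apply: IH => //; rewrite lieC rpredN; apply: mem_brv => //.
      exact: (subvP RS).
    by apply/env_gen/(subvP RS).
apply: nil_ideal_tr; first exact: subv_trans BRR RS.
  by apply: brv_ideal => // x y xS yS; apply: RI.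
move=> z zR; apply: tr_pow_nil => // j.
have zRR := subvP BRR _ zR.
have ez : env S z by apply/env_gen/(subvP RS).
rewrite exprSr; move: {-2}z (zR); apply: brv_ind.
- by rewrite mulr0 linear0.
- by move=> a x y hx hy; rewrite mulrDr -scalerAr linearD /= linearZ /= hx hy mulr0 addr0.
- move=> x y xS yR; rewrite lieC mulrN linearN /= -tr_lie (@tr_pow_lie _ _ S) ?oppr0 //.
    by move=> b' eb; apply: R'tr => //; apply: mem_brv.
  exact: env_gen.
Qed.
End Solvable.

(** * Cartan's criterion *)

Section PolyCRT.
Context (F : fieldType).
Implicit Types (p q : {poly F}) (rs : seq F).

Lemma coprimep_XsubC_exp (a b : F) j k : a != b ->
  coprimep (('X - a%:P) ^+ j) (('X - b%:P) ^+ k).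
Proof.
move=> ab; apply: coprimep_expl; apply: coprimep_expr; apply: coprimep_XsubC2.
by rewrite subr_eq0 eq_sym.
Qed.

Lemma coprimep_prod_XsubC_exp rs (m : F -> nat) (a : F) k : a \notin rs ->
  coprimep (\prod_(r <- rs) ('X - r%:P) ^+ m r) (('X - a%:P) ^+ k).
Proof.
elim: rs => [|r rs IH]; first by rewrite big_nil coprime1p.
rewrite inE negb_or => /andP [ar ars]; rewrite big_cons coprimepMl IH // andbT.
by apply: coprimep_XsubC_exp; rewrite eq_sym.
Qed.

Lemma dvdp_prod_XsubC_exp rs (m : F -> nat) p : uniq rs ->
  (forall r, r \in rs -> ('X - r%:P) ^+ m r %| p) ->
  \prod_(r <- rs) ('X - r%:P) ^+ m r %| p.
Proof.
elim: rs => [|r rs IH] /=; first by rewrite big_nil dvd1p.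
move=> /andP [rrs urs] H; rewrite big_cons Gauss_dvdp; last first.
  by rewrite coprimep_sym; apply: coprimep_prod_XsubC_exp.
rewrite H ?mem_head //= IH // => z zrs; apply: H; by rewrite inE zrs orbT.
Qed.

Lemma poly_crt rs (g : F -> F) k : uniq rs ->
  exists p, forall r, r \in rs -> ('X - r%:P) ^+ k %| p - (g r)%:P.
Proof.
elim: rs => [|r rs IH] /=; first by exists 0.
move=> /andP [rrs /IH [p Hp]].
have := coprimep_prod_XsubC_exp (fun=> k) k rrs; set M := \prod_(_ <- _) _ => cop.
have [[u v] /= uv] := Bezout_eq1_coprimepP _ _ cop.
exists (p + ((g r)%:P - p) * (u * M)) => z; rewrite inE => /orP [/eqP ->|zrs].
  have -> : p + ((g r)%:P - p) * (u * M) - (g r)%:P =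
      (p - (g r)%:P) * v * ('X - r%:P) ^+ k.
    by rewrite -mulrA -[in RHS](addKr (u * M) (v * _)) uv; ring.
  exact: dvdp_mull.
have -> : p + ((g r)%:P - p) * (u * M) - (g z)%:P =
    p - (g z)%:P + ((g r)%:P - p) * u * M by ring.
apply: dvdp_add; first exact: Hp.
apply: dvdp_mull; rewrite /M (big_rem z) //=; exact: dvdp_mulr.
Qed.
End PolyCRT.

Section Spectral.
Context (F : closedFieldType) (n : nat).
Local Notation E := 'M[F]_n.+1.
Implicit Types (x b : E) (A B : {vspace E}).

Lemma horner_mx_dvd x (p d : {poly F}) : d %| p -> horner_mx x d = 0 -> horner_mx x p = 0.
Proof. by move=> /dvdpP [q ->] d0; rewrite rmorphM /= d0 mulr0. Qed.

(** The projection for [r] is a polynomial in [x] congruent to 1 modulo [('X - r%:P) ^+ n.+1] and to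
    0 modulo the same power of the other factors; [n.+1] bounds all multiplicities in the
    characteristic polynomial. *)
Lemma spectral_projections x : exists (rs : seq F) (pr : F -> E),
  [/\ uniq rs, \sum_(r <- rs) pr r = 1,
      forall r, r \in rs -> pr r * pr r = pr r,
      forall r, r \in rs -> (x - r%:M) ^+ n.+1 * pr r = 0 &
      forall r, pr r * x = x * pr r].
Proof.
have [r0 E0] := closed_field_poly_normal (char_poly x).
have /monicP lc := char_poly_monic x; rewrite lc scale1r in E0.
set rs := undup r0.
have urs : uniq rs by apply: undup_uniq.
have vanish p : (forall r, r \in rs -> ('X - r%:P) ^+ n.+1 %| p) -> horner_mx x p = 0.
  move=> H; apply: (horner_mx_dvd (d := char_poly x)); last exact: Cayley_Hamilton.
  rewrite E0 -big_undup_iterop_count /=.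
  apply: (@dvdp_prod_XsubC_exp _ _ (fun r => count_mem r r0)) => // r /H; apply: dvdp_trans.
  apply: dvdp_exp2l; apply: leq_trans (count_size _ _) _.
  by rewrite -ltnS -(size_char_poly x) E0 size_prod_XsubC.
have /choice [p Hp] : forall r, exists p : {poly F}, forall z, z \in rs ->
    ('X - z%:P) ^+ n.+1 %| p - (z == r)%:R%:P.
  by move=> r; apply: (poly_crt (fun z => (z == r)%:R)).
have Hx r : horner_mx x ('X - r%:P) = x - r%:M.
  by rewrite rmorphB /= horner_mx_X horner_mx_C.
exists rs, (fun r => horner_mx x (p r)); split=> //.
- apply/eqP; rewrite -subr_eq0 -[X in _ - X](rmorph1 (horner_mx x)) -rmorph_sum -rmorphB /=.
  apply/eqP/vanish => z zrs.
  have S1 : \sum_(r <- rs) (z == r)%:R = 1 :> F.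
    rewrite (bigD1_seq z) //= eqxx big1 ?addr0 // => i.
    by rewrite eq_sym => /negbTE ->.
  have -> : (1 : {poly F}) = \sum_(r <- rs) (z == r)%:R%:P.
    by rewrite -rmorph_sum /= S1.
  rewrite -sumrB; apply: (big_ind (fun q : {poly F} => ('X - z%:P) ^+ n.+1 %| q)) => [|u v|i _];
    first exact: dvdp0; first exact: dvdp_add.
  exact: Hp.
- move=> r rrs; apply/eqP; rewrite -subr_eq0 -rmorphM -rmorphB; apply/eqP/vanish => z zrs.
  have -> : p r * p r - p r = (p r - (z == r)%:R%:P) * (p r - (z != r)%:R%:P).
    case: (z == r); rewrite /= ?polyC0 ?polyC1; ring.
  exact/dvdp_mulr/Hp.
- move=> r rrs; rewrite -Hx -rmorphXn -rmorphM; apply: vanish => z zrs.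
  have [->|zr] := eqVneq z r; first exact: dvdp_mulr.
  apply: dvdp_mull; have := Hp r z zrs; by rewrite (negbTE zr) polyC0 subr0.
- by move=> r; apply/esym/comm_mx_horner/comm_mx_refl.
Qed.

(** Left multiplication by [a] and right multiplication by [d] commute, and in each term of degree
    [2N] one of them occurs at least [N] times. *)
Lemma ad_word_nil (a d u : E) N : a ^+ N * u = 0 -> u * d ^+ N = 0 ->
  iter N.*2 (fun z => a * z - z * d) u = 0.
Proof.
move=> au ud.
suff H t i j : (N.*2 <= i + j + t)%N ->
    a ^+ i * iter t (fun z => a * z - z * d) u * d ^+ j = 0.
  by have := H N.*2 0%N 0%N (leqnn _); rewrite !expr0 mul1r mulr1.
elim: t i j => [|t IH] i j /= sz.
  have [Ni|iN] := leqP N i.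
    by rewrite -(subnK Ni) exprD -(mulrA _ _ u) au mulr0 mul0r.
  have Nj : (N <= j)%N by move: sz iN; clear; lia.
  by rewrite -mulrA -(subnKC Nj) exprD (mulrA u) ud mul0r mulr0.
rewrite mulrBr mulrBl mulrA -exprSr (IH i.+1 j); last by move: sz; clear; lia.
by rewrite -!mulrA -exprS !mulrA (IH i j.+1) ?subrr //; move: sz; clear; lia.
Qed.
End Spectral.

Section AdPoly.
Context (F : fieldType) (n : nat).
Local Notation E := 'M[F]_n.+1.
Implicit Types (x b : E) (A B : {vspace E}) (p q : {poly F}).

Lemma lie_is_linear x : linear (lie x : E -> E).
Proof. by move=> a u v; rewrite lieDr lieZr. Qed.
HB.instance Definition _ x := GRing.isLinear.Build F E E _ (lie x : E -> E) (lie_is_linear x).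

(** The polynomial [p] in [ad x], applied to [b] through vectorized matrices. The size index
    [n + n * n.+1] is used because its successor is convertible to [n.+1 * n.+1]. *)
Definition ad_horner x p b : E :=
  vec_mx (mxvec b *m @horner_mx F (n + n * n.+1) (lin_mx (lie x)) p : 'rV_(n.+1 * n.+1)).

Lemma ad_hornerD x p q b : ad_horner x (p + q) b = ad_horner x p b + ad_horner x q b.
Proof. by rewrite /ad_horner rmorphD mulmxDr linearD. Qed.
Lemma ad_hornerDr x p b c : ad_horner x p (b + c) = ad_horner x p b + ad_horner x p c.
Proof. by rewrite /ad_horner linearD mulmxDl linearD. Qed.
Lemma ad_hornerM x p q b : ad_horner x (p * q) b = ad_horner x q (ad_horner x p b).
Proof. by rewrite /ad_horner rmorphM /= -mulmxE mulmxA vec_mxK. Qed.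
Lemma ad_hornerX x b : ad_horner x 'X b = lie x b.
Proof.
rewrite /ad_horner horner_mx_X -[RHS]mxvecK; congr (vec_mx _).
exact: (mul_vec_lin (lie x : {linear E -> E})).
Qed.
Lemma ad_hornerC x a b : ad_horner x a%:P b = a *: b.
Proof. by rewrite /ad_horner horner_mx_C mul_mx_scalar linearZ /= mxvecK. Qed.
Lemma ad_horner0 x b : ad_horner x 0 b = 0.
Proof. by rewrite -polyC0 ad_hornerC scale0r. Qed.
Lemma ad_hornerr0 x p : ad_horner x p 0 = 0.
Proof. by rewrite /ad_horner linear0 mul0mx linear0. Qed.

Lemma ad_horner_stable x A p : (forall b, b \in A -> lie x b \in A) ->
  forall b, b \in A -> ad_horner x p b \in A.
Proof.
move=> H; elim/poly_ind: p => [|p c IH] b bA; first by rewrite ad_horner0 mem0v.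
by rewrite ad_hornerD ad_hornerC ad_hornerM ad_hornerX rpredD ?rpredZ // H ?IH.
Qed.

Lemma ad_horner_XsubC_exp x r k b :
  ad_horner x (('X - r%:P) ^+ k) b = iter k (fun z => lie x z - r *: z) b.
Proof.
elim: k => [|k IH]; first by rewrite expr0 -polyC1 ad_hornerC scale1r.
by rewrite exprSr ad_hornerM IH -polyCN ad_hornerD ad_hornerX ad_hornerC scaleNr.
Qed.
End AdPoly.

Notation C := complex.

Definition Cconj (z : C) : C := Cplx (cre z) (Ropp (cim z)).

Lemma CconjB z w : Cconj (z - w) = Cconj z - Cconj w.
Proof. case: z => a b; case: w => c d; apply: Cext => //=; lra. Qed.

(** All terms are nonnegative reals. This positivity stands in for the rational linear functionals
    of the usual proof of Cartan's criterion. *)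
Lemma norm_sum_eq0 (rs : seq C) (m : C -> nat) :
  \sum_(r <- rs) Cconj r * r * (m r)%:R = 0 -> forall r, r \in rs -> r = 0 \/ m r = 0%N.
Proof.
have normE r : Cconj r * r * (m r)%:R =
    Cplx (Rmult (Rplus (Rmult (cre r) (cre r)) (Rmult (cim r) (cim r))) (INR (m r))) R0.
  by rewrite natr_complex; case: r (INR _) => a b k; apply: Cext => /=; lra.
have pos r : Rle R0 (Rmult (Rplus (Rmult (cre r) (cre r)) (Rmult (cim r) (cim r))) (INR (m r))).
  by apply: Rmult_le_pos; [nra | apply: pos_INR].
have creD (z w : C) : cre (z + w) = Rplus (cre z) (cre w) by [].
have sumpos (s : seq C) : Rle R0 (cre (\sum_(r <- s) Cconj r * r * (m r)%:R)).
  elim: s => [|r s IH]; first by rewrite big_nil; apply: Rle_refl.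
  rewrite big_cons creD; apply: Rplus_le_le_0_compat => //.
  by rewrite normE; apply: pos.
elim: rs => [|z rs IH] //; rewrite big_cons => H0.
have H1 : Rplus (cre (Cconj z * z * (m z)%:R)) (cre (\sum_(r <- rs) Cconj r * r * (m r)%:R)) = R0.
  by rewrite -creD H0.
have := sumpos rs; have := pos z; move: H1; rewrite {1}normE /= => H1 p1 p2.
have z0 : Cconj z * z * (m z)%:R = 0 by rewrite normE; apply: Cext => //; apply: Rle_antisym; lra.
move=> r; rewrite inE => /orP [/eqP ->|]; last first.
  by apply: IH; move: H0; rewrite z0 add0r.
have : Rmult (Rplus (Rmult (cre z) (cre z)) (Rmult (cim z) (cim z))) (INR (m z)) = R0.
  by move: z0; rewrite normE => -[].
move/Rmult_integral => [h|h]; [left|by right; apply: INR_eq].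
by case: z h {IH H0 H1 p1 p2 z0} => a b /= h; apply: Cext; nra.
Qed.

Section Cartan.
Context (n : nat).
Local Notation E := 'M[C]_n.+1.
Implicit Types (x y b : E) (A B : {vspace E}).

(* y is the complex conjugate of the semisimple part of x *)
Lemma cartan_conj x : exists y, (\tr (x * y) = 0 -> nil x) /\
  forall A B, (A <= B)%VS -> (forall b, b \in B -> lie x b \in A) ->
    forall b, b \in B -> lie y b \in A.
Proof.
have [rs [pr [urs pr1 prI prN prC]]] := spectral_projections x.
pose y := \sum_(r <- rs) Cconj r *: pr r.
exists y; split.
  move=> txy.
  have trE : \tr (x * y) = \sum_(r <- rs) Cconj r * r * (\rank (pr r))%:R.
    rewrite mulr_sumr linear_sum /= big_seq [RHS]big_seq; apply: eq_bigr => r rrs.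
    rewrite -scalerAr linearZ /= -mulrA; congr (_ * _).
    have -> : x * pr r = (x - r%:M) * pr r + r *: pr r.
      by rewrite mulrBl -scalemx1 -mulmxE -scalemxAl mul1mx subrK.
    rewrite linearD linearZ /= (tr_idem (prI r rrs)) nil_tr0 ?add0r //.
    have cx : GRing.comm (x - r%:M) (pr r).
      by rewrite /GRing.comm mulrBl mulrBr -prC; congr (_ - _); rewrite -!mulmxE -scalar_mxC.
    exists n.+1; rewrite (exprMn_comm _ cx) [pr r ^+ _]exprS mulrA prN // mul0r //.
  rewrite trE in txy; have rk := norm_sum_eq0 txy.
  exists n.+1; rewrite -[_ ^+ _]mulr1 -pr1 mulr_sumr big_seq big1 // => r rrs.
  have [r0|] := rk r rrs; last by move/eqP; rewrite mxrank_eq0 => /eqP ->; rewrite mulr0.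
  by have := prN r rrs; rewrite r0 raddf0 subr0.
move=> A B AB Hx b bB.
(* [p] is congruent to the conjugate of [d] modulo a power of ['X - d] for every difference [d] of
   eigenvalues, so [p] evaluated at [ad x] is [ad y]. The exponent is [2(n + 1)] because on a block
   [ad x] is a scalar plus two commuting nilpotents of order at most [n + 1]. The entry 0 forces
   ['X] to divide [p], whence [ad y] maps [B] into [A]. *)
pose ds := undup (0 :: [seq r - s | r <- rs, s <- rs]).
have [p Hp] := @poly_crt _ ds Cconj (n.+1).*2 (undup_uniq _).
have block r s u : r \in rs -> s \in rs ->
    ad_horner x p (pr r * u * pr s) = Cconj (r - s) *: (pr r * u * pr s).
  move=> rrs srs; have : r - s \in ds.
    by rewrite mem_undup inE; apply/orP; right; apply/allpairsP; exists (r, s).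
  move=> /Hp /dvdpP [q qE].
  have -> : p = ('X - (r - s)%:P) ^+ (n.+1).*2 * q + (Cconj (r - s))%:P.
    by rewrite mulrC -qE subrK.
  rewrite ad_hornerD ad_hornerC ad_hornerM ad_horner_XsubC_exp.
  rewrite (_ : iter _ _ _ = 0) ?ad_hornerr0 ?add0r //.
  have sN : pr s * (x - s%:M) ^+ n.+1 = 0.
    have cs : GRing.comm (pr s) (x - s%:M).
      by rewrite /GRing.comm mulrBl mulrBr prC; congr (_ - _); rewrite -!mulmxE -scalar_mxC.
    by rewrite (commrX _ cs) prN.
  rewrite -[RHS](@ad_word_nil _ _ (x - r%:M) (x - s%:M) (pr r * u * pr s) n.+1).
  - apply: eq_iter => z; rewrite !lieE mulrBl mulrBr scalerBl -!mulmxE.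
    by rewrite mul_scalar_mx mul_mx_scalar; zmod.
  - by rewrite !mulrA prN // !mul0r.
  - by rewrite -mulrA sN mulr0.
have yE : lie y b = ad_horner x p b.
  have Eb u : u = \sum_(r <- rs) \sum_(s <- rs) pr r * u * pr s.
    rewrite -{1}[u]mul1r -{1}[u]mulr1 -pr1 mulr_suml; apply: eq_bigr => r _.
    by rewrite mulrA mulr_sumr.
  rewrite [b in RHS]Eb.
  have sumE (I : eqType) (s : seq I) (f : I -> E) :
      ad_horner x p (\sum_(i <- s) f i) = \sum_(i <- s) ad_horner x p (f i).
    by apply: (big_morph (ad_horner x p) _ (ad_hornerr0 x p)) => ? ?; rewrite ad_hornerDr.
  rewrite sumE.
  transitivity (\sum_(r <- rs) \sum_(s <- rs)
     (Cconj r *: (pr r * b * pr s) - Cconj s *: (pr r * b * pr s))); last first.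
    rewrite [LHS]big_seq [RHS]big_seq; apply: eq_bigr => r rrs; rewrite sumE.
    rewrite [LHS]big_seq [RHS]big_seq; apply: eq_bigr => s srs.
    by rewrite block // -scalerBl CconjB.
  under eq_bigr do rewrite sumrB.
  rewrite sumrB !lieE; congr (_ - _).
    rewrite mulr_suml; apply: eq_bigr => r _; rewrite -scaler_sumr -mulr_sumr pr1 mulr1.
    by rewrite scalerAl.
  rewrite exchange_big mulr_sumr; apply: eq_bigr => s _ /=.
  by rewrite -scaler_sumr -mulr_suml -mulr_suml pr1 mul1r scalerAr.
rewrite yE.
have : 0 \in ds by rewrite mem_undup inE eqxx.
move=> /Hp; have -> : Cconj 0 = 0 by apply: Cext => //=; lra.
rewrite !subr0 doubleS => /dvdpP [q ->].
rewrite mulrC exprS -mulrA ad_hornerM ad_hornerX.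
apply: ad_horner_stable (Hx b bB) => c cA; apply: Hx; exact: (subvP AB).
Qed.
End Cartan.

(** * Nondegenerate trace forms and the Casimir element *)

Lemma lie_ideal_closed (F : fieldType) n (P I : {vspace 'M[F]_n.+1}) :
  (I <= P)%VS -> lie_ideal_in P I -> lie_closed I.
Proof. by move=> IP II x y xI yI; apply: II => //; apply: (subvP IP). Qed.

(** Semisimplicity expressed without quotients or a Killing form; the zero algebra qualifies. *)
Definition no_abelian (F : fieldType) n (P : {vspace 'M[F]_n.+1}) :=
  forall I : {vspace 'M[F]_n.+1}, (I <= P)%VS -> lie_ideal_in P I ->
    (forall x y, x \in I -> y \in I -> lie x y = 0) -> I = 0%VS.

Definition tr_nondeg (F : fieldType) n (P : {vspace 'M[F]_n.+1}) :=
  forall x, x \in P -> (forall y, y \in P -> \tr (x * y) = 0) -> x = 0.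

Lemma no_abelian_solvable (F : fieldType) n (P I : {vspace 'M[F]_n.+1}) k :
  no_abelian P -> lie_closed P -> (I <= P)%VS -> lie_ideal_in P I -> dser I k = 0%VS -> I = 0%VS.
Proof.
move=> nP PL IP II; elim: k => // k IH dk; apply: IH.
have IL := lie_ideal_closed IP II.
apply: nP; first exact: subv_trans (dser_sub k IL) IP.
  exact: dser_ideal.
move=> x y xD yD; apply/eqP; rewrite -memv0 -dk; exact: mem_brv.
Qed.

Lemma dser_closed (F : fieldType) n (I : {vspace 'M[F]_n.+1}) k :
  lie_closed I -> lie_closed (dser I k).
Proof.
move=> IL; elim: k => // k IH x y /(subvP (brv_sub IH)) xI /(subvP (brv_sub IH)) yI.
exact: mem_brv.
Qed.

Lemma dser_stable (F : fieldType) n (I : {vspace 'M[F]_n.+1}) :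
  lie_closed I -> exists k, dser I k.+1 = dser I k.
Proof.
move=> IL; apply: contrapT => H.
have dec k : (dser I k.+1 <= dser I k)%VS.
  by apply: (@dser_sub _ _ _ 1%N); apply: dser_closed.
have dl k : (\dim (dser I k) + k <= \dim I)%N.
  elim: k => [|k IH]; first by rewrite addn0.
  apply: leq_trans IH; rewrite addnS -addSn leq_add2r.
  rewrite ltn_neqAle dimvS ?dec // andbT; apply/eqP => E; apply: H; exists k.
  by apply/eqP; rewrite eqEdim dec E leqnn.
by have := dl (\dim I).+1; rewrite addnS ltnNge leq_addl.
Qed.

(** Each letter is a combination of products of two letters, so the length at which words vanish can
    be lowered step by step to 1. *)
Lemma perfect_word_nil (F : fieldType) n (J : {vspace 'M[F]_n.+1}) k :
  brv J J = J -> word_nil J k -> J = 0%VS.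
Proof.
move=> JJ; case: k => [|k].
  move=> /(_ [::] isT erefl); rewrite big_nil => /eqP.
  by rewrite oner_eq0.
elim: k => [|k IH] Jk.
  apply/eqP; rewrite -subv0; apply/subvP => x xJ; rewrite memv0.
  by have := Jk [:: x]; rewrite big_seq1 /= xJ => ->.
apply: IH => -[|x s] //= /andP [xJ sJ] [sk]; rewrite big_cons.
rewrite -JJ in xJ; move: x xJ; apply: brv_ind.
- by rewrite mul0r.
- by move=> a x y; rewrite mulrDl -scalerAl => -> ->; rewrite scaler0 addr0.
- move=> x y xJ yJ; rewrite !lieE mulrBl.
  have := Jk (x :: y :: s); have := Jk (y :: x :: s).
  by rewrite !big_cons /= xJ yJ sJ sk !mulrA => -> // -> //; rewrite subrr.
Qed.

(** Let [I] be the radical of the trace form and [J] the stable term of its derived series. For [x =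
    [u, v]] with [u], [v] in [J] and any [y] normalizing [J], [\tr (x * y) = \tr (u * [v, y]) = 0].
    So [cartan_conj] makes the elements of [J] nilpotent, the perfect algebra [J] is zero, and [I]
    is a solvable ideal. *)
Lemma no_abelian_tr_nondeg n (P : {vspace 'M[C]_n.+1}) :
  lie_closed P -> no_abelian P -> tr_nondeg P.
Proof.
move=> PL nP.
have [|a u v|I HI] := @vspace_of_pred _ _
  (fun x : 'M[C]_n.+1 => x \in P /\ forall y, y \in P -> \tr (x * y) = 0).
- by split=> [|y _]; rewrite ?mem0v // mul0r linear0.
- move=> [uP hu] [vP hv]; split=> [|y yP]; first by rewrite rpredD ?rpredZ.
  by rewrite mulrDl -scalerAl linearD linearZ /= hu // hv // mulr0 addr0.
have IP : (I <= P)%VS by apply/subvP => x /HI [].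
have II : lie_ideal_in P I.
  move=> x y xP /HI [yP hy]; apply/HI; split; first exact: PL.
  by move=> z zP; rewrite lieC mulNr linearN /= tr_lie hy ?oppr0 // PL.
have IL := lie_ideal_closed IP II.
suff I0 : I = 0%VS.
  by move=> x xP hx; apply/eqP; rewrite -memv0 -I0; apply/HI.
have [k kE] := dser_stable IL; set J := dser I k in kE.
have JI : (J <= I)%VS by apply: dser_sub.
have JL : lie_closed J by move=> x y xJ yJ; rewrite -kE; apply: mem_brv.
have Jnil x : x \in J -> nil x.
  move=> xJ; have [y [ny Hy]] := cartan_conj x; apply: ny.
  have {}Hy := Hy J J (subvv _) (fun b => JL x b xJ).
  move: xJ; rewrite -kE; move: x; apply: brv_ind.
  - by rewrite mul0r linear0.
  - by move=> a u v hu hv; rewrite mulrDl -scalerAl linearD linearZ /= hu hv mulr0 addr0.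
  - move=> u v uJ vJ; rewrite tr_lie lieC mulrN linearN /=.
    have /HI [_ ->] := subvP JI _ uJ; first by rewrite oppr0.
    by apply/(subvP IP)/(subvP JI)/Hy.
have [k' Jk'] := engel JL Jnil.
exact: no_abelian_solvable nP PL IP II (perfect_word_nil kE Jk').
Qed.

Section DualBasis.
Context (F : fieldType) (n : nat) (P : {vspace 'M[F]_n.+1}).
Hypothesis nd : tr_nondeg P.
Local Notation d := (\dim P).
Local Notation E := 'M[F]_n.+1.
Let X (i : 'I_d) : E := (vbasis P)`_i.

Lemma tr_dual_basis : exists f : 'I_d -> E, (forall i, f i \in P) /\
  forall i k, \tr (f i * X k) = (i == k)%:R.
Proof.
have XP i : X i \in P by apply/vbasis_mem/memt_nth.
pose G := \matrix_(i < d, j < d) \tr (X i * X j).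
have GU : G \in unitmx.
  rewrite -row_free_unit -kermx_eq0; apply/eqP/row_matrixP => i; rewrite row0.
  have : row i (kermx G) *m G = 0 by apply/sub_kermxP/row_sub.
  move: (row i _) => v vG.
  pose x := \sum_j v 0 j *: X j.
  have xP : x \in P by apply: rpred_sum => j _; apply: rpredZ.
  have x0 : x = 0.
    apply: nd => // y /coord_vbasis ->; rewrite mulr_sumr linear_sum big1 //= => k _.
    rewrite -scalerAr linearZ /= mulr_suml linear_sum /=.
    have /matrixP /(_ 0 k) := vG; rewrite !mxE => vk.
    rewrite [X in _ * X](_ : _ = 0) ?mulr0 // -[RHS]vk; apply: eq_bigr => j _.
    by rewrite -scalerAl linearZ /= mxE.
  apply/rowP => j; rewrite mxE.
  by have /freeP := basis_free (vbasisP P); move/(_ (fun j => v 0 j) x0 j).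
exists (fun i => \sum_j invmx G i j *: X j); split=> [i|i k].
  by apply: rpred_sum => j _; apply: rpredZ.
rewrite mulr_suml linear_sum /=.
have /matrixP /(_ i k) := mulVmx GU; rewrite !mxE => <-.
by apply: eq_bigr => j _; rewrite -scalerAl linearZ /= mxE.
Qed.

Lemma tr_orth_proj z : exists2 u, u \in P & forall y, y \in P -> \tr (u * y) = \tr (z * y).
Proof.
have [f [fP fX]] := tr_dual_basis.
exists (\sum_i \tr (z * X i) *: f i); first by apply: rpred_sum => i _; apply: rpredZ.
move=> y /coord_vbasis ->; rewrite !mulr_sumr !linear_sum /=; apply: eq_bigr => k _.
rewrite -!scalerAr !linearZ /=; congr (_ * _).
rewrite mulr_suml linear_sum /= (bigD1 k) //= big1 => [|i ik].
  by rewrite -scalerAl linearZ /= fX eqxx mulr1 addr0.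
by rewrite -scalerAl linearZ /= fX (negbTE ik) mulr0.
Qed.

(** The Casimir element of the trace form: its trace is [\dim P], invariance of the form makes the
    two halves of its bracket cancel, and each summand ends in a factor from [P], which bounds the
    row space. *)
Lemma casimir : lie_closed P -> [pchar F] =i pred0 -> P != 0%VS ->
  exists c : E, [/\ \tr c != 0, forall x, x \in P -> lie x c = 0 &
    forall m (U : 'M_(m, n.+1)), (forall x, x \in P -> (x <= U)%MS) -> (c <= U)%MS].
Proof.
move=> PL char0 P0; have [f [fP fX]] := tr_dual_basis.
have XP i : X i \in P by apply/vbasis_mem/memt_nth.
exists (\sum_i X i * f i); split.
- rewrite linear_sum /= (eq_bigr (fun=> 1)) => [|i _]; last by rewrite trC fX eqxx.
  by rewrite sumr_const card_ord ((pcharf0P F).1 char0) dimv_eq0.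
- have exX z : z \in P -> z = \sum_i \tr (f i * z) *: X i.
    move=> zP; rewrite {1}(coord_vbasis zP); apply: eq_bigr => i _; congr (_ *: _).
    rewrite {2}(coord_vbasis zP) mulr_sumr linear_sum (bigD1 i) //= big1 => [|k ki].
      by rewrite -scalerAr linearZ /= fX eqxx mulr1 addr0.
    by rewrite -scalerAr linearZ /= fX eq_sym (negbTE ki) mulr0.
  have exf z : z \in P -> z = \sum_i \tr (z * X i) *: f i.
    move=> zP; apply/eqP; rewrite -subr_eq0; apply/eqP; apply: nd.
      by apply: rpredB => //; apply: rpred_sum => i _; exact/rpredZ/fP.
    move=> y /coord_vbasis ->; rewrite mulr_sumr linear_sum big1 //= => k _.
    rewrite -scalerAr linearZ /= mulrBl linearB /= mulr_suml linear_sum /=.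
    rewrite (bigD1 k) //= big1 => [|i ik].
      by rewrite -scalerAl linearZ /= fX eqxx mulr1 addr0 subrr mulr0.
    by rewrite -scalerAl linearZ /= fX (negbTE ik) mulr0.
  move=> x xP; rewrite lie_sumr.
  under eq_bigr do rewrite lieM.
  rewrite big_split /=.
  have -> : \sum_i lie x (X i) * f i =
      \sum_i \sum_j \tr (f j * lie x (X i)) *: (X j * f i).
    apply: eq_bigr => i _; rewrite {1}(exX (lie x (X i))) ?PL // mulr_suml.
    by apply: eq_bigr => j _; rewrite scalerAl.
  have -> : \sum_i X i * lie x (f i) =
      \sum_i \sum_j \tr (lie x (f i) * X j) *: (X i * f j).
    apply: eq_bigr => i _; rewrite {1}(exf (lie x (f i))) ?PL // mulr_sumr.
    by apply: eq_bigr => j _; rewrite scalerAr.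
  rewrite [X in _ + X]exchange_big -big_split big1 //= => i _.
  rewrite -big_split big1 //= => j _; rewrite -scalerDl -tr_lie -linearD -mulrDl.
  by rewrite [lie (f j) x]lieC addNr mul0r linear0 scale0r.
- move=> m U HU; apply: summx_sub => i _; apply: submx_trans (HU _ (fP i)).
  by rewrite -mulmxE submxMl.
Qed.
End DualBasis.

(** * Whitehead's first lemma *)

Definition hom_on (F : fieldType) m n (f : 'M[F]_m.+1 -> 'M[F]_n.+1) (P : {vspace 'M[F]_m.+1}) :=
  forall x y, x \in P -> y \in P -> f (lie x y) = lie (f x) (f y).

Section LinearFun.
Context (F : fieldType) (U V : lmodType F) (f : U -> V).
Hypothesis fl : linear f.
Lemma lin0 : f 0 = 0.
Proof. by have := fl (-1) 0 0; rewrite scaler0 addr0 scaleN1r addNr. Qed.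
Lemma linD x y : f (x + y) = f x + f y.
Proof. by have := fl 1 x y; rewrite !scale1r. Qed.
Lemma linZ a x : f (a *: x) = a *: f x.
Proof. by have := fl a x 0; rewrite !addr0 lin0 addr0. Qed.
Lemma linN x : f (- x) = - f x.
Proof. by rewrite -scaleN1r linZ scaleN1r. Qed.
Lemma linB x y : f (x - y) = f x - f y.
Proof. by rewrite linD linN. Qed.
End LinearFun.

Lemma vspace_img (F : fieldType) (U V : vectType F) (f : U -> V) (P : {vspace U}) :
  linear f -> exists Q : {vspace V}, forall z, z \in Q <-> exists2 x, x \in P & z = f x.
Proof.
move=> fl; apply: vspace_of_pred.
  by exists 0; rewrite ?mem0v // (lin0 fl).
move=> a _ _ [x xP ->] [y yP ->]; exists (a *: x + y); first by rewrite rpredD ?rpredZ.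
by rewrite fl.
Qed.

Section Image.
Context (m n : nat) (P : {vspace 'M[C]_m.+1}) (f : 'M[C]_m.+1 -> 'M[C]_n.+1).
Hypotheses (PL : lie_closed P) (fl : linear f) (fh : hom_on f P).
Variable Q : {vspace 'M[C]_n.+1}.
Hypothesis QP : forall z, z \in Q <-> exists2 x, x \in P & z = f x.

Lemma img_lie_closed : lie_closed Q.
Proof.
move=> _ _ /QP [x xP ->] /QP [y yP ->]; apply/QP; exists (lie x y); rewrite ?fh //.
exact: PL.
Qed.

(* By invariance of the trace form P is the direct sum of ker f and of its
   orthogonal complement, which f maps isomorphically onto Q. *)
Lemma img_no_abelian : no_abelian P -> no_abelian Q.
Proof.
move=> nP; have nd := no_abelian_tr_nondeg PL nP.
have [|a u v|b HI] := @vspace_of_pred _ _ (fun x : 'M[C]_m.+1 => x \in P /\ f x = 0).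
- by rewrite mem0v (lin0 fl).
- by move=> [uP fu] [vP fv]; rewrite rpredD ?rpredZ // fl fu fv scaler0 addr0.
have [|a u v|b' HI'] := @vspace_of_pred _ _
  (fun x : 'M[C]_m.+1 => x \in P /\ forall y, y \in b -> \tr (x * y) = 0).
- by split=> [|y _]; rewrite ?mem0v // mul0r linear0.
- move=> [uP hu] [vP hv]; split=> [|y yP]; first by rewrite rpredD ?rpredZ.
  by rewrite mulrDl -scalerAl linearD linearZ /= hu // hv // mulr0 addr0.
have bI : lie_ideal_in P b.
  move=> x y xP /HI [yP fy]; apply/HI; split; first exact: PL.
  by rewrite fh // fy liex0.
have b'I : lie_ideal_in P b'.
  move=> x y xP /HI' [yP hy]; apply/HI'; split; first exact: PL.
  by move=> z zb; rewrite lieC mulNr linearN /= tr_lie hy ?oppr0 // bI.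
have disj x : x \in b -> x \in b' -> x = 0.
  move=> xb xb'; suff E : (b :&: b' = 0)%VS by apply/eqP; rewrite -memv0 -E; apply/memv_capP.
  apply: nP.
  - by apply/subvP => y /memv_capP [/HI []].
  - by move=> y z yP /memv_capP [zb zb']; apply/memv_capP; split; [apply: bI | apply: b'I].
  - move=> y z /memv_capP [yb yb'] /memv_capP [zb zb'].
    have [[yP _] [zP _]] := ((HI y).1 yb, (HI z).1 zb).
    apply: nd; first exact: PL.
    move=> w wP; rewrite tr_lie lieC mulrN linearN /=.
    by have /HI' [_ ->] := yb'; rewrite ?oppr0 //; apply: bI.
have ndb : tr_nondeg b.
  by move=> x xb hx; apply: disj => //; apply/HI'; split=> //; have /HI [] := xb.
move=> c cQ cI cA.
have [|a u v|e HE] := @vspace_of_pred _ _ (fun x : 'M[C]_m.+1 => x \in b' /\ f x \in c).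
- by rewrite (lin0 fl) !mem0v.
- by move=> [ub fu] [vb fv]; rewrite fl !rpredD ?rpredZ.
have b'P x : x \in b' -> x \in P by case/HI'.
have e0 : e = 0%VS.
  apply: nP.
  - by apply/subvP => x /HE [/b'P].
  - move=> x y xP /HE [yb fy]; apply/HE; split; first exact: b'I.
    by rewrite (fh xP (b'P _ yb)); apply: cI => //; apply/QP; exists x.
  - move=> x y /HE [xb fx] /HE [yb fy]; apply: disj; last by apply: b'I => //; apply: b'P.
    by apply/HI; split; [apply: PL; apply: b'P | rewrite (fh (b'P _ xb) (b'P _ yb)) cA].
apply/eqP; rewrite -subv0; apply/subvP => z zc; rewrite memv0.
have /QP [x xP zE] := subvP cQ _ zc.
have [u ub uE] := tr_orth_proj ndb x; have [uP fu] := (HI u).1 ub.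
have fw : f (x - u) = z by rewrite (linB fl) fu subr0.
have : x - u \in e.
  apply/HE; rewrite fw; split=> //; apply/HI'; split; first exact: rpredB.
  by move=> y yb; rewrite mulrBl linearB /= uE // subrr.
by rewrite e0 memv0 -fw => /eqP ->; rewrite (lin0 fl).
Qed.
End Image.

(* The vanishing of H^1 in module form: for every representation of H killing
   the ideal a, elements of the module that H moves into U are invariant up to U. *)
Definition whitehead m (H a : {vspace 'M[C]_m.+1}) :=
  forall n (rho : 'M[C]_m.+1 -> 'M[C]_n.+1) (U : 'M[C]_n.+1),
    linear rho -> hom_on rho H -> (forall x, x \in a -> rho x = 0) ->
    (forall x, x \in H -> (rho x <= U)%MS) ->
    forall v : 'rV_n.+1, exists2 u : 'rV_n.+1, (u <= U)%MS &
      forall x, x \in H -> (v - u) *m rho x = 0.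

(** Induction on the dimension of the representation. The Casimir element of the image has nonzero
    trace, hence a nonzero Fitting idempotent [e], which commutes with the representation and has
    its row space in [U]. So [v *m e] is absorbed by [U], and the induction hypothesis handles the
    row space of [1 - e]. *)
Theorem no_abelian_whitehead m (P : {vspace 'M[C]_m.+1}) :
  lie_closed P -> no_abelian P -> whitehead P 0%VS.
Proof.
move=> PL nP n; have [N] := ubnP n; elim: N n => // N IH n nN rho U rl rh _ rU v.
have [Q QP] := vspace_img P rl.
have QL := img_lie_closed PL rh QP.
have nQ := img_no_abelian PL rl rh QP nP.
have ndQ := no_abelian_tr_nondeg QL nQ.
have rQ x : x \in P -> rho x \in Q by move=> xP; apply/QP; exists x.
have [Q0|Q0] := eqVneq Q 0%VS.
  exists 0; first exact: sub0mx.
  by move=> x /rQ; rewrite Q0 memv0 => /eqP ->; rewrite mulmx0.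
have [c [trc cQ cU]] := casimir ndQ QL complex_pchar0 Q0.
have {}cU : (c <= U)%MS by apply: cU => _ /QP [x xP ->]; apply: rU.
have nnil : ~ nil c by move/nil_tr0 => t0; rewrite t0 eqxx in trc.
have [p] := nonnil_idem nnil; set e := c * _ => -[e0 ee].
have eC : e = horner_mx c p * c by apply/comm_mx_horner/comm_mx_refl.
have eU : (e <= U)%MS by apply: submx_trans cU; rewrite eC -mulmxE submxMl.
have ecomm x : x \in P -> rho x * e = e * rho x.
  move=> xP; have xc : GRing.comm (rho x) c.
    by apply/eqP; rewrite -subr_eq0 -lieE; apply/eqP/cQ/rQ.
  apply: (commrM xc); exact: comm_mx_horner.
set e' : 'M_n.+1 := 1 - e.
have e'e' : e' * e' = e' by rewrite /e' mulrBr mulr1 mulrBl mul1r ee subrr subr0.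
have e'comm x : x \in P -> rho x * e' = e' * rho x.
  by move=> xP; rewrite /e' mulrBr mulrBl mulr1 mul1r ecomm.
have rk : (\rank e' < n.+1)%N.
  rewrite ltn_neqAle rank_leq_row andbT; apply: contra e0 => full.
  have /row_fullP [D De] : row_full e' by [].
  rewrite -[e]mul1r -[1]De mulmxE -(mulrA D) /e' mulrBl mul1r ee subrr mulr0 //.
have vE : v = v *m e' + v *m e by rewrite -mulmxDr subrK mulmx1.
case: (posnP (\rank e')) => [/eqP|rpos].
  rewrite mxrank_eq0 => /eqP e'0; exists v; last by move=> x _; rewrite subrr mul0mx.
  by rewrite vE e'0 mulmx0 add0r; apply: submx_trans eU; apply: submxMl.
set B := row_base e'; have BE : (B :=: e')%MS := eq_row_base e'.
have Bfree : row_free B := row_base_free e'.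
move: (\rank e') rk rpos B BE Bfree => [//|r] rn _ B BE Bfree.
(* The representation on the row space of [e'] in the basis [B]; [U0] below is the preimage of [U]
   under [w |-> w *m B]. *)
pose rho0 x : 'M_r.+1 := B *m rho x *m pinvmx B.
have Bst x : x \in P -> rho0 x *m B = B *m rho x.
  move=> xP; rewrite /rho0 mulmxKpV // BE.
  have /submxP [D ->] : (B <= e')%MS by rewrite BE.
  have h : e' *m rho x = rho x *m e' by apply/esym/e'comm.
  by rewrite -mulmxA h mulmxA submxMl.
have r0l : linear rho0.
  by move=> a x y; rewrite /rho0 rl mulmxDr -scalemxAr mulmxDl -scalemxAl.
clearbody rho0.
pose U0 : 'M_r.+1 := kermx (B *m cokermx U).
have U0P k (w : 'M_(k, r.+1)) : (w <= U0)%MS = (w *m B <= U)%MS.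
  by rewrite [in RHS]submxE -mulmxA; apply/sub_kermxP/eqP.
have [|x y xP yP|x|x xP|w] := @IH r _ rho0 U0 r0l _ _ _ ((v *m e') *m pinvmx B).
- by rewrite -ltnS; apply: leq_trans nN; exact: rn.
- apply: (row_free_inj Bfree); rewrite Bst ?PL // rh // !lieE mulmxBl -!mulmxE mulmxBr.
  by rewrite -!mulmxA !Bst // !mulmxA !Bst.
- by rewrite memv0 => /eqP ->; rewrite (lin0 r0l).
- by rewrite U0P Bst //; apply: submx_trans (rU _ xP); apply: submxMl.
rewrite U0P => wU Hw.
exists (v *m e + w *m B); first by rewrite addmx_sub //; apply: submx_trans eU; apply: submxMl.
move=> x xP; have /(congr1 (fun z => z *m B)) := Hw x xP.
rewrite mul0mx -mulmxA Bst // mulmxA mulmxBl mulmxKpV ?BE ?submxMl // => <-.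
by congr (_ *m _); rewrite {1}vE; zmod.
Qed.

Lemma lin_sum (F : fieldType) (U V : lmodType F) (f : U -> V) (I : Type) (r : seq I) (g : I -> U) :
  linear f -> f (\sum_(i <- r) g i) = \sum_(i <- r) f (g i).
Proof. by move=> fl; apply: (big_morph f (linD fl) (lin0 fl)). Qed.

Lemma lfun_lin (F : fieldType) (U V : vectType F) (f : 'Hom(U, V)) a u v :
  f (a *: u + v) = a *: f u + f v.
Proof. exact: linearP. Qed.

Lemma rowspace_of_pred (F : fieldType) n (P : 'rV[F]_n -> Prop) :
  P 0 -> (forall a u v, P u -> P v -> P (a *: u + v)) ->
  exists U : 'M[F]_n, forall v, (v <= U)%MS <-> P v.
Proof.
move=> P0 PD; have [W WP] := vspace_of_pred P0 PD.
pose M := \matrix_(i < \dim W) (vbasis W)`_i.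
exists <<M>>%MS => v; rewrite genmxE; split.
  case/submxP => D ->; apply/WP; rewrite mulmx_sum_row rpred_sum // => i _.
  by rewrite rpredZ // rowK; apply/vbasis_mem/memt_nth.
move=> /WP /coord_vbasis ->; apply: summx_sub => i _; apply: scalemx_sub.
by rewrite -[_`_i](rowK (fun i : 'I_(\dim W) => (vbasis W)`_i)) row_sub.
Qed.

Lemma linear_section (F : fieldType) (U V : vectType F) (f : U -> V) (H : {vspace U}) (Q : {vspace V}) :
  linear f -> (forall z, z \in Q -> exists2 x, x \in H & z = f x) ->
  exists g : V -> U, [/\ linear g, forall z, g z \in H & forall z, z \in Q -> f (g z) = z].
Proof.
move=> fl HQ.
have /choice [h hP] : forall i : 'I_(\dim Q), exists x, x \in H /\ (vbasis Q)`_i = f x.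
  by move=> i; have [|x xH E] := HQ (vbasis Q)`_i; [apply/vbasis_mem/memt_nth | exists x].
exists (fun z => \sum_i coord (vbasis Q) i z *: h i); split.
- move=> a z w; rewrite scaler_sumr -big_split; apply: eq_bigr => i _ /=.
  by rewrite linearP scalerDl scalerA.
- by move=> z; apply: rpred_sum => i _; apply: rpredZ; case: (hP i).
- move=> z zQ; rewrite (lin_sum _ _ fl) [RHS](coord_vbasis zQ); apply: eq_bigr => i _.
  by rewrite (linZ fl); case: (hP i) => _ ->.
Qed.

Section Transfer.
Context (m k : nat) (H a : {vspace 'M[C]_m.+1}) (f : 'M[C]_m.+1 -> 'M[C]_k.+1).
Context (Q : {vspace 'M[C]_k.+1}).
Hypotheses (HL : lie_closed H) (fl : linear f) (fh : hom_on f H).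
Hypothesis QP : forall z, z \in Q <-> exists2 x, x \in H & z = f x.

Lemma whitehead_img : (forall x, x \in a -> f x = 0) -> whitehead H a -> whitehead Q 0%VS.
Proof.
move=> fa W n rho U rl rh _ rU v.
have [|x y xH yH|x xa|x xH|u uU Hu] := W n (rho \o f) U _ _ _ _ v.
- by move=> c x y /=; rewrite fl rl.
- by rewrite /= fh // rh //; apply/QP; [exists x | exists y].
- by rewrite /= fa // (lin0 rl).
- by apply: rU; apply/QP; exists x.
by exists u => // _ /QP [x xH ->]; apply: Hu.
Qed.

(** A linear section of [f] is a homomorphism modulo [a], so composition with it turns
    representations of [H] that kill [a] into representations of [Q]. *)
Lemma whitehead_preimg : (forall x, x \in H -> f x = 0 -> x \in a) ->
  whitehead Q 0%VS -> whitehead H a.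
Proof.
move=> fa W n rho U rl rh ra rU v.
have [g [gl gH gK]] := linear_section fl (fun z => (QP z).1).
have rE x : x \in H -> rho (g (f x)) = rho x.
  move=> xH; apply/eqP; rewrite -subr_eq0 -(linB rl); apply/eqP/ra/fa; first exact: rpredB.
  by rewrite (linB fl) gK ?subrr //; apply/QP; exists x.
have [|x y xQ yQ|x|x xQ|u uU Hu] := W n (rho \o g) U _ _ _ _ v.
- by move=> c x y /=; rewrite gl rl.
- rewrite /= -rh ?gH //= -(rE (lie (g x) (g y))); last exact: HL.
  by rewrite fh ?gH // !gK.
- by rewrite memv0 => /eqP ->; rewrite /= (lin0 gl) (lin0 rl).
- exact/rU/gH.
exists u => // x xH; rewrite -rE //; apply: Hu.
by apply/QP; exists x.
Qed.
End Transfer.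

Section QuotientRep.
Context (m : nat) (H : {vspace 'M[C]_m.+1}) (V : vectType C) (act : 'M[C]_m.+1 -> V -> V).
Context (Y I : {vspace V}).
Hypotheses (actl : forall v, linear (act^~ v)) (actr : forall x, linear (act x)).
Hypothesis act_lie : forall x z v, x \in H -> z \in H -> v \in Y ->
  act (lie x z) v = act x (act z v) - act z (act x v).
Hypothesis IY : (I <= Y)%VS.
Hypotheses (actY : forall x v, x \in H -> v \in Y -> act x v \in Y)
  (actI : forall x v, x \in H -> v \in I -> act x v \in I).

(* The sign turns the right action on row vectors into a homomorphism. *)
Lemma quotient_rep : ~~ (Y <= I)%VS -> exists (n : nat) (kap : V -> 'rV[C]_n.+1)
    (sig : 'rV[C]_n.+1 -> V) (rho : 'M[C]_m.+1 -> 'M[C]_n.+1),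
  [/\ linear kap, linear sig, linear rho & [/\ hom_on rho H, forall r, sig r \in Y,
     forall r, kap (sig r) = r, forall y, y \in Y -> (kap y = 0 <-> y \in I) &
     forall x y, x \in H -> y \in Y -> kap y *m rho x = - kap (act x y)]].
Proof.
move=> YI; set D := (Y :\: I)%VS.
have DI : (D :&: I = 0)%VS by rewrite capv_diff.
have DIY : (D + I = Y)%VS by rewrite addv_diff; apply/addv_idPl.
have : (0 < \dim D)%N.
  rewrite lt0n dimv_eq0; apply: contra YI => /eqP D0.
  by rewrite -DIY D0 add0v subvv.
move: (vbasis D) (vbasisP D); case: (\dim D) => // n X XB _.
have XD i : X`_i \in D.
  have [lt|ge] := ltnP i n.+1; last by rewrite nth_default ?mem0v // size_tuple.
  by apply: (basis_mem XB); rewrite mem_nth // size_tuple.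
have DY : (D <= Y)%VS by rewrite -DIY addvSl.
pose pr := daddv_pi D I.
pose kap v : 'rV[C]_n.+1 := \row_i coord X i (pr v).
pose sig (r : 'rV[C]_n.+1) : V := \sum_i r 0 i *: X`_i.
pose rho x : 'M[C]_n.+1 := \matrix_i (- kap (act x X`_i)).
have kl : linear kap.
  by move=> a u v; apply/rowP => i; rewrite !mxE linearP /= linearP.
have sl : linear sig.
  move=> a r s; rewrite /sig scaler_sumr -big_split; apply: eq_bigr => i _ /=.
  by rewrite !mxE scalerDl scalerA.
have sD r : sig r \in D by apply: rpred_sum => i _; apply: rpredZ.
have kapK r : kap (sig r) = r.
  apply/rowP => i; rewrite mxE /pr daddv_pi_id // coord_sum_free //.
  exact: basis_free XB.
have sigK y : y \in Y -> y - sig (kap y) \in I.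
  rewrite -DIY => yY; have <- : pr y = sig (kap y).
    rewrite /sig [LHS](coord_basis XB) ?memv_pi //; apply: eq_bigr => i _; by rewrite mxE.
  by rewrite -{1}(daddv_pi_add DI yY) [_ + daddv_pi I D y]addrC addrK memv_pi.
have kI y : y \in I -> kap y = 0.
  move=> yI; apply/rowP => i; rewrite !mxE.
  suff -> : pr y = 0 by rewrite linear0.
  have yY : y \in (D + I)%VS by apply: (subvP (addvSr _ _)).
  have := daddv_pi_add DI yY; rewrite (daddv_pi_id _ yI) 1?capvC //.
  by rewrite -[X in _ = X]add0r => /addIr.
have rl : linear rho.
  move=> a x y; apply/row_matrixP => i; rewrite linearP /= !rowK actl kl.
  by rewrite opprD scalerN.
have rhoE x r : r *m rho x = - kap (act x (sig r)).
  rewrite mulmx_sum_row /sig (lin_sum _ _ (actr x)) (lin_sum _ _ kl) -sumrN.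
  by apply: eq_bigr => i _; rewrite rowK (linZ (actr x)) (linZ kl) scalerN.
have kapact x y : x \in H -> y \in Y -> kap y *m rho x = - kap (act x y).
  move=> xH yY; rewrite rhoE; congr (- _); apply/esym/eqP.
  by rewrite -subr_eq0 -(linB kl) -(linB (actr x)) kI // actI // sigK.
have sY r : sig r \in Y by apply: (subvP DY).
exists n, kap, sig, rho; split=> //; split=> //.
- move=> x z xH zH; apply/row_matrixP => i; rewrite !rowE.
  move: (delta_mx 0 i) => r; rewrite rhoE [lie (rho x) _]lieE mulmxBr -!mulmxE !mulmxA (rhoE x r) (rhoE z r).
  by rewrite !mulNmx !kapact ?actY // !opprK act_lie // (linB kl) opprB.
- move=> y yY; split=> [k0|]; last exact: kI.
  by have := sigK y yY; rewrite k0 (lin0 sl) subr0.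
Qed.

(** Vanishing of H^1 for the subquotient [Y / I] of a left module, transported through
    [quotient_rep]. *)
Lemma whitehead_mod (a : {vspace 'M[C]_m.+1}) (U : {vspace V}) : whitehead H a ->
  (I <= U)%VS -> (forall x v, x \in H -> v \in Y -> act x v \in U) ->
  (U <= Y)%VS -> (a <= H)%VS -> (forall x v, x \in a -> v \in Y -> act x v \in I) ->
  forall y, y \in Y -> exists2 u, u \in U & forall x, x \in H -> act x (y - u) \in I.
Proof.
move=> W IU actU UY aH acta y yY.
have [YI|YI] := boolP (Y <= I)%VS.
  exists 0; rewrite ?mem0v // => x xH; rewrite subr0; apply: actI => //.
  exact: (subvP YI).
have [n [kap [sig [rho [kl sl rl [rh sY kK kI kact]]]]]] := quotient_rep YI.
have [|c r s|M MP] := @rowspace_of_pred _ _ (fun r => sig r \in U).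
- by rewrite (lin0 sl) mem0v.
- by move=> rU sU; rewrite sl rpredD ?rpredZ.
have sk w : w \in Y -> sig (kap w) - w \in I.
  move=> wY; apply/kI; first exact: rpredB.
  by rewrite (linB kl) kK subrr.
have skU w : w \in U -> sig (kap w) \in U.
  move=> wU; rewrite -(subrK w (sig _)) rpredD //.
  apply/(subvP IU)/sk; exact: (subvP UY).
have rK r x : x \in H -> r *m rho x = - kap (act x (sig r)).
  by move=> xH; rewrite -{1}(kK r) kact.
have [x xa|x xH|u /MP uU Hu] := W n rho M rl rh _ _ (kap y).
- have xH := subvP aH _ xa.
  apply/row_matrixP => i; rewrite rowE row0 rK // (_ : kap _ = 0) ?oppr0 //.
  apply/kI; first by apply: actY.
  exact: acta.
- apply/row_subP => i; apply/MP; rewrite rowE rK // (linN sl) rpredN.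
  by apply: skU; apply: actU.
exists (sig u) => // x xH; apply/kI.
  by apply: actY => //; rewrite rpredB.
have := Hu x xH; rewrite -{1}(kK u) -(linB kl) kact ?rpredB // => /eqP.
by rewrite oppr_eq0 => /eqP.
Qed.
End QuotientRep.

Fact hom_act_key : unit. Proof. exact: tt. Qed.

(** * Bourbaki's trick on modules of linear maps *)

Section HomModule.
Context (m : nat) (H a : {vspace 'M[C]_m.+1}) (V : vectType C) (act : 'M[C]_m.+1 -> 'End(V)).
Context (Y U I : {vspace V}) (J : {vspace 'End(V)}).
Hypotheses (W : whitehead H a) (aH : (a <= H)%VS) (actl : linear act).
Hypothesis act_lie : forall x z v, x \in H -> z \in H ->
  act (lie x z) v = act x (act z v) - act z (act x v).
Hypotheses (actY : forall x v, x \in H -> v \in Y -> act x v \in Y)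
  (actU : forall x v, x \in H -> v \in U -> act x v \in U)
  (actI : forall x v, x \in H -> v \in I -> act x v \in I).

Let lP (f : 'End(V)) : linear f. Proof. exact: linearP. Qed.

Definition hom_act x (phi : 'End(V)) : 'End(V) :=
  locked_with hom_act_key ((act x \o phi)%VF - (phi \o act x)%VF).
Lemma hom_actE x phi v : hom_act x phi v = act x (phi v) - phi (act x v).
Proof. by rewrite /hom_act locked_withE !lfun_simp. Qed.
Lemma hom_act_linearl phi : linear (hom_act^~ phi).
Proof.
move=> c x y; apply/lfunP => v; rewrite add_lfunE scale_lfunE !hom_actE actl !lfun_simp.
by rewrite (linD (lP _)) (linZ (lP _)) scalerBr; zmod.
Qed.
Lemma hom_act_linearr x : linear (hom_act x).
Proof.
move=> c phi psi; apply/lfunP => v; rewrite add_lfunE scale_lfunE !hom_actE !lfun_simp.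
by rewrite (linD (lP _)) (linZ (lP _)) scalerBr; zmod.
Qed.
Lemma hom_act_lie x z phi : x \in H -> z \in H ->
  hom_act (lie x z) phi = hom_act x (hom_act z phi) - hom_act z (hom_act x phi).
Proof.
move=> xH zH; apply/lfunP => v; rewrite add_lfunE opp_lfunE !hom_actE !act_lie //.
by rewrite !(linB (lP _)); zmod.
Qed.

Definition scalar_mod (l : C) (phi : 'End(V)) :=
  (forall y, y \in Y -> phi y \in U) /\ (forall u, u \in U -> phi u - l *: u \in I).

Hypothesis J0 : forall phi, phi \in J -> scalar_mod 0 phi.
Hypothesis actJ : forall x phi, x \in H -> phi \in J -> hom_act x phi \in J.
Hypothesis aJ : forall c l phi, c \in a -> scalar_mod l phi -> hom_act c phi \in J.

(* Bourbaki's trick: apply the vanishing of H^1 to the maps Y -> U acting on U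
   as scalars modulo I; H moves them into those that vanish on U modulo I. *)
Lemma projection_mod : exists phi : 'End(V),
  scalar_mod 1 phi /\ forall x, x \in H -> hom_act x phi \in J.
Proof.
have scalD l l' phi psi (c : C) : scalar_mod l phi -> scalar_mod l' psi ->
    scalar_mod (c * l + l') (c *: phi + psi).
  move=> [p1 p2] [q1 q2]; split=> [y yY|u uU]; rewrite !lfun_simp.
    by rewrite rpredD ?rpredZ ?p1 ?q1.
  have -> : c *: phi u + psi u - (c * l + l') *: u = c *: (phi u - l *: u) + (psi u - l' *: u).
    by rewrite scalerBr scalerDl scalerA; zmod.
  by rewrite rpredD ?rpredZ ?p2 ?q2.
have scal0 : scalar_mod 0 0.
  by split=> [y _|u _]; rewrite lfunE /= ?scale0r ?subr0 mem0v.
have [|c phi psi [l pl] [l' ql]|Y' HY'] :=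
    @vspace_of_pred _ _ (fun phi : 'End(V) => exists l, scalar_mod l phi).
- by exists 0.
- by exists (c * l + l'); apply: scalD.
have [|c phi psi pl ql|U' HU'] := @vspace_of_pred _ _ (fun phi : 'End(V) => scalar_mod 0 phi).
- exact: scal0.
- by have := scalD _ _ _ _ c pl ql; rewrite mulr0 addr0.
have actY' x phi l : x \in H -> scalar_mod l phi -> scalar_mod 0 (hom_act x phi).
  move=> xH [p1 p2]; split=> [y yY|u uU]; rewrite hom_actE.
    by apply: rpredB; [apply: actU => //; apply: p1 | apply/p1/actY].
  have -> : act x (phi u) - phi (act x u) - 0 *: u =
      act x (phi u - l *: u) - (phi (act x u) - l *: act x u).
    by rewrite (linB (lP _)) (linZ (lP _)) scale0r; zmod.
  by apply: rpredB; [apply/actI/p2 | apply/p2/actU].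
have prU : scalar_mod 1 (projv U).
  split=> [y _|u uU]; first exact: memv_proj.
  by rewrite projv_id // scale1r subrr mem0v.
have [x z phi xH zH _||||||||||y /HU' yU Hy] :=
  @whitehead_mod m H _ hom_act Y' J hom_act_linearl hom_act_linearr _ _ _ _ a U' W _ _ _ _ _ (projv U) _.
- exact: hom_act_lie.
- by apply/subvP => phi pJ; apply/HY'; exists 0; apply: J0.
- by move=> x phi xH /HY' [l pl]; apply/HY'; exists 0; apply: actY' pl.
- exact: actJ.
- by apply/subvP => phi /J0 pJ; apply/HU'.
- by move=> x phi xH /HY' [l pl]; apply/HU'; apply: actY' pl.
- by apply/subvP => phi /HU' pU; apply/HY'; exists 0.
- exact: aH.
- by move=> x phi xa /HY' [l pl]; apply: aJ pl.
- by apply/HY'; exists 1.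
exists (projv U - y); split=> //.
by have := scalD _ _ _ _ (-1) yU prU; rewrite mulr0 add0r scaleN1r addrC.
Qed.
End HomModule.

Section Complement.
Context (m : nat) (H a : {vspace 'M[C]_m.+1}) (V : vectType C) (act : 'M[C]_m.+1 -> 'End(V)).
Context (Y U : {vspace V}).
Hypotheses (W : whitehead H a) (aH : (a <= H)%VS) (actl : linear act).
Hypothesis act_lie : forall x z v, x \in H -> z \in H ->
  act (lie x z) v = act x (act z v) - act z (act x v).
Hypothesis UY : (U <= Y)%VS.
Hypotheses (actY : forall x v, x \in H -> v \in Y -> act x v \in Y)
  (actU : forall x v, x \in H -> v \in U -> act x v \in U)
  (acta : forall x v, x \in a -> v \in Y -> act x v = 0).

(** Complete reducibility relative to the ideal [a]: this is [projection_mod] with [I = 0] and with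
    [J] the maps that vanish on [Y]. *)
Lemma equivariant_projection : exists phi : 'End(V),
  [/\ forall y, y \in Y -> phi y \in U, forall u, u \in U -> phi u = u &
      forall x y, x \in H -> y \in Y -> phi (act x y) = act x (phi y)].
Proof.
have [|c phi psi p q y yY|J HJ] :=
    @vspace_of_pred _ _ (fun phi : 'End(V) => forall y, y \in Y -> phi y = 0).
- by move=> y _; rewrite lfunE.
- by rewrite !lfun_simp p // q // scaler0 addr0.
have [x v _|phi /HJ p|x phi xH /HJ p|c l phi ca [p1 p2]|phi [[p1 p2] p3]] :=
   @projection_mod m H a V act Y U 0%VS J W aH actl act_lie actY actU _ _ _ _.
- by rewrite memv0 => /eqP ->; rewrite linear0 mem0v.
- split=> [y yY|u uU]; first by rewrite p // mem0v.
  by rewrite p ?(subvP UY) // scale0r subr0 mem0v.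
- by apply/HJ => y yY; rewrite hom_actE !p ?actY // linear0 subr0.
- apply/HJ => y yY; have pY : phi y \in Y := subvP UY _ (p1 _ yY).
  by rewrite hom_actE (acta ca pY) (acta ca yY) linear0 subr0.
exists phi; split=> //.
- by move=> u /p2; rewrite memv0 scale1r subr_eq0 => /eqP.
- move=> x y xH yY; have /HJ /(_ y yY) /eqP := p3 x xH.
  by rewrite hom_actE subr_eq0 => /eqP.
Qed.
End Complement.

(** * The relative Levi theorem *)

Section WhiteheadTheory.
Context (m : nat).
Local Notation E := 'M[C]_m.+1.
Implicit Types (H a b c s P : {vspace E}).

Definition adl (x : E) : 'End(E) := linfun (lie x : {linear E -> E}).

Lemma adE x v : adl x v = lie x v.
Proof. by rewrite lfunE. Qed.

Lemma adl_linear : linear adl.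
Proof. by move=> k x y; apply/lfunP => v; rewrite add_lfunE scale_lfunE !adE lieDl lieZl. Qed.

Lemma adl_lie x z v : adl (lie x z) v = adl x (adl z v) - adl z (adl x v).
Proof. by rewrite !adE (jacobi x z v) addrK. Qed.

(** If [y] were outside [[s, s]], a matrix entry of [pr] would be a linear functional [l] that kills
    [[s, s]] but not [y]. Then [z |-> l z *: e] is a representation on the plane, a non-split
    extension of trivial modules, against the vanishing of H^1. *)
Lemma whitehead_perfect s : lie_closed s -> whitehead s 0%VS -> brv s s = s.
Proof.
move=> sL W; have ss : (brv s s <= s)%VS by apply: brv_sub.
apply/eqP; rewrite eqEsubv ss; apply/subvP => y ys; apply: contrapT => /negP yss.
pose pr (z : E) := z - projv (brv s s) z.
have prl : linear pr by move=> k u v; rewrite /pr lfun_lin scalerBr; zmod.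
have pr0 z : z \in brv s s -> pr z = 0 by move=> zs; rewrite /pr projv_id ?subrr.
have [i [j yij]] : exists i j, pr y i j != 0.
  apply: contrapT => H; case/negP: yss.
  have : pr y = 0.
    apply/matrixP => i j; rewrite [RHS]mxE; apply: contrapT => /eqP h.
    by apply: H; exists i, j.
  by move/eqP; rewrite subr_eq0 => /eqP ->; apply: memv_proj.
pose e : 'M[C]_2 := delta_mx 0 1.
have ee : e *m e = 0 by rewrite mul_delta_mx_0.
pose rho (z : E) : 'M[C]_2 := pr z i j *: e.
have [k u v|u v us vs|z|x xs|u /submxP [D ->] Hu] := W 1%N rho e _ _ _ _ (delta_mx 0 0).
- by rewrite /rho prl !mxE scalerDl scalerA.
- rewrite {1}/rho pr0 ?mem_brv // mxE scale0r !lieE /rho -!mulmxE.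
  by rewrite -!scalemxAl -!scalemxAr !scalerA ee !scaler0 subrr.
- by rewrite memv0 => /eqP ->; rewrite /rho (lin0 prl) mxE scale0r.
- exact: scalemx_sub.
have := Hu y ys; rewrite /rho -scalemxAr mulmxBl -mulmxA ee mulmx0 subr0 mul_delta_mx => /eqP.
rewrite scaler_eq0 (negbTE yij) /= => /eqP /matrixP /(_ 0 1); rewrite !mxE /= => /eqP.
by rewrite oner_eq0.
Qed.

(** An equivariant projection [phi] of [s] onto [c] kills the brackets of [x - phi x] with [s], so
    it is a homomorphism of Lie algebras and [c] is an image of [s]. *)
Lemma whitehead_ideal s c : lie_closed s -> whitehead s 0%VS -> (c <= s)%VS ->
  lie_ideal_in s c -> whitehead c 0%VS.
Proof.
move=> sL W cs cI.
have [|x z v _ _||x v xs vs|x v xs vc|x v|phi [p1 p2 p3]] :=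
  @equivariant_projection m s 0%VS E adl s c W _ adl_linear.
- exact: sub0v.
- exact: adl_lie.
- exact: cs.
- by rewrite adE; apply: sL.
- by rewrite adE; apply: cI.
- by rewrite memv0 => /eqP -> _; rewrite adE lie0x.
have cs' x : x \in c -> x \in s by apply: (subvP cs).
have {}p3 x y : x \in s -> y \in s -> phi (lie x y) = lie x (phi y).
  by move=> xs ys; have := p3 x y xs ys; rewrite !adE.
have lp : linear phi by exact: linearP.
have H : hom_on phi s.
  move=> x y xs ys; rewrite p3 // -[x in LHS](subrK (phi x)) lieDl -p3 //; last first.
    by apply: rpredB => //; apply/cs'/p1.
  rewrite [lie (x - _) y]lieC (linN lp) p3 //; last by apply: rpredB => //; apply/cs'/p1.
  by rewrite (linB lp) (p2 (phi x)) ?p1 // subrr liex0 oppr0 add0r.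
apply: (@whitehead_img _ _ s 0%VS phi c lp H) => //.
  move=> z; split=> [zc|[x xs ->]]; last exact: p1.
  by exists z; [apply: cs' | rewrite p2].
by move=> x; rewrite memv0 => /eqP ->; rewrite linear0.
Qed.

(** By [whitehead_ideal] and [whitehead_perfect] the ideal [c] is perfect, so its derived series is
    constant. *)
Lemma whitehead_no_solvable s c k : lie_closed s -> whitehead s 0%VS -> (c <= s)%VS ->
  lie_ideal_in s c -> dser c k = 0%VS -> c = 0%VS.
Proof.
move=> sL W cs cI; have cL := lie_ideal_closed cs cI.
have cc := whitehead_perfect cL (whitehead_ideal sL W cs cI).
by elim: k => //= k IH; rewrite (_ : dser c k = c) ?cc //; elim: k {IH} => //= k ->.
Qed.

(** [H'] modulo [H' :&: a] is [H/a]: the projection of [H] to [H'] along [a] is a homomorphism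
    modulo [a], and representations of [H'] that kill [b] are pulled back along it. *)
Lemma whitehead_sub H H' a b : lie_closed H -> lie_closed H' -> lie_ideal_in H a ->
  (a <= H)%VS -> (H' <= H)%VS -> (H <= H' + a)%VS -> (H' :&: a <= b)%VS ->
  whitehead H a -> whitehead H' b.
Proof.
move=> HL HL' aI aH H'H HE H'a W n rho U rl rh rb rU v.
pose pr := addv_pi1 H' a.
have prH x : pr x \in H' by apply: memv_pi1.
have prE x : x \in H -> x - pr x \in a.
  move=> xH; rewrite -{1}(addv_pi1_pi2 (subvP HE _ xH)) [_ + addv_pi2 _ _ _]addrC addrK.
  exact: memv_pi2.
have Ha x y : x \in a -> y \in H -> lie x y \in a.
  by move=> xa yH; rewrite lieC rpredN; apply: aI.
have rE x : x \in H' -> x \in a -> rho x = 0.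
  by move=> x1 x2; apply/rb/(subvP H'a)/memv_capP.
have prK x : x \in H' -> rho (pr x) = rho x.
  move=> xH'; apply/eqP; rewrite eq_sym -subr_eq0 -(linB rl); apply/eqP/rE.
    exact: rpredB.
  exact/prE/(subvP H'H).
have [k x y|x y xH yH|x xa|x xH|u uU Hu] := W n (rho \o pr) U _ _ _ _ v.
- by rewrite /= linearP rl.
- have pxy' : lie (pr x) (pr y) \in H' by apply: HL'.
  rewrite /= -(rh _ _ (prH x) (prH y)) -(prK _ pxy'); apply/eqP.
  rewrite -subr_eq0 -(linB rl); apply/eqP/rE; first exact: rpredB.
  have xy : lie x y \in H by apply: HL.
  have pxy : lie (pr x) (pr y) \in H by apply/(subvP H'H)/HL'.
  have -> : pr (lie x y) - pr (lie (pr x) (pr y)) =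
     (lie (pr x) (pr y) - pr (lie (pr x) (pr y))) - (lie x y - pr (lie x y))
     + (lie (x - pr x) y + lie (pr x) (y - pr y)).
    by rewrite lieDl lieDr lieNl lieNr; zmod.
  apply: rpredD; first by apply: rpredB; apply: prE.
  by apply: rpredD; [apply: Ha => //; apply: prE | apply: aI; rewrite ?prE // (subvP H'H)].
- apply: rE; rewrite ?prH // -[pr x](subrK x) -opprB rpredD // rpredN.
  exact/prE/(subvP aH).
- exact/rU/prH.
exists u => // x xH'; rewrite -prK //; exact/Hu/(subvP H'H).
Qed.

(** For an ideal [a] containing [b]: a complement of [a / b] in [H / b], written without
    quotients. *)
Definition is_complement_in H a b H' :=
  [/\ (b <= H')%VS, (H' <= H)%VS, lie_closed H', (H <= H' + a)%VS & (H' :&: a <= b)%VS].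

Section AbelianStep.
Variables (H a b s0 : {vspace E}).
Hypotheses (HL : lie_closed H) (aH : (a <= H)%VS) (ba : (b <= a)%VS).
Hypotheses (aI : lie_ideal_in H a) (bI : lie_ideal_in H b).
Hypothesis aab : forall x y, x \in a -> y \in a -> lie x y \in b.
Hypothesis W : whitehead H a.
Hypotheses (s0H : (s0 <= H)%VS) (s0L : lie_closed s0) (W0 : whitehead s0 0%VS).

Let haE x (phi : 'End(E)) v : hom_act adl x phi v = lie x (phi v) - phi (lie x v).
Proof. by rewrite hom_actE !adE. Qed.
Let a2H x : x \in a -> x \in H. Proof. exact: (subvP aH). Qed.
Let b2a x : x \in b -> x \in a. Proof. exact: (subvP ba). Qed.
Let b2H x : x \in b -> x \in H. Proof. by move/b2a/a2H. Qed.
Let bIr x y : x \in b -> y \in H -> lie x y \in b.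
Proof. by move=> xb yH; rewrite lieC rpredN; apply: bI. Qed.
Let aIr x y : x \in a -> y \in H -> lie x y \in a.
Proof. by move=> xb yH; rewrite lieC rpredN; apply: aI. Qed.

(** [J] consists of the maps from [H] to [a] that are inner modulo [b], given by [ad c] with [c] in
    [a]. [projection_mod] provides [phi] that [H] moves into [J]; a second use of H^1, for [s0],
    corrects [phi] by an element of [J] so that [s0] fixes it modulo [b]. *)
Lemma cocycle_step : exists phi : 'End(E),
  [/\ scalar_mod H a b 1 phi,
      forall x, x \in H -> exists2 c, c \in a & forall v, v \in H -> hom_act adl x phi v - lie c v \in b &
      forall x v, x \in s0 -> v \in H -> hom_act adl x phi v \in b].
Proof.
have [|k f g [f1 [c ca fc]] [g1 [d da gd]]|J HJ] := @vspace_of_pred _ _ (fun phi : 'End(E) =>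
    (forall y, y \in H -> phi y \in a) /\ exists2 c, c \in a & forall v, v \in H -> phi v - lie c v \in b).
- split=> [y _|]; first by rewrite lfunE mem0v.
  by exists 0; rewrite ?mem0v // => v _; rewrite lie0x subr0 lfunE mem0v.
- split=> [y yH|]; first by rewrite !lfun_simp rpredD ?rpredZ ?f1 ?g1.
  exists (k *: c + d); first by rewrite rpredD ?rpredZ.
  move=> v vH; have -> : (k *: f + g) v - lie (k *: c + d) v = k *: (f v - lie c v) + (g v - lie d v).
    by rewrite !lfun_simp lieDl lieZl (scalerBr k (f v)); zmod.
  by rewrite rpredD ?rpredZ ?fc ?gd.
have [x z v _ _|x v xH vH|x v xH va|x v xH vb|phi /HJ [f1 [c ca fc]]|x phi xH /HJ [f1 [c ca fc]]|c l phi ca [p1 p2]|phi [pS pJ]] :=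
  @projection_mod m H a E adl H a b J W aH adl_linear.
- exact: adl_lie.
- by rewrite adE HL.
- by rewrite adE aI.
- by rewrite adE bI.
- split=> // u ua; rewrite scale0r subr0 -(subrK (lie c u) (phi u)).
  by rewrite rpredD ?fc ?aab // a2H.
- apply/HJ; split=> [y yH|]; first by rewrite haE rpredB ?aI ?f1 ?HL.
  exists (lie x c) => [|v vH]; first exact: aI.
  have -> : hom_act adl x phi v - lie (lie x c) v =
     lie x (phi v - lie c v) - (phi (lie x v) - lie c (lie x v)).
    by rewrite haE lieDr lieNr (jacobi x c v); zmod.
  by rewrite rpredB ?bI ?fc // HL.
- have h v : v \in H -> hom_act adl c phi v - lie (- l *: c) v \in b.
    move=> vH; have -> : hom_act adl c phi v - lie (- l *: c) v =
        lie c (phi v) - (phi (lie c v) - l *: lie c v).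
      by rewrite haE lieZl scaleNr; zmod.
    by rewrite rpredB ?aab ?p1 ?p2 ?aIr.
  apply/HJ; split=> [y yH|]; last by exists (- l *: c); rewrite ?rpredZ.
  by rewrite haE rpredB ?aI ?p1 ?(a2H ca) ?HL ?(a2H ca).
have [|k f g fb gb v vH|I0 HI0] := @vspace_of_pred _ _ (fun phi : 'End(E) => forall v, v \in H -> phi v \in b).
- by move=> v _; rewrite lfunE mem0v.
- by rewrite add_lfunE scale_lfunE; apply: rpredD; [apply/rpredZ/fb | apply: gb].
have s0H' x : x \in s0 -> x \in H by apply: (subvP s0H).
have hr := hom_act_linearr adl; have hl := hom_act_linearl adl_linear.
have actJ x f : x \in H -> f \in J -> hom_act adl x f \in J.
  move=> xH /HJ [f1 [c ca fc]]; apply/HJ; split=> [y yH|]; first by rewrite haE rpredB ?aI ?f1 ?HL.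
  exists (lie x c) => [|v vH]; first exact: aI.
  have -> : hom_act adl x f v - lie (lie x c) v =
     lie x (f v - lie c v) - (f (lie x v) - lie c (lie x v)).
    by rewrite haE lieDr lieNr (jacobi x c v); zmod.
  by rewrite rpredB ?bI ?fc // HL.
have actY x f : x \in s0 -> f \in (<[phi]> + J)%VS -> hom_act adl x f \in J.
  move=> /s0H' xH /memv_addP [_ /vlineP [k ->] [g gJ ->]].
  by rewrite hr rpredD ?rpredZ ?pJ ?actJ.
have I0J : (I0 <= J)%VS.
  apply/subvP => f /HI0 fb; apply/HJ; split=> [y yH|]; first by apply/b2a/fb.
  by exists 0; rewrite ?mem0v // => v vH; rewrite lie0x subr0 fb.
have JY : (J <= <[phi]> + J)%VS := addvSr _ _.
have [x z f xs zs _||x f xs fY|x f xs /HI0 fb|||||x f||u uJ Hu] :=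
  @whitehead_mod m s0 _ (hom_act adl) (<[phi]> + J)%VS I0 hl hr _ _ _ _ 0%VS J W0 _ _ _ _ _ phi _.
- by apply: (@hom_act_lie _ H) => [? ? ? _ _||]; rewrite ?s0H' //; apply: adl_lie.
- exact: subv_trans I0J JY.
- exact/(subvP JY)/actY.
- apply/HI0 => v vH; rewrite haE rpredB ?bI ?fb ?HL //; exact: s0H'.
- exact: I0J.
- exact: actY.
- exact: JY.
- exact: sub0v.
- by rewrite memv0 => /eqP -> _; rewrite (lin0 (hl f)) mem0v.
- by apply: (subvP (addvSl _ _)); rewrite memv_line.
exists (phi - u); split.
- case: pS => p1 p2; have /HJ [u1 [c ca uc]] := uJ.
  split=> [y yH|w wa]; rewrite !lfun_simp; first by rewrite rpredB ?p1 ?u1.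
  have -> : phi w - u w - 1 *: w = (phi w - 1 *: w) - (u w - lie c w) - lie c w by zmod.
  by rewrite rpredB ?aab // rpredB ?p2 // uc // a2H.
- move=> x xH; have : hom_act adl x (phi - u) \in J by rewrite (linB (hr x)) rpredB ?pJ ?actJ.
  by case/HJ.
- by move=> x v xs vH; have /HI0 := Hu x xs; apply.
Qed.

(** The stabilizer [H1] of [phi] modulo [b] supplements [a], because an element [c] of [a] moves
    [phi] by [- ad c] modulo [b]. For the same reason [Z = H1 :&: a] is central modulo [b]; an
    equivariant projection [f] of [H1] onto [Z] splits it off, and [H2] is the preimage of [b] under
    [f]. *)
Lemma abelian_step : exists H', is_complement_in H a b H' /\ (s0 <= H')%VS.
Proof.
have [phi [[p1 p2] pc ps]] := cocycle_step.
have p2' w : w \in a -> phi w - w \in b by move=> /p2; rewrite scale1r.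
have hl := hom_act_linearl adl_linear.
have [|k x z [xH xb] [zH zb]|H1 HH1] := @vspace_of_pred _ _ (fun h =>
   h \in H /\ forall v, v \in H -> hom_act adl h phi v \in b).
- by split=> [|v _]; rewrite ?mem0v // (lin0 (hl phi)) lfunE mem0v.
- split=> [|v vH]; first by rewrite rpredD ?rpredZ.
  rewrite (hl phi k x z) add_lfunE scale_lfunE; apply: rpredD; last exact: zb.
  exact/rpredZ/xb.
have H1H x : x \in H1 -> x \in H by case/HH1.
have H1L : lie_closed H1.
  move=> x z /HH1 [xH xb] /HH1 [zH zb]; apply/HH1; split; first exact: HL.
  move=> v vH; rewrite haE.
  have xb' w : w \in H -> lie x (phi w) - phi (lie x w) \in b by move=> wH; rewrite -haE; apply: xb.
  have zb' w : w \in H -> lie z (phi w) - phi (lie z w) \in b by move=> wH; rewrite -haE; apply: zb.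
  have -> : lie (lie x z) (phi v) - phi (lie (lie x z) v) =
      (lie x (lie z (phi v) - phi (lie z v)) - (lie z (phi (lie x v)) - phi (lie z (lie x v))))
    - (lie z (lie x (phi v) - phi (lie x v)) - (lie x (phi (lie z v)) - phi (lie x (lie z v)))).
    have -> : lie (lie x z) v = lie x (lie z v) - lie z (lie x v) by rewrite (jacobi x z v) addrK.
    have -> : lie (lie x z) (phi v) = lie x (lie z (phi v)) - lie z (lie x (phi v)).
      by rewrite (jacobi x z (phi v)) addrK.
    by rewrite (linB (lfun_lin phi)) !lieDr !lieNr; zmod.
  by apply: rpredB; apply: rpredB; [apply/bI/zb' | apply/zb'/HL | apply/bI/xb' | apply/xb'/HL].
have bH1 : (b <= H1)%VS.
  apply/subvP => x xb; apply/HH1; split; first exact: b2H.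
  move=> v vH; rewrite haE rpredB ?bIr ?a2H ?p1 //.
  have xv : lie x v \in b by apply: bIr.
  by rewrite -[phi _](subrK (lie x v)) rpredD // p2' // b2a.
have s0H1 : (s0 <= H1)%VS.
  by apply/subvP => x xs; apply/HH1; split; [apply: (subvP s0H) | move=> v vH; apply: ps].
have dec h : h \in H -> exists2 c, c \in a & h + c \in H1.
  move=> hH; have [c ca Hc] := pc h hH; exists c => //.
  apply/HH1; split; first by rewrite rpredD // a2H.
  move=> v vH; rewrite (linD (hl phi)) add_lfunE [X in _ + X](haE c phi v).
  have -> : hom_act adl h phi v + (lie c (phi v) - phi (lie c v)) =
      (hom_act adl h phi v - lie c v) + lie c (phi v) - (phi (lie c v) - lie c v) by zmod.
  by rewrite rpredB ?p2' ?aIr // rpredD ?Hc ?aab ?p1.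
set Z := (H1 :&: a)%VS.
have ZP x : x \in Z <-> x \in H1 /\ x \in a by split=> [/memv_capP|h]; last apply/memv_capP.
have Zc z v : z \in Z -> v \in H -> lie z v \in b.
  move=> /ZP [/HH1 [_ zb] za] vH.
  have -> : lie z v = lie z (phi v) - (phi (lie z v) - lie z v) - hom_act adl z phi v.
    by rewrite haE; zmod.
  by rewrite rpredB ?zb // rpredB ?p2' ?aIr // aab // p1.
have Zc' z v : z \in Z -> v \in H -> lie v z \in b.
  by move=> zZ vH; rewrite lieC rpredN; apply: Zc.
have ZH1 : (Z <= H1)%VS by apply: capvSl.
have Za x : x \in Z -> x \in a by case/ZP.
have bZ : (b <= Z)%VS by rewrite subv_cap bH1.
have HE1 : (H <= H1 + a)%VS.
  apply/subvP => h /dec [c ca hc]; rewrite -(addrK c h); apply: memv_add => //.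
  by rewrite rpredN.
have H1H' : (H1 <= H)%VS by apply/subvP.
have W1 : whitehead H1 Z.
  exact: (@whitehead_sub H H1 a Z).
have [|k f g fb gb v vH|J HJ] := @vspace_of_pred _ _ (fun f : 'End(E) => forall v, v \in H1 -> f v \in b).
- by move=> v _; rewrite lfunE mem0v.
- by rewrite add_lfunE scale_lfunE; apply: rpredD; [apply/rpredZ/fb | apply: gb].
have [x z v _ _|x v xH vH|x v xH vZ|x v xH vb|f /HJ fb|x f xH /HJ fb|c l f cZ [f1 f2]|f [[f1 f2] fJ]] :=
  @projection_mod m H1 Z E adl H1 Z b J W1 ZH1 adl_linear.
- exact: adl_lie.
- by rewrite adE H1L.
- by rewrite adE; apply/(subvP bZ)/Zc' => //; apply: H1H.
- by rewrite adE bI // H1H.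
- split=> [y yH|u uZ]; first exact/(subvP bZ)/fb.
  by rewrite scale0r subr0 fb // (subvP ZH1).
- by apply/HJ => v vH; rewrite haE rpredB ?bI ?fb ?H1L // H1H.
- apply/HJ => v vH; rewrite haE rpredB //; first by apply: Zc => //; apply/a2H/Za/f1.
  have cv : lie c v \in b by apply: Zc => //; apply: H1H.
  by rewrite -[f _](subrK (l *: lie c v)) rpredD ?rpredZ // f2 // (subvP bZ).
have f2' u : u \in Z -> f u - u \in b by move=> /f2; rewrite scale1r.
have feq x v : x \in H1 -> v \in H1 -> f (lie x v) - lie x (f v) \in b.
  move=> xH vH; have /HJ /(_ v vH) := fJ x xH; rewrite haE.
  by rewrite -rpredN opprB.
have [|k x z [xH xb] [zH zb]|H2 HH2] := @vspace_of_pred _ _ (fun h => h \in H1 /\ f h \in b).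
- by rewrite linear0 !mem0v.
- by rewrite linearP /= !rpredD ?rpredZ.
have H2I : lie_ideal_in H1 H2.
  move=> x h xH /HH2 [hH hb]; apply/HH2; split; first exact: H1L.
  by rewrite -[f _](subrK (lie x (f h))) rpredD ?feq ?bI // H1H.
have H2H1 : (H2 <= H1)%VS by apply/subvP => x /HH2 [].
have bH2 : (b <= H2)%VS.
  apply/subvP => x xb; apply/HH2; split; first exact: (subvP bH1).
  by rewrite -[f x](subrK x) rpredD // f2' // (subvP bZ).
have H2Z x : x \in H2 -> x \in a -> x \in b.
  move=> /HH2 [xH1 xb] xa; rewrite -[x](subKr (f x)) rpredB // f2' //.
  by apply/ZP.
have dec2 h : h \in H1 -> h - f h \in H2.
  move=> hH; have fZ := f1 h hH; apply/HH2; split; first by rewrite rpredB // (subvP ZH1).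
  by rewrite linearB /= -opprB rpredN f2'.
exists H2; split; first split.
- exact: bH2.
- exact: subv_trans H2H1 H1H'.
- by apply: lie_ideal_closed H2I.
- apply/subvP => h /dec [c ca hc].
  have -> : h = (h + c - f (h + c)) + (f (h + c) - c) by zmod.
  by apply: memv_add; [apply: dec2 | rewrite rpredB // Za // f1].
- by apply/subvP => x /memv_capP [xH2 xa]; apply: H2Z.
(* [s0] is perfect, and [[x, y]] splits into [[x, y - f y]], in the ideal [H2], and [[x, f y]], in
   [b]. *)
rewrite -(whitehead_perfect s0L W0); apply: brv_sub => x y xs ys.
have xH1 := subvP s0H1 _ xs; have yH1 := subvP s0H1 _ ys.
rewrite -[y](subrK (f y)) lieDr; apply: rpredD; first exact/H2I/dec2.
by apply: (subvP bH2); apply: Zc'; [apply: f1 | apply: H1H].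
Qed.
End AbelianStep.

(** [abelian_step] is applied along the derived series of [P], each time shrinking the supplement of
    [P] while keeping [s0] inside. *)
Theorem levi_relative H P s0 k : lie_closed H -> (P <= H)%VS -> lie_ideal_in H P ->
  dser P k = 0%VS -> whitehead H P ->
  (s0 <= H)%VS -> lie_closed s0 -> whitehead s0 0%VS ->
  exists s, [/\ lie_closed s, whitehead s 0%VS, (s0 <= s)%VS, (s <= H)%VS &
    (H <= s + P)%VS /\ (s :&: P = 0)%VS].
Proof.
move=> HL PH PI Pk W s0H s0L W0; have PL := lie_ideal_closed PH PI.
have [s [[_ sH sL HE sP] s0s]] : exists H', is_complement_in H P (dser P k) H' /\ (s0 <= H')%VS.
  elim: k {Pk} => [|k [H' [[bH' H'H H'L HE H'P] s0H']]].
    by exists H; rewrite /is_complement_in subvv addvSl capvSr; split.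
  have aH' : (dser P k <= H')%VS by [].
  have W' : whitehead H' (dser P k) by apply: whitehead_sub HE _ W.
  have dI j : lie_ideal_in H' (dser P j).
    move=> x y xH yP; apply: (dser_ideal PI) => //; exact: (subvP H'H).
  have [|x y xa ya|H2 [[b2 H2H' H2L HE2 H2a] s0H2]] :=
     @abelian_step H' (dser P k) (dser P k.+1) s0 H'L aH' _ (dI _) (dI _) _ W' s0H' s0L W0.
  - by apply: brv_sub => x y; apply: dser_closed.
  - exact: mem_brv.
  exists H2; split=> //; split=> //.
  - exact: subv_trans H2H' H'H.
  - apply: subv_trans HE _; rewrite subv_add addvSr andbT; apply: subv_trans HE2 _.
    by apply: addvS => //; apply: dser_sub.
  - apply/subvP => x /memv_capP [xH2 xP]; apply: (subvP H2a); apply/memv_capP; split=> //.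
    by apply: (subvP H'P); apply/memv_capP; split=> //; apply: (subvP H2H').
rewrite Pk in sP; exists s; split=> //; last by split=> //; apply/eqP; rewrite -subv0.
exact: whitehead_sub HE sP W.
Qed.
End WhiteheadTheory.

(** * Levi decomposition of a finite-dimensional matrix Lie algebra *)

Section LeviLinear.
Context (m : nat) (S : {vspace 'M[C]_m.+1}).
Hypothesis SL : lie_closed S.
Local Notation E := 'M[C]_m.+1.
Implicit Types (I R c : {vspace E}).

Definition solvable_ideal I := [/\ (I <= S)%VS, lie_ideal_in S I & exists k, dser I k = 0%VS].

Lemma max_solvable_ideal : exists R, solvable_ideal R /\
  forall I, solvable_ideal I -> (R <= I)%VS -> (I <= R)%VS.
Proof.
suff H d : forall R, solvable_ideal R -> (\dim S <= \dim R + d)%N ->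
    exists R', solvable_ideal R' /\ forall I, solvable_ideal I -> (R' <= I)%VS -> (I <= R')%VS.
  apply: (H (\dim S) 0%VS); last exact: leq_addl.
  split; [exact: sub0v | | by exists 0%N].
  by move=> x y _; rewrite !memv0 => /eqP ->; rewrite liex0.
elim: d => [|d IH] R RS dR.
  exists R; split=> // I [IS _ _] RI.
  suff -> : R = S by []. 
  by apply/eqP; rewrite eqEdim -(addn0 (\dim R)) dR; case: RS => ->.
have [H|H] := pselect (forall I, solvable_ideal I -> (R <= I)%VS -> (I <= R)%VS).
  by exists R.
have [I [IS [RI IR]]] : exists I, solvable_ideal I /\ (R <= I)%VS /\ ~~ (I <= R)%VS.
  apply: contrapT => nex; apply: H => I IS RI; apply: contrapT => /negP IR.
  by apply: nex; exists I.
apply: (IH I) => //; have := dimv_leqif_sup RI; move/ltn_leqif; rewrite IR => lt.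
by move: dR lt; clear; lia.
Qed.

Lemma solvable_ideal_ext R c : solvable_ideal R -> (c <= S)%VS -> lie_ideal_in S c ->
  (forall x y, x \in c -> y \in c -> lie x y \in R) -> solvable_ideal c.
Proof.
move=> [RS RI [k Rk]] cS cI cc; split=> //; exists k.+1; rewrite dserS.
by apply/eqP; rewrite -subv0 -Rk; apply: dser_mono; apply: brv_sub.
Qed.

(** The adjoint action on [S / R] has kernel [R]: the elements [x] with [[x, S]] in [R] form an
    ideal that is solvable and contains [R], so maximality applies. Maximality likewise excludes
    abelian ideals in the image. *)
Lemma whitehead_radical R : solvable_ideal R ->
  (forall I, solvable_ideal I -> (R <= I)%VS -> (I <= R)%VS) -> whitehead S R.
Proof.
move=> Rs Rmax; have [RS RI _] := Rs.
have [SR|SR] := boolP (S <= R)%VS.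
  move=> n rho U _ _ rR _ v; exists 0; first exact: sub0mx.
  by move=> x xS; rewrite rR ?mulmx0 // (subvP SR).
have actl (v : E) : linear ((fun x w : E => lie x w)^~ v).
  by move=> k x y; rewrite lieDl lieZl.
have actr (x : E) : linear ((fun x w : E => lie x w) x).
  by move=> k u v; rewrite lieDr lieZr.
have [x z v _ _ _|n [kap [sig [rho [kl sl rl [rh sY kK kR kact]]]]]] :=
  @quotient_rep m S E (fun x v : E => lie x v) S R actl actr _ RS SL RI SR.
  by rewrite (jacobi x z v) addrK.
have [Q QP] := vspace_img S rl.
have ker x : x \in S -> rho x = 0 -> x \in R.
  have [|k u v [uS uR] [vS vR]|Z HZ] := @vspace_of_pred _ _
      (fun x => x \in S /\ forall y, y \in S -> lie x y \in R).
  - by split=> [|y _]; rewrite ?mem0v // lie0x mem0v.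
  - split=> [|y yS]; first by rewrite rpredD ?rpredZ.
    by rewrite lieDl lieZl rpredD ?rpredZ ?uR ?vR.
  have ZR : (Z <= R)%VS.
    apply: Rmax; last first.
      apply/subvP => z zR; apply/HZ; split; first exact: (subvP RS).
      by move=> y yS; rewrite lieC rpredN; apply: RI.
    apply: (solvable_ideal_ext Rs).
    - by apply/subvP => z /HZ [].
    - move=> w y wS /HZ [yS yR]; apply/HZ; split; first exact: SL.
      move=> z zS; have -> : lie (lie w y) z = lie w (lie y z) - lie y (lie w z).
        by rewrite (jacobi w y z) addrK.
      by apply: rpredB; [apply/RI/yR | apply/yR/SL].
    - by move=> w y /HZ [wS wR] /HZ [yS _]; apply: wR.
  move=> xS r0; apply/(subvP ZR)/HZ; split=> // y yS; apply/kR; first exact: SL.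
  by apply/eqP; rewrite -oppr_eq0 -kact // r0 mulmx0.
have rR x : x \in R -> rho x = 0.
  move=> xR; apply/row_matrixP => i; rewrite rowE row0 -(kK (delta_mx 0 i)).
  have xS : x \in S := subvP RS _ xR.
  rewrite kact // (_ : kap _ = 0) ?oppr0 //; apply/kR; first exact: SL.
  by rewrite lieC rpredN; apply: RI.
apply: (whitehead_preimg SL rl rh QP ker); apply: no_abelian_whitehead.
  exact: (img_lie_closed SL rh QP).
move=> c cQ cI cA.
have [|k u v [uS uc] [vS vc]|c' Hc'] := @vspace_of_pred _ _ (fun x => x \in S /\ rho x \in c).
- by rewrite (lin0 rl) !mem0v.
- by rewrite rl !rpredD ?rpredZ.
have c'R : (c' <= R)%VS.
  apply: Rmax; last first.
    apply/subvP => x xR; apply/Hc'; split; first exact: (subvP RS).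
    by rewrite rR ?mem0v.
  apply: (solvable_ideal_ext Rs).
  - by apply/subvP => x /Hc' [].
  - move=> x y xS /Hc' [yS yc]; apply/Hc'; split; first exact: SL.
    by rewrite rh //; apply: cI => //; apply/QP; exists x.
  - move=> x y /Hc' [xS xc] /Hc' [yS yc]; apply: ker; first exact: SL.
    by rewrite rh // cA.
apply/eqP; rewrite -subv0; apply/subvP => z zc; rewrite memv0.
have /QP [x xS zE] := subvP cQ _ zc.
by rewrite zE rR //; apply/(subvP c'R)/Hc'; rewrite -zE.
Qed.

(** From [S = s + R] one gets [[S, S] <= s + [S, R]]. The ideal [N] is [[S, R]] because this is what
    [tr_lie_solvable] shows to be trace-null. *)
Theorem levi_linear : exists s N : {vspace E},
  [/\ lie_closed s /\ whitehead s 0%VS, (s <= brv S S)%VS, (N <= brv S S)%VS, lie_ideal_in S N &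
    (brv S S <= s + N)%VS /\ forall z b, z \in N -> env S b -> \tr (z * b) = 0].
Proof.
have [R [Rs Rmax]] := max_solvable_ideal; have [RS RI [k Rk]] := Rs.
have W := whitehead_radical Rs Rmax.
have L0 : lie_closed (0%VS : {vspace E}).
  by move=> x y; rewrite !memv0 => /eqP -> _; rewrite lie0x.
have W0 : whitehead (0%VS : {vspace E}) 0%VS.
  move=> n rho U rl _ _ _ v; exists 0; first exact: sub0mx.
  by move=> x; rewrite memv0 => /eqP ->; rewrite (lin0 rl) mulmx0.
have [s [sL sW _ sS [HE sR]]] := levi_relative SL RS RI Rk W (sub0v S) L0 W0.
exists s, (brv S R); split=> //.
- by rewrite -(whitehead_perfect sL sW); apply: brvS.
- exact: brvS.
- by apply: brv_ideal.
- split; last exact: tr_lie_solvable complex_pchar0 _ _ _ SL RS RI Rk.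
  apply: brv_sub => u v uS vS.
  have /memv_addP [x xs [r rR uE]] := subvP HE _ uS.
  have /memv_addP [z zs [t tR vE]] := subvP HE _ vS.
  have xS := subvP sS _ xs; have zS := subvP sS _ zs.
  have -> : lie u v = lie x z + (lie x t - lie v r).
    by rewrite uE [lie v r]lieC opprK lieDl {1}vE lieDr addrA.
  by apply: memv_add; [apply: sL | apply: rpredB; apply: mem_brv].
Qed.
End LeviLinear.

(** * The envelope of a matrix Lie algebra *)

Section OneSidedUnits.
Context (m : nat).
Local Notation E := 'M[C]_m.+1.
Implicit Types (A : E -> Prop) (X : seq E).

Definition subalg A := [/\ A 1, forall (k : C) x y, A x -> A y -> A (k *: x + y) &
  forall x y, A x -> A y -> A (x * y)].

Inductive lspan A X : E -> Prop :=
| lspan0 : lspan A X 0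
| lspanD b x z of A b & x \in X & lspan A X z : lspan A X (b * x + z).

Section Subalg.
Variables (A : E -> Prop) (X : seq E).
Hypothesis sA : subalg A.

Lemma sub_alg0 : A 0.
Proof.
case: sA => A1 AL _; rewrite -(addNr (1 : E)) -scaleN1r; exact: AL.
Qed.
Lemma sub_algD x y : A x -> A y -> A (x + y).
Proof. by case: sA => _ AL _ Ax Ay; rewrite -(scale1r x); apply: AL. Qed.
Lemma sub_algZ k x : A x -> A (k *: x).
Proof. by case: sA => _ AL _ Ax; rewrite -(addr0 (k *: x)); apply: AL => //; apply: sub_alg0. Qed.
Lemma sub_algN x : A x -> A (- x).
Proof. by move=> Ax; rewrite -scaleN1r; apply: sub_algZ. Qed.
Lemma sub_algB x y : A x -> A y -> A (x - y).
Proof. by move=> Ax Ay; apply: sub_algD => //; apply: sub_algN. Qed.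
Lemma sub_alg_horner x p : A x -> A (horner_mx x p).
Proof.
case: sA => A1 AL AM Ax; elim/poly_ind: p => [|p c IH]; first by rewrite rmorph0; apply: sub_alg0.
rewrite rmorphD rmorphM /= horner_mx_X horner_mx_C; apply: sub_algD; first exact: AM.
by rewrite -[c%:M]scalemx1; apply: sub_algZ.
Qed.

Lemma lspan_add y z : lspan A X y -> lspan A X z -> lspan A X (y + z).
Proof.
move=> Hy Hz; elim: Hy => [|b x w Ab xX _ IH]; first by rewrite add0r.
by rewrite -addrA; apply: lspanD.
Qed.
Lemma lspan_mull b z : A b -> lspan A X z -> lspan A X (b * z).
Proof.
case: sA => _ _ AM Ab; elim=> [|c x w Ac xX _ IH]; first by rewrite mulr0; apply: lspan0.
by rewrite mulrDr mulrA; apply: lspanD => //; apply: AM.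
Qed.
Lemma lspan_gen x : x \in X -> lspan A X x.
Proof.
by case: sA => A1 _ _ xX; rewrite -[x]mul1r -[1 * x]addr0; apply: lspanD => //; apply: lspan0.
Qed.

(* Adjoining to e an idempotent in A x (1 - e) lowers the total rank of the x (1 - e). *)
Lemma right_unit : (forall x, x \in X -> A x) -> exists e, [/\ lspan A X e, e * e = e &
  forall x a, x \in X -> A a -> \tr ((x - x * e) * a) = 0].
Proof.
case: (sA) => A1 AL AM XA.
have spanA z : lspan A X z -> A z.
  by elim=> [|b x w Ab xX _ IH]; [apply: sub_alg0 | apply: sub_algD => //; apply: AM => //; apply: XA].
suff H N : forall e, lspan A X e -> e * e = e -> (\sum_(x <- X) \rank (x * (1 - e))%R < N)%N ->
    exists e, [/\ lspan A X e, e * e = e &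
      forall x a, x \in X -> A a -> \tr ((x - x * e) * a) = 0].
  by apply: (H (\sum_(x <- X) \rank (x * (1 - 0))%R).+1 0); rewrite ?mulr0 //; apply: lspan0.
elim: N => // N IH e espan ee rk.
have [H|nH] := pselect (forall x a, x \in X -> A a -> \tr ((x - x * e) * a) = 0).
  by exists e.
have [x [a [xX Aa tr0]]] : exists x a, [/\ x \in X, A a & \tr ((x - x * e) * a) != 0].
  apply: contrapT => nex; apply: nH => x a xX Aa; apply: contrapT => /eqP h.
  by apply: nex; exists x, a.
have Ae : A e by apply: spanA.
set e' := 1 - e; have e'e' : e' * e' = e' by rewrite /e' mulrBr mulr1 mulrBl mul1r ee subrr subr0.
have ee' : e * e' = 0 by rewrite /e' mulrBr mulr1 ee subrr.
have e'e : e' * e = 0 by rewrite /e' mulrBl mul1r ee subrr.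
have Ae' : A e' by apply: sub_algB.
set y := x * e'; have yE : x - x * e = y by rewrite /y /e' mulrBr mulr1.
(* [u] has the nonzero trace of [y * a], hence a Fitting idempotent [g]; the factors [e'] at both
   ends of [u] make [g] orthogonal to [e]. *)
rewrite yE in tr0; set u := e' * a * y.
have nu : ~ nil u.
  have ye' : y * e' = y by rewrite /y -mulrA e'e'.
  have yu : \tr (y * a) = \tr u by rewrite /u [RHS]trC mulrA ye'.
  by move=> /nil_tr0 h; rewrite yu h eqxx in tr0.
have [p] := nonnil_idem nu; set g := u * _ => -[g0 gg].
have gE : g = horner_mx u p * u by apply/comm_mx_horner/comm_mx_refl.
have eg : e * g = 0 by rewrite /g /u !mulrA ee' !mul0r.
have ge : g * e = 0 by rewrite gE /u /y -!mulrA e'e !mulr0.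
set c := horner_mx u p * (e' * a).
have Ac : A c.
  apply: (AM); last exact: (AM).
  by apply: sub_alg_horner; apply: (AM); [apply: (AM) | apply: (AM) => //; apply: XA].
have gc : g = c * y by rewrite gE /u /c !mulrA.
have ye x' : x' * (1 - (e + g)) = x' * e' * (1 - g).
  rewrite -mulrA; congr (_ * _); rewrite /e' mulrBl mul1r mulrBr mulr1 eg subr0.
  by rewrite opprD addrA; zmod.
have lt : (\rank (y * (1 - g))%R < \rank y)%N.
  have sub : ((y * (1 - g))%R <= y)%MS.
    rewrite gc mulrBr mulr1 (mulrA y) -{1}[y]mul1r -mulrBl -mulmxE; exact: submxMl.
  rewrite (ltn_leqif (mxrank_leqif_sup sub)); apply/negP => /submxP [D DE].
  have yg : y * g = 0.
    by rewrite DE mulmxE -!mulrA (_ : (1 - g) * g = 0) ?mulr0 // mulrBl mul1r gg subrr.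
  by case/eqP: g0; rewrite -gg {1}gc -mulrA yg mulr0.
apply: (IH (e + g)).
- apply: lspan_add => //; have -> : g = c * x + (- (c * x)) * e.
    by rewrite gc /y /e' mulrBr mulr1 mulrBr mulrA mulNr.
  apply: lspan_add; first by apply: lspan_mull => //; apply: lspan_gen.
  by apply: lspan_mull => //; apply: sub_algN; apply: AM => //; apply: XA.
- by rewrite mulrDl !mulrDr ee gg eg ge addr0 add0r.
- rewrite ltnS in rk; apply: leq_trans rk.
  rewrite (big_rem x) //= [X in (_ < X)%N](big_rem x) //= -addSn.
  apply: leq_add; first by rewrite ye.
  apply: leq_sum => z _; rewrite ye -mulmxE; exact: mxrankM_maxl.
Qed.
End Subalg.

Inductive rspan A X : E -> Prop :=
| rspan0 : rspan A X 0
| rspanD b x z of A b & x \in X & rspan A X z : rspan A X (x * b + z).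

(** Transposition exchanges the two sides in [right_unit]. *)
Lemma left_unit A X : subalg A -> (forall x, x \in X -> A x) -> exists e, [/\ rspan A X e, e * e = e &
  forall x a, x \in X -> A a -> \tr ((x - e * x) * a) = 0].
Proof.
move=> [A1 AL AM] XA.
pose A' (x : E) := A x^T; pose X' : seq E := [seq (x : E)^T | x <- X].
have trM (x y : E) : (x * y)^T = y^T * x^T by exact: trmx_mul.
have sA' : subalg A'.
  split; rewrite /A'; first by rewrite trmx1.
    by move=> k x y hx hy; rewrite linearP; apply: AL.
  by move=> x y hx hy; rewrite trM; apply: AM.
have [|e [espan ee He]] := right_unit (X := X') sA'.
  by move=> _ /mapP [x xX ->]; rewrite /A' trmxK; apply: XA.
exists e^T; split.
- elim: espan => [|b x' z Ab /mapP [x xX ->] _ IH]; first by rewrite trmx0; apply: rspan0.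
  by rewrite linearD /= trM trmxK; apply: rspanD.
- by rewrite -trM ee.
- move=> x a xX Aa; have := He x^T a^T; rewrite /A' trmxK => <- //; last exact: map_f.
  by rewrite -[LHS]mxtrace_tr trM linearB /= trM trmxK trC.
Qed.
End OneSidedUnits.

Lemma env_subalg m (S : {vspace 'M[C]_m.+1}) : subalg (env S).
Proof.
by split; [apply: env_one | move=> k x y; apply: env_lin | move=> x y; apply: env_mul].
Qed.

Section SemisimpleEnvelope.
Context (m : nat) (s : {vspace 'M[C]_m.+1}).
Hypothesis sW : whitehead s 0%VS.
Local Notation E := 'M[C]_m.+1.

Definition row_act (x : E) : 'End('rV[C]_m.+1) := - linfun (mulmxr x : {linear 'rV[C]_m.+1 -> _}).

Lemma row_actE x v : row_act x v = - (v *m x).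
Proof. by rewrite /row_act opp_lfunE lfunE. Qed.

(** Complete reducibility lowers the length of vanishing words. Let [U] be the rows killed by words
    of length [j.+1] and [phi] an equivariant projection onto it. For [p] in [P], the row
    [(v - phi v) *m p] is in [U], hence fixed by [phi], but it is also killed by [phi]; so
    [v *m p = phi v *m p], which dies one letter earlier. *)
Lemma nil_ideal_env_eq0 (P : {vspace E}) : (forall x, x \in P -> nil x) ->
  (forall a x, env s a -> x \in P -> a * x \in P /\ x * a \in P) ->
  (forall x, x \in P -> env s x) -> P = 0%VS.
Proof.
move=> Pnil PI Penv.
have PL : lie_closed P.
  by move=> x y xP yP; rewrite lieE rpredB //; have [] := PI x y (Penv _ xP) yP.
have [k Pk] := engel PL Pnil.
have rl : linear row_act.
  move=> c x y; apply/lfunP => v; rewrite add_lfunE scale_lfunE !row_actE.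
  by rewrite mulmxDr -scalemxAr opprD scalerN.
have rlie x z v : row_act (lie x z) v = row_act x (row_act z v) - row_act z (row_act x v).
  by rewrite !row_actE lieE !mulNmx !opprK mulmxBr -!mulmxE !mulmxA opprB.
suff H j : word_nil P j.+2 -> word_nil P j.+1.
  have {k Pk} P1 : word_nil P 1.
    have : word_nil P k.+1 by move=> w wP wk; apply: word_nil_ge Pk wP _; rewrite wk.
    by elim: k {Pk} => // k IH /H.
  apply/eqP; rewrite -subv0; apply/subvP => x xP; rewrite memv0.
  by have := P1 [:: x]; rewrite big_seq1 /= xP => ->.
move=> Pj.
have [|c u v hu hv|U HU] := @vspace_of_pred _ _ (fun u : 'rV[C]_m.+1 =>
    forall w, all (mem P) w -> size w = j.+1 -> u *m \prod_(x <- w) x = 0).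
- by move=> w _ _; rewrite mul0mx.
- by move=> w wP wj; rewrite mulmxDl -scalemxAl hu // hv // scaler0 addr0.
have [|x z v _ _||x v _ _|x v xs /HU vU|x v|phi [p1 p2 p3]] :=
  @equivariant_projection m s 0%VS _ row_act fullv U sW _ rl.
- exact: sub0v.
- exact: rlie.
- exact: subvf.
- exact: memvf.
- apply/HU => -[|p w] //= /andP [pP wP] wj; rewrite row_actE mulNmx -mulmxA big_cons mulmxE.
  have [_ xp] := PI x p (env_gen xs) pP; have [xp' _] := PI x p (env_gen xs) pP.
  have := vU (x * p :: w); rewrite big_cons /= xp' wP -mulrA => -> //; exact: oppr0.
- by rewrite memv0 => /eqP -> _; rewrite row_actE mulmx0 oppr0.
have comm a : env s a -> forall v, phi (v *m a) = phi v *m a.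
  elim=> [|x xs|c x y _ IH1 _ IH2|x y _ IH1 _ IH2] v.
  - by rewrite !mulmx1.
  - have := p3 x v xs (memvf v); rewrite !row_actE linearN /= => /eqP.
    by rewrite eqr_opp => /eqP.
  - by rewrite !mulmxDr -!scalemxAr (lfun_lin phi) IH1 IH2.
  - by rewrite -mulmxE !mulmxA IH2 IH1.
have vp v p : p \in P -> v *m p = phi v *m p.
  move=> pP; apply/eqP; rewrite -subr_eq0 -mulmxBl; apply/eqP.
  have yU : (v - phi v) *m p \in U.
    apply/HU => w wP wj; have := Pj (p :: w); rewrite big_cons /= pP wP wj => /(_ isT erefl) h.
    by rewrite -mulmxA mulmxE h mulmx0.
  rewrite -(p2 _ yU) comm; last exact: Penv.
  by rewrite (linB (lfun_lin phi)) (p2 (phi v)) ?subrr ?mul0mx //; apply: p1; apply: memvf.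
move=> [|p w] // wP wj; apply/row_matrixP => i; rewrite rowE row0.
move: (delta_mx 0 i) => v; rewrite big_cons.
case/andP: (wP) => pP _; set W := \prod_(x <- w) x.
have -> u : u *m (p * W) = u *m p *m W by exact: mulmxA.
rewrite (vp v p pP) -mulmxA mulmxE.
have /HU /(_ _ wP wj) := p1 v (memvf v); by rewrite big_cons.
Qed.
End SemisimpleEnvelope.

(** * Capturing finitely many elements *)

Definition two_sided m (A K : 'M[C]_m.+1 -> Prop) :=
  [/\ forall x, K x -> A x, K 0, forall (k : C) x y, K x -> K y -> K (k *: x + y),
      forall a x, A a -> K x -> K (a * x) & forall a x, A a -> K x -> K (x * a)].

Section TwoSided.
Variables (m : nat) (A K : 'M[C]_m.+1 -> Prop).
Hypothesis idK : two_sided A K.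

Lemma two_sidedW x : K x -> A x. Proof. by case: idK => h *; apply: h. Qed.
Lemma two_sided0 : K 0. Proof. by case: idK. Qed.
Lemma two_sidedD x y : K x -> K y -> K (x + y).
Proof. by case: idK => _ _ h _ _ Kx Ky; rewrite -[x]scale1r; apply: h. Qed.
Lemma two_sidedZ k x : K x -> K (k *: x).
Proof. by case: idK => _ K0 h _ _ Kx; rewrite -[_ *: x]addr0; apply: h. Qed.
Lemma two_sidedN x : K x -> K (- x).
Proof. by move=> Kx; rewrite -scaleN1r; apply: two_sidedZ. Qed.
Lemma two_sidedMl a x : A a -> K x -> K (a * x).
Proof. by case: idK => _ _ _ h _; apply: h. Qed.
Lemma two_sidedMr a x : A a -> K x -> K (x * a).
Proof. by case: idK => _ _ _ _ h; apply: h. Qed.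
Lemma two_sided_vspace : exists U : {vspace 'M[C]_m.+1}, forall v, v \in U <-> K v.
Proof. by case: idK => _ K0 KL _ _; apply: vspace_of_pred. Qed.
End TwoSided.

Lemma unipotent_inverse m (A : 'M[C]_m.+1 -> Prop) r : subalg A -> A r -> nil r ->
  exists w, [/\ A w, w * (1 + r) = 1 & (1 + r) * w = 1].
Proof.
move=> sA Ar [k rk]; have [A1 AL AM] := sA.
have /= E := subrXX_comm k (commr1 (- r)); rewrite expr1n exprNn rk mulr0 sub0r in E.
set w := \sum_(i < k) _ in E.
have Aw : A w.
  rewrite /w; elim/big_ind: _ => [|x y|i _]; first exact: sub_alg0.
    exact: sub_algD.
  rewrite expr1n mulr1; elim: (_ - _)%N => [|j IH]; first by rewrite expr0.
  by rewrite exprS; apply: AM => //; apply: sub_algN.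
have wr : (1 + r) * w = 1.
  apply: oppr_inj; rewrite E -mulNr; congr (_ * _); zmod.
exists w; split=> //; by apply: mulmx1C.
Qed.

Section Capture.
Context (m : nat).
Local Notation E := 'M[C]_m.+1.
Variables (A D : E -> Prop) (X : seq E).
Hypothesis sA : subalg A.
Hypothesis XA : forall x, x \in X -> A x.
Hypothesis captured : forall d, D d -> exists a, [/\ A a,
  forall x, x \in X -> \tr (x * d) = \tr (x * a) &
  forall x y, x \in X -> y \in X -> x * d * y = x * a * y].

(** For [P = A] this is the radical [R] of the trace form on [A], for [P = D] the ideal [K]. *)
Definition tr_orth (P : E -> Prop) a := A a /\ forall d, P d -> \tr (a * d) = 0.

Lemma tr_orth_two_sided (P : E -> Prop) : (forall a d, A a -> P d -> P (a * d)) ->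
  (forall a d, A a -> P d -> P (d * a)) -> two_sided A (tr_orth P).
Proof.
move=> Pl Pr; split=> [x []||k x y [Ax hx] [Ay hy]|a x Aa [Ax hx]|a x Aa [Ax hx]] //.
- by split=> [|d _]; [apply: sub_alg0 | rewrite mul0r mxtrace0].
- split=> [|d Pd]; first by case: sA => _ AL _; apply: AL.
  by rewrite mulrDl -scalerAl mxtraceD mxtraceZ hx // hy // mulr0 addr0.
- split=> [|d Pd]; first by case: sA => _ _ AM; apply: AM.
  by rewrite -mulrA trC -mulrA hx //; apply: Pr.
- split=> [|d Pd]; first by case: sA => _ _ AM; apply: AM.
  by rewrite -mulrA hx //; apply: Pl.
Qed.

Lemma tr_orth_nil r : tr_orth A r -> nil r.
Proof.
case: sA => A1 AL AM [Ar hr]; apply: tr_pow_nil; first exact: complex_pchar0.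
move=> k; rewrite exprS; apply: hr; elim: k => [|k IH]; first by rewrite expr0.
by rewrite exprS; apply: AM.
Qed.

(** [f] is a sum of elements of [X A] and [f'] of [A X]. So in [f' * d * f] and in the trace of
    [f * x * d] the element [d] only stands between elements of [X], where some [a] in [A] may
    replace it. *)
Lemma capture_units : exists f f',
  [/\ rspan A X f /\ f * f = f, lspan A X f' /\ f' * f' = f',
      forall x, x \in X -> tr_orth D (x - f * x),
      forall x, x \in X -> tr_orth D (x - x * f') &
      forall r, tr_orth A r -> tr_orth D (f * r * f')].
Proof.
have [A1 AL AM] := sA.
have [f [fX ff Hf]] := left_unit sA XA; have [f' [f'X ff' Hf']] := right_unit sA XA.
have Af : A f.
  by elim: fX => [|b x z Ab xX _ IH]; [apply: sub_alg0 | apply: sub_algD => //; apply: AM => //; apply: XA].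
have Af' : A f'.
  by elim: f'X => [|b x z Ab xX _ IH]; [apply: sub_alg0 | apply: sub_algD => //; apply: AM => //; apply: XA].
have fxl d a x : x \in X -> (forall x y, x \in X -> y \in X -> x * d * y = x * a * y) ->
    \tr (f * x * d) = \tr (f * x * a).
  move=> xX H; elim: fX => [|b y z Ab yX _ IH]; first by rewrite !mul0r.
  rewrite !mulrDl !mxtraceD IH; congr (_ + _).
  have e c : \tr (y * b * x * c) = \tr (x * c * y * b) by rewrite -mulrA trC !mulrA.
  by rewrite !e H.
have fxr d a x : x \in X -> (forall x y, x \in X -> y \in X -> x * d * y = x * a * y) ->
    \tr (x * f' * d) = \tr (x * f' * a).
  move=> xX H; elim: f'X => [|b y z Ab yX _ IH]; first by rewrite !mulr0 !mul0r.
  rewrite !mulrDr !mulrDl !mxtraceD IH; congr (_ + _).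
  have e c : \tr (x * (b * y) * c) = \tr (b * (y * c * x)) by rewrite -!mulrA [LHS]trC !mulrA.
  by rewrite !e H.
have fdf d a : (forall x y, x \in X -> y \in X -> x * d * y = x * a * y) ->
    f' * d * f = f' * a * f.
  move=> H; elim: f'X => [|b x z Ab xX _ IH]; first by rewrite !mul0r.
  rewrite !mulrDl IH; congr (_ + _); rewrite -!mulrA; congr (b * _); rewrite !mulrA {IH}.
  elim: fX => [|c y w Ac yX _ IH]; first by rewrite !mulr0.
  by rewrite !mulrDr IH !mulrA H.
exists f, f'; split=> // [x xX|x xX|r [Ar hr]].
- split=> [|d Dd]; first by apply: sub_algB; [|apply: XA |apply: AM => //; apply: XA].
  have [a [Aa h1 h2]] := captured Dd.
  by rewrite mulrBl linearB /= h1 // (fxl _ _ _ xX h2) -linearB -mulrBl /= Hf.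
- split=> [|d Dd]; first by apply: sub_algB; [|apply: XA |apply: AM => //; apply: XA].
  have [a [Aa h1 h2]] := captured Dd.
  by rewrite mulrBl linearB /= h1 // (fxr _ _ _ xX h2) -linearB -mulrBl /= Hf'.
- split=> [|d Dd]; first by apply: (AM) => //; apply: AM.
  have [a [Aa h1 h2]] := captured Dd.
  by rewrite -!mulrA trC -!mulrA (mulrA f') (fdf _ _ h2) hr //; apply: (AM) => //; apply: AM.
Qed.
End Capture.

(** * Conjugation of [X] into the complement [B] modulo [K] *)

Section Shift.
Context (m : nat).
Local Notation E := 'M[C]_m.+1.
Variables (A B K R : E -> Prop) (X : seq E) (bar : E -> E).
Hypotheses (sA : subalg A) (sB : subalg B) (BA : forall b, B b -> A b).
Hypotheses (iK : two_sided A K) (iR : two_sided A R) (KR : forall x, K x -> R x).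
Hypothesis Rnil : forall r, R r -> nil r.
Hypothesis AR : forall a, A a -> exists2 b, B b & R (a - b).
Hypothesis BR : forall b, B b -> R b -> b = 0.
Hypothesis XA : forall x, x \in X -> A x.
Hypothesis Bbar : forall x, x \in X -> B (bar x).
Hypothesis Rbar : forall x, x \in X -> R (x - bar x).

Let KD := two_sidedD iK. Let KN := two_sidedN iK. Let K0 := two_sided0 iK.
Let KMl := two_sidedMl iK. Let KMr := two_sidedMr iK. Let KZ := two_sidedZ iK.
Let RD := two_sidedD iR. Let RN := two_sidedN iR. Let R0 := two_sided0 iR.
Let RMl := two_sidedMl iR. Let RMr := two_sidedMr iR. Let RW := two_sidedW iR.
Let AM : forall x y, A x -> A y -> A (x * y). Proof. by case: sA. Qed.
Let BM : forall x y, B x -> B y -> B (x * y). Proof. by case: sB. Qed.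
Let AD := sub_algD sA. Let AN := sub_algN sA.
Let BD := sub_algD sB. Let BN := sub_algN sB.
Let A1 : A 1. Proof. by case: sA. Qed.
#[local] Hint Resolve KD KN K0 KMl KMr KZ RD RN R0 RMl RMr RW AM BM AD AN BD BN A1 BA KR XA Bbar Rbar : idl.
Ltac idl := by auto 12 with idl nocore.

Lemma complement_inj b c : B b -> B c -> R (b - c) -> b = c.
Proof. by move=> Bb Bc /BR h; apply/eqP; rewrite -subr_eq0 h //; idl. Qed.

Lemma lift_idem (f f0 : E) : B f0 -> R (f - f0) -> f * f = f -> f0 * f0 = f0.
Proof.
move=> Bf0; set r := f - f0 => Rr ff; apply: complement_inj; [idl|idl|].
have fE : f = f0 + r by rewrite /r; zmod.
clearbody r.
have -> : f0 * f0 - f0 = r - f0 * r - r * f0 - r * r.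
  by move: ff; rewrite fE => /eqP; rewrite -subr_eq0 => /eqP e; rewrite -[RHS]addr0 -e; ncring.
idl.
Qed.

(** The classical intertwiner [f f0 + (1 - f)(1 - f0)] of two idempotents; it is 1 modulo the nil
    ideal [R], hence invertible in [A]. *)
Lemma idem_conj (f f0 : E) : A f -> A f0 -> R (f - f0) -> f * f = f -> f0 * f0 = f0 ->
  exists u w, [/\ A u /\ A w, u * f0 = f * u & w * u = 1 /\ u * w = 1].
Proof.
move=> Af Af0; set r := f - f0 => Rr ff ff0.
have fE : f = f0 + r by rewrite /r; zmod.
clearbody r.
set u := f * f0 + (1 - f) * (1 - f0).
have uE : u = 1 + (r * f0 + r * f0 - r).
  rewrite /u; have -> : f * f0 + (1 - f) * (1 - f0) = 1 + (f * f0 - f0 + (f * f0 - f)) by ncring.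
  by congr (1 + _); rewrite fE mulrDl ff0; ncring.
have Rv : R (r * f0 + r * f0 - r) by idl.
have [w [Aw wu uw]] := unipotent_inverse sA (RW Rv) (Rnil Rv).
exists u, w; rewrite uE wu uw; split=> //; first by split=> //; idl.
rewrite -uE; have -> : u * f0 = f * (f0 * f0) + (1 - f) * (f0 - f0 * f0) by rewrite /u; ncring.
have -> : f * u = f * f * f0 + (f - f * f) * (1 - f0) by rewrite /u; ncring.
by rewrite ff0 ff !subrr mulr0 mul0r.
Qed.

Variables (f f' : E).
Hypotheses (fX : rspan A X f) (f'X : lspan A X f') (ff : f * f = f) (ff' : f' * f' = f').
Hypothesis fK : forall x, x \in X -> K (x - f * x).
Hypothesis f'K : forall x, x \in X -> K (x - x * f').
Hypothesis fRf' : forall r, R r -> K (f * r * f').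

Lemma shift : exists J w f0', [/\
  [/\ J 0, forall (k : C) x y, J x -> J y -> J (k *: x + y),
      (forall a x, B a -> J x -> J (a * x)), (forall a x, B a -> J x -> J (x * a)) &
      (forall x, J x -> B x) /\
      (forall a r c, J a -> R r -> J c -> K (a * r * c))],
  J f0' /\ (forall x, x \in X -> J (bar x) /\ bar x * f0' = bar x), R w &
  forall x, x \in X -> K (x - (1 + w) * bar x * (1 - w))].
Proof.
have Af : A f by elim: fX => [|b x z Ab xX _ IH]; [exact: sub_alg0 | idl].
have Af' : A f' by elim: f'X => [|b x z Ab xX _ IH]; [exact: sub_alg0 | idl].
have [f0 Bf0 Rf] := AR Af; have [f0' Bf0' Rf'] := AR Af'.
have ff0 := lift_idem Bf0 Rf ff; have ff0' := lift_idem Bf0' Rf' ff'.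
set d := f - f0 in Rf; set d' := f' - f0' in Rf'.
have Rf_ : R (f - f0) := Rf. have Rf'_ : R (f' - f0') := Rf'.
have fE : f = f0 + d by rewrite /d; zmod.
have f'E : f' = f0' + d' by rewrite /d'; zmod.
clearbody d d'.
have f0b x : x \in X -> f0 * bar x = bar x.
  move=> xX; apply: complement_inj; [idl|idl|].
  have -> : f0 * bar x - bar x = (x - bar x) - (x - f * x) - f0 * (x - bar x) - d * x.
    by rewrite fE; ncring.
  by have := fK xX; idl.
have f0'b x : x \in X -> bar x * f0' = bar x.
  move=> xX; apply: complement_inj; [idl|idl|].
  have -> : bar x * f0' - bar x = (x - bar x) - (x - x * f') - (x - bar x) * f0' - x * d'.
    by rewrite f'E; ncring.
  by have := f'K xX; idl.
have f0Rf0' r : R r -> K (f0 * r * f0').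
  move=> Rr.
  have [u [w [[Au Aw] uf [wu uw]]]] := idem_conj Af (BA Bf0) Rf_ ff ff0.
  have [v [z [[Av Az] vf [zv vz]]]] := idem_conj Af' (BA Bf0') Rf'_ ff' ff0'.
  (* f0 = w f u and f0' = z f' v *)
  have -> : f0 * r * f0' = w * (f * (u * r * z) * f') * v.
    rewrite -[f0]mul1r -wu -(mulrA w u f0) uf -[f0' in LHS]mul1r -zv -(mulrA z v f0') vf.
    by rewrite !mulrA.
  by have := fRf' (RMr Az (RMl Au Rr)); idl.
have bRb x y r : x \in X -> y \in X -> R r -> K (bar x * r * bar y).
  move=> xX yX Rr; rewrite -(f0b x xX) -(f0'b y yX).
  have -> : f0 * bar x * r * (bar y * f0') = f0 * (bar x * r * bar y) * f0' by rewrite !mulrA.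
  by apply: f0Rf0'; idl.
(* A double annihilator for the relation that [a R c] and [c R a] lie in [K]: [J1] is taken against
   the [bar x], [J] against [J1]. Since each [bar x] is in [J1], [J] is contained in [J1], which
   gives [J R J] inside [K], and [J] is an ideal of [B]. *)
pose J1 a := B a /\ forall r x, R r -> x \in X -> K (a * r * bar x) /\ K (bar x * r * a).
pose J a := B a /\ forall r c, R r -> J1 c -> K (a * r * c) /\ K (c * r * a).
have J1b x : x \in X -> J1 (bar x) by move=> xX; split=> [|r y Rr yX]; [idl|split; apply: bRb].
have Jb x : x \in X -> J (bar x).
  by move=> xX; split=> [|r c Rr [Bc hc]]; [idl|split; have [] := hc r x Rr xX].
have JJ1 a : J a -> J1 a.
  by case=> Ba ha; split=> // r x Rr xX; apply: ha => //; apply: J1b.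
have JB a : J a -> B a by case.
have JL (k : C) x y : J x -> J y -> J (k *: x + y).
  move=> [Bx hx] [By hy]; split=> [|r c Rr Jc]; first by case: sB => _ h _; apply: h.
  have [h1 h2] := hx r c Rr Jc; have [h3 h4] := hy r c Rr Jc.
  by rewrite !mulrDl mulrDr -!scalerAl -scalerAr; split; idl.
have J0 : J 0.
  by split=> [|r c Rr Jc]; [apply: sub_alg0 | rewrite !mul0r mulr0; split; idl].
have JMl a x : B a -> J x -> J (a * x).
  move=> Ba [Bx hx]; split=> [|r c Rr Jc]; first by idl.
  have [h1 _] := hx r c Rr Jc; have [_ h2] := hx (r * a) c (RMr (BA Ba) Rr) Jc.
  have -> : a * x * r * c = a * (x * r * c) by rewrite !mulrA.
  have -> : c * r * (a * x) = c * (r * a) * x by rewrite !mulrA.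
  by split; idl.
have JMr a x : B a -> J x -> J (x * a).
  move=> Ba [Bx hx]; split=> [|r c Rr Jc]; first by idl.
  have [h1 _] := hx (a * r) c (RMl (BA Ba) Rr) Jc; have [_ h2] := hx r c Rr Jc.
  have -> : x * a * r * c = x * (a * r) * c by rewrite !mulrA.
  have -> : c * r * (x * a) = c * r * x * a by rewrite !mulrA.
  by split; idl.
have JRJ a r c : J a -> R r -> J c -> K (a * r * c).
  by move=> [Ba ha] Rr /JJ1 Jc; have [] := ha r c Rr Jc.
have JD x y : J x -> J y -> J (x + y) by move=> Jx Jy; rewrite -[x]scale1r; apply: JL.
(* The [B]-part of an element of [X A] is a sum of terms [bar x * b0], so it lies in [J]; this
   applies to [f0], and its mirror image to [f0']. *)
have Jf z : rspan A X z -> forall z0, B z0 -> R (z - z0) -> J z0.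
  elim=> [|b x y Ab xX hy IH] z0 Bz0 Rz; first by rewrite (BR Bz0) // -[z0]opprK; apply: RN; rewrite -sub0r.
  have Ay : A y by elim: hy => [|c t z' Ac tX _ hz]; [exact: sub_alg0 | idl].
  have [b0 Bb0 Rb] := AR Ab; have [y0 By0 Ry] := AR Ay.
  have -> : z0 = bar x * b0 + y0.
    apply: complement_inj => //; first by idl.
    have -> : z0 - (bar x * b0 + y0) = - (x * b + y - z0) + (y - y0) + (x - bar x) * b0 + x * (b - b0).
      by ncring.
    idl.
  by apply: JD; [apply: JMr => //; apply: Jb | apply: IH].
have Jf' z : lspan A X z -> forall z0, B z0 -> R (z - z0) -> J z0.
  elim=> [|b x y Ab xX hy IH] z0 Bz0 Rz; first by rewrite (BR Bz0) // -[z0]opprK; apply: RN; rewrite -sub0r.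
  have Ay : A y by elim: hy => [|c t z' Ac tX _ hz]; [exact: sub_alg0 | idl].
  have [b0 Bb0 Rb] := AR Ab; have [y0 By0 Ry] := AR Ay.
  have -> : z0 = b0 * bar x + y0.
    apply: complement_inj => //; first by idl.
    have -> : z0 - (b0 * bar x + y0) = - (b * x + y - z0) + (y - y0) + b0 * (x - bar x) + (b - b0) * x.
      by ncring.
    idl.
  by apply: JD; [apply: JMl => //; apply: Jb | apply: IH].
have Jf0 : J f0 by apply: (Jf f).
have Jf0' : J f0' by apply: (Jf' f').
set w := d * f0 - f0' * d'.
exists J, w, f0'; split=> //; [by split=> // x xX; split; auto|by rewrite /w; idl|].
move=> x xX; set b := bar x; have Jbx := Jb x xX; rewrite -/b in Jbx.
have Bb := Bbar xX; rewrite -/b in Bb.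
have e0 : f0 * b = b by exact: f0b.
have e0' : b * f0' = b by exact: f0'b.
set n := x - b; have Rn : R n by exact: Rbar.
have xE : x = b + n by rewrite /n; zmod.
clearbody n b.
(* x = f x f' = (1 + d) b (1 + d') modulo K, while f0' d' b and b d f0 lie in K *)
have h1 : K (x - (b + d * b + b * d' + d * b * d')).
  have -> : x - (b + d * b + b * d' + d * b * d') = (x - f * x) + f * (x - x * f') + f * n * f'.
    have -> : f * n * f' = f * x * f' - (f0 + d) * b * (f0' + d') by rewrite -fE -f'E xE; ncring.
    have -> : (f0 + d) * b * (f0' + d') = b + d * b + b * d' + d * b * d'.
      by rewrite mulrDl e0 mulrDr !mulrDl -(mulrA d) e0' addrA; zmod.
    ncring.
  by have := fRf' Rn; have := fK xX; have := f'K xX; idl.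
have h2 : K (f0' * d' * b) by apply: JRJ.
have h3 : K (b * d * f0) by apply: JRJ.
have -> : x - (1 + w) * b * (1 - w) = (x - (b + d * b + b * d' + d * b * d'))
  + f0' * d' * b - (f0' * d' * b) * w + b * d * f0 + d * (b * d * f0).
  have wb : w * b = d * b - f0' * d' * b by rewrite /w mulrBl -(mulrA d) e0.
  have bw : b * w = b * d * f0 - b * d' by rewrite /w mulrBr !mulrA e0'.
  have -> : (1 + w) * b * (1 - w) = b + w * b - b * w - w * b * w by ncring.
  have dbw : d * b * w = d * (b * d * f0) - d * b * d' by rewrite -mulrA bw; ncring.
  by rewrite wb bw mulrBl dbw; ncring.
have Aw : A w by rewrite /w; idl.
by have := RW Rf; idl.
Qed.
End Shift.

(** * Moving the conjugation inside [q] *)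

Section Conjugate.
Context (m : nat).
Local Notation E := 'M[C]_m.+1.
Variables (q s N : {vspace E}) (pr : E -> E) (A K R J : E -> Prop) (w f0' : E) (X : seq E).
Hypotheses (qL : lie_closed q) (sL : lie_closed s) (sW : whitehead s 0%VS).
Hypotheses (sq : (s <= q)%VS) (Nq : (N <= q)%VS) (Nq_ideal : lie_ideal_in q N).
Hypotheses (prlin : linear pr) (pr_s : forall x, x \in q -> pr x \in s)
  (pr_N : forall x, x \in q -> x - pr x \in N)
  (pr_eq : forall x y, y \in s -> x - y \in N -> pr x = y).
Hypotheses (sA : subalg A) (qA : forall x, x \in q -> A x).
Hypotheses (iK : two_sided A K) (iR : two_sided A R) (KR : forall x, K x -> R x).
Hypotheses (NR : forall z, z \in N -> R z).
Hypotheses (J0 : J 0) (JL : forall (k : C) x y, J x -> J y -> J (k *: x + y)).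
Hypotheses (JMl : forall a x, a \in s -> J x -> J (a * x))
  (JMr : forall a x, a \in s -> J x -> J (x * a)).
Hypotheses (JA : forall x, J x -> A x)
  (JRJ : forall a r c, J a -> R r -> J c -> K (a * r * c)).
Hypotheses (Jf0' : J f0') (Rw : R w).
Hypotheses (Xq : forall x, x \in X -> x \in q).
Hypotheses (Jpr : forall x, x \in X -> J (pr x)) (pr_f0' : forall x, x \in X -> pr x * f0' = pr x).
Hypothesis shiftX : forall x, x \in X -> K (x - (1 + w) * pr x * (1 - w)).

Let KD := two_sidedD iK. Let KN := two_sidedN iK. Let K0 := two_sided0 iK.
Let KMl := two_sidedMl iK. Let KMr := two_sidedMr iK. Let KZ := two_sidedZ iK.
Let RD := two_sidedD iR. Let RN := two_sidedN iR. Let R0 := two_sided0 iR.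
Let RMl := two_sidedMl iR. Let RMr := two_sidedMr iR. Let RW := two_sidedW iR.
Let AM : forall x y, A x -> A y -> A (x * y). Proof. by case: sA. Qed.
Let AD := sub_algD sA. Let AN := sub_algN sA.
Let A1 : A 1. Proof. by case: sA. Qed.
#[local] Hint Resolve KD KN K0 KMl KMr KZ RD RN R0 RMl RMr RW AM AD AN A1 qA KR Xq Jpr JA : idl.
Ltac idl := by auto 12 with idl nocore.

Let pr0 := lin0 prlin.


Lemma pr_hom : hom_on pr q.
Proof.
move=> x y xq yq; have xs := pr_s xq; have ys := pr_s yq.
apply: pr_eq; first exact: sL.
have -> : lie x y - lie (pr x) (pr y) = lie x (y - pr y) - lie (pr y) (x - pr x).
  by rewrite [in RHS]lieDr [in RHS]lieNr [in RHS]lieDr [in RHS]lieNr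
    [lie (pr y) x]lieC [lie (pr y) (pr x)]lieC; zmod.
by apply: rpredB; apply: Nq_ideal; rewrite ?pr_N // (subvP sq).
Qed.

(* Project R equivariantly onto the elements that sX moves into K: brackets with sX go to K. *)
Lemma brv_annihilated (sX Rv : {vspace E}) (v : E) : whitehead sX 0%VS -> (sX <= s)%VS ->
  (forall r, r \in Rv <-> R r) ->
  v \in brv sX Rv -> (forall y, y \in sX -> K (lie y v)) -> K v.
Proof.
move=> sXW sXs HRv vb vK.
have As y : y \in sX -> A y by move=> ys; apply: qA; apply: (subvP sq); apply: (subvP sXs).
have [||T HT] := @vspace_of_pred _ _ (fun v => R v /\ forall y, y \in sX -> K (lie y v)).
- by split=> [|y _]; [idl | rewrite liex0].
- move=> k a b [Ra ha] [Rb hb]; split=> [|y ys].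
    by apply: RD => //; apply: (two_sidedZ iR).
  by rewrite lieDr lieZr; apply: KD; [apply: KZ; apply: ha | apply: hb].
have lieR y r : y \in sX -> R r -> R (lie y r).
  by move=> /As Ay Rr; rewrite lieE; idl.
have lieK y r : y \in sX -> K r -> K (lie y r).
  by move=> /As Ay Kr; rewrite lieE; idl.
have [||||y r ys /HRv Rr|y r ys /HT [Rr hr]|y r|phi [p1 p2 p3]] :=
  @equivariant_projection m sX 0%VS E (@adl m) Rv T sXW.
- exact: sub0v.
- exact: adl_linear.
- by move=> x z u _ _; rewrite adl_lie.
- by apply/subvP => r /HT [/HRv].
- by apply/HRv; rewrite adE; apply: lieR.
- apply/HT; rewrite adE; split=> [|z zs]; first exact: lieR.
  by apply: lieK => //; apply: hr.
- by rewrite memv0 => /eqP -> _; rewrite adE lie0x.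
have vR : R v.
  move: vb; apply: brv_ind => [|k x y Rx Ry|x y xs /HRv Ry]; [idl| |exact: lieR].
  by apply: RD => //; apply: (two_sidedZ iR).
have <- : phi v = v by apply: p2; apply/HT.
move: vb; apply: (@brv_ind _ _ _ _ (fun v => K (phi v))) => [|k x y Rx Ry|x y xs yR].
  by rewrite linear0.
  by rewrite linearD linearZ; apply: KD => //; apply: KZ.
have := p3 x y xs yR; rewrite !adE => ->; have /HT [_ h] := p1 y yR; exact: h x xs.
Qed.

(** [H] consists of the elements of [q] that are, modulo [K], conjugates of elements of [sX] under
    [1 + v]; [pr] maps it onto the semisimple [sX] with kernel in [P = H :&: K]. To get [v] inside
    [N], [w] is first projected to [N + K], and then a part commuting with [sX] is removed. *)
Lemma conjugate_subalgebra : exists H P : {vspace E},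
  [/\ lie_closed H /\ (P <= H)%VS, (H <= q)%VS /\ lie_ideal_in H P, forall x, x \in X -> x \in H,
      forall x, x \in P -> K x & whitehead H P].
Proof.
have [|k x y [xs Jx] [ys Jy]|sX HsX] := @vspace_of_pred _ _ (fun y => y \in s /\ J y).
- by split; [exact: mem0v|].
- by split; [rewrite rpredD ?rpredZ | apply: JL].
have sXs : (sX <= s)%VS by apply/subvP => y /HsX [].
have JsX y : y \in sX -> J y by move=> /HsX [].
have sXq y : y \in sX -> y \in q by move=> /HsX [ys _]; apply: (subvP sq).
have JD x y : J x -> J y -> J (x + y) by move=> Jx Jy; rewrite -[x]scale1r; apply: JL.
have JN x : J x -> J (- x) by move=> Jx; rewrite -scaleN1r -[_ *: _]addr0; apply: JL.
have sXi : lie_ideal_in s sX.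
  move=> x y xs /HsX [ys Jy]; apply/HsX; split; first exact: sL.
  by rewrite lieE; apply: JD; [apply: JMl | apply: JN; apply: JMr].
have sXW : whitehead sX 0%VS by apply: whitehead_ideal sL sW sXs sXi.
have XsX x : x \in X -> pr x \in sX.
  by move=> xX; apply/HsX; split; [apply: pr_s; apply: Xq | apply: Jpr].
have [Rv HRv] := two_sided_vspace iR; have [Kv HKv] := two_sided_vspace iK.
have lieR y r : y \in q -> R r -> R (lie y r).
  by move=> /qA Ay Rr; rewrite lieE; idl.
have lieK y r : y \in q -> K r -> K (lie y r).
  by move=> /qA Ay Kr; rewrite lieE; idl.
have NKR : (N + Kv <= Rv)%VS.
  by rewrite subv_add; apply/andP; split; apply/subvP => r; [move=> /NR|move=> /HKv /KR] => /HRv.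
(* [phi] projects [R] onto [N + K] equivariantly under [s]; the [N]-component [z] of [phi w] is the
   first candidate for [v]. *)
have [||||y r ys /HRv Rr|y r ys /memv_addP [n nN [k kK ->]]|y r|phi [p1 p2 p3]] :=
  @equivariant_projection m s 0%VS E (@adl m) Rv (N + Kv)%VS sW.
- exact: sub0v.
- exact: adl_linear.
- by move=> x z u _ _; rewrite adl_lie.
- exact: NKR.
- by apply/HRv; rewrite adE; apply: lieR => //; apply: (subvP sq).
- rewrite adE lieDr; apply: memv_add; first by apply: Nq_ideal => //; apply: (subvP sq).
  by apply/HKv/lieK; [apply: (subvP sq) | apply/HKv].
- by rewrite memv0 => /eqP -> _; rewrite adE lie0x.
have wR : w \in Rv by apply/HRv.
have /memv_addP [z zN [k0 /HKv k0K wE]] := p1 w wR.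
(* H^1 for [sX] acting on [N]: up to an element commuting with [sX], [z] is an element [n1] of
   [[sX, N]]. *)
have [||||y n ys nN|||y n ys nN|||y n|n1 n1b Hn1] :=
  @whitehead_mod m sX E (@lie _) N 0%VS _ _ _ _ _ _ 0%VS (brv sX N) sXW _ _ _ _ _ z zN.
- by move=> v k x y; rewrite lieDl lieZl.
- by move=> v k x y; rewrite lieDr lieZr.
- by move=> x y v _ _ _; rewrite jacobi; zmod.
- exact: sub0v.
- by apply: Nq_ideal => //; apply: sXq.
- by move=> x v xs; rewrite memv0 => /eqP ->; rewrite liex0 mem0v.
- exact: sub0v.
- exact: mem_brv.
- by apply: brv_sub => y n ys nN; apply: Nq_ideal => //; apply: sXq.
- exact: sub0v.
- by rewrite memv0 => /eqP -> _; rewrite lie0x mem0v.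
set v := n1 in n1b Hn1.
have vN : v \in N.
  by apply: (subvP _ _ n1b); apply: brv_sub => y n ys nN; apply: Nq_ideal => //; apply: sXq.
have Rv_ : R v by apply: NR.
have bracket_w x : x \in X -> K (lie (pr x) (w - v)).
  move=> xX; set b := pr x; have Jb : J b by apply: Jpr.
  have bs : b \in sX by apply: XsX.
  have bss : b \in s by apply: (subvP sXs).
  have -> : lie b (w - v) = lie b (w - phi w) + lie b k0 + lie b (z - v).
    by rewrite wE !lieDr !lieNr !lieDr; zmod.
  have /eqP -> : lie b (z - v) == 0 by rewrite -memv0 Hn1.
  rewrite addr0; apply: KD; last by apply: lieK => //; apply: sXq.
  have phiR : R (phi w) by apply/HRv; apply: (subvP NKR); apply: p1.
  apply: (brv_annihilated sXW sXs HRv).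
    by apply: mem_brv => //; apply/HRv; idl.
  move=> y ys; have Jy := JsX y ys.
  have bN : b - x \in N by rewrite -opprB rpredN pr_N //; apply: Xq.
  set t := lie b (w - phi w).
  have tR : t \in Rv by apply/HRv; apply: lieR; [apply: sXq | idl].
  have yss : y \in s by apply: (subvP sXs).
  have phit : phi t = 0.
    have := p3 b (w - phi w) bss; rewrite !adE -/t => ->; last by apply/HRv; idl.
    by rewrite linearB /= (p2 (phi w)) ?subrr ?liex0 //; apply: p1.
  (* As [phi t = 0], equivariance finishes once [[y, t]] is in the image [N + K] of [phi]. In [t]
     the terms [b - x] and [[phi w, b]] lie in [N + K], [x - (1 + w) b (1 - w)] lies in [K], and
     [w b w] falls into [K] after multiplication by [y], as [J R J] does. *)
  have ytNK : lie y t \in (N + Kv)%VS.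
    have -> : lie y t = lie y (b - x + lie (phi w) b) +
       (lie y (x - (1 + w) * b * (1 - w)) - (y * w * b) * w + w * (b * w * y)).
      have tE : t = b - x + lie (phi w) b + (x - (1 + w) * b * (1 - w)) - w * b * w.
        by rewrite /t !lieE; ncring.
      by rewrite [in LHS]tE ![in LHS]lieDr ![in LHS]lieNr ![in RHS]lieDr !lieE; ncring.
    have /memv_addP [n' n'N [k' /HKv k'K ->]] : phi w \in (N + Kv)%VS by apply: p1.
    rewrite [lie (n' + k') b]lieDl.
    have -> : b - x + (lie n' b + lie k' b) = (b - x + lie n' b) + lie k' b by zmod.
    rewrite [lie y (_ + lie k' b)]lieDr -addrA.
    apply: memv_add.
      apply: Nq_ideal; first exact: sXq.
      by rewrite rpredD // lieC rpredN; apply: Nq_ideal => //; apply: sXq.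
    apply/HKv; apply: KD.
      by apply: (lieK); [apply: sXq | rewrite lieC; apply: KN; apply: lieK => //; apply: sXq].
    have K1 : K (lie y (x - (1 + w) * b * (1 - w))) by apply: lieK; [apply: sXq | apply: shiftX].
    have K2 : K (y * w * b) by apply: JRJ.
    have K3 : K (b * w * y) by apply: JRJ.
    by have := RW Rw; idl.
  have <- : phi (lie y t) = lie y t by apply: p2.
  have := p3 y t yss tR; rewrite !adE => ->; by rewrite phit liex0.
set u := w - v in bracket_w; have Ru : R u by rewrite /u; idl.
have wuv : w = v + u by rewrite /u; zmod.
clearbody u.
have Kub x : x \in X -> K (u * pr x) /\ K (pr x * u).
  move=> xX; have Jb := Jpr xX; have K1 := bracket_w x xX; rewrite lieE in K1.
  have K2 : K (pr x * u * f0') by apply: JRJ.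
  (* The right unit [f0'] of [pr x] belongs to [J], so that [pr x * u * f0'] is in [J R J]. *)
  have Kub : K (u * pr x).
    have -> : u * pr x = pr x * u * f0' - (pr x * u - u * pr x) * f0'.
      by rewrite mulrBl -(mulrA u) pr_f0' //; zmod.
    idl.
  by split=> //; rewrite -[_ * u](subrK (u * pr x)); idl.
have Av : A v by idl.
have Au : A u by idl.
have shiftv x : x \in X -> K (x - (1 + v) * pr x * (1 - v)).
  move=> xX; have [K1 K2] := Kub x xX; have K3 := shiftX xX; have Jb := Jpr xX.
  have Ab := JA Jb; have Aw := RW Rw.
  have -> : x - (1 + v) * pr x * (1 - v) = x - (1 + w) * pr x * (1 - w)
     + u * pr x - pr x * u - (u * pr x) * v - (w * (pr x * u)).
    by rewrite wuv; ncring.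
  idl.
have KJ a c : J a -> J c -> K (a * v * c) by move=> Ja Jc; apply: JRJ.
(* v is a sum of brackets of elements of J and R, so v v y and y v v lie in K for y in J *)
have Kvvy y : y \in sX -> K (v * v * y) /\ K (y * v * v).
  move=> ys; have Jy := JsX y ys; have Ay := JA Jy.
  have H1 : forall v', v' \in brv sX N -> K (y * v' * v) /\ K (v * v' * y).
    apply: brv_ind => [|k a b [h1 h2] [h3 h4]|a n /JsX Ja /NR Rn].
    - by rewrite !mulr0 !mul0r; split; idl.
    - by rewrite !mulrDr !mulrDl -!scalerAr -!scalerAl; split; idl.
    suff H2 : forall v', v' \in brv sX N ->
        K (y * (a * n - n * a) * v') /\ K (v' * (a * n - n * a) * y) by rewrite lieE; apply: H2.
    apply: brv_ind => [|k c b [h1 h2] [h3 h4]|c n' /JsX Jc /NR Rn'].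
    - by rewrite !mulr0 !mul0r; split; idl.
    - move: (a * n - n * a) h1 h2 h3 h4 => z0 h1 h2 h3 h4.
      by rewrite !mulrDr !mulrDl -!scalerAr -!scalerAl; split; idl.
    have Aa := JA Ja; have Ac := JA Jc; have An := RW Rn; have An' := RW Rn'.
    have k1 : K (y * n * a) by apply: JRJ.
    have k2 : K (a * n * c) by apply: JRJ.
    have k3 : K (c * n * a) by apply: JRJ.
    have k4 : K (a * n * y) by apply: JRJ.
    have k5 : K (a * n' * c) by apply: JRJ.
    have k6 : K (y * (a * n * n') * c) by apply: JRJ => //; idl.
    have k7 : K (c * (n' * n * a) * y) by apply: JRJ => //; idl.
    rewrite lieE; split.
      have -> : y * (a * n - n * a) * (c * n' - n' * c) =
        y * (a * n * c) * n' - y * (a * n * n') * c - (y * n * a) * (c * n' - n' * c) by ncring.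
      idl.
    have -> : (c * n' - n' * c) * (a * n - n * a) * y =
      (c * n' - n' * c) * (a * n * y) - c * (n' * n * a) * y + n' * (c * n * a) * y by ncring.
    idl.
  by have [h1 h2] := H1 v n1b; split.
pose conj y := (1 + v) * y * (1 - v).
have conjL (k : C) x y : conj (k *: x + y) = k *: conj x + conj y.
  by rewrite /conj [(1 + v) * _]mulrDr mulrDl -scalerAr -scalerAl.
have [|k x y [xq xs hx] [yq ys hy]|H HH] := @vspace_of_pred _ _ (fun h =>
    [/\ h \in q, pr h \in sX & K (h - conj (pr h))]).
- by split; rewrite ?pr0 ?mem0v // /conj mulr0 mul0r subr0.
- rewrite prlin conjL; split; rewrite ?rpredD ?rpredZ //.
  have -> : k *: x + y - (k *: conj (pr x) + conj (pr y)) =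
     k *: (x - conj (pr x)) + (y - conj (pr y)) by rewrite scalerBr; zmod.
  by apply: KD => //; apply: KZ.
have Ac y : A y -> A (conj y) by rewrite /conj => Ay; idl.
have HL : lie_closed H.
  move=> x y /HH [xq xs hx] /HH [yq ys hy]; apply/HH; rewrite pr_hom //.
  split; [exact: qL | by apply: sXi => //; apply: (subvP sXs) |].
  have Jx := JsX _ xs; have Jy := JsX _ ys; have Ax := JA Jx; have Ay := JA Jy.
  (* [(1 - v) * (1 + v)] is [1 - v * v], and [a * v * v * b] is in [J R J]: the map [conj] is
     multiplicative on [J] modulo [K] although [1 - v] is not the inverse of [1 + v]. *)
  have cc a b : J a -> J b -> K (conj a * conj b - conj (a * b)).
    move=> Ja Jb; have -> : conj a * conj b - conj (a * b) = - ((1 + v) * (a * (v * v) * b) * (1 - v)).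
      by rewrite /conj; ncring.
    by have := JRJ Ja (RMl Av Rv_) Jb; have := JA Ja; have := JA Jb; idl.
  have := cc _ _ Jx Jy; have := cc _ _ Jy Jx; move: hx hy.
  have -> : conj (lie (pr x) (pr y)) = conj (pr x * pr y) - conj (pr y * pr x).
    by rewrite lieE /conj [(1 + v) * (_ - _)]mulrBr mulrBl.
  have := Ac _ Ax; have := Ac _ Ay; have := qA xq; have := qA yq.
  move: (conj (pr x)) (conj (pr y)) (conj (pr x * pr y)) (conj (pr y * pr x)) => cx cy cxy cyx.
  move=> Aqy Aqx Acy Acx hx hy h1 h2.
  have -> : lie x y - (cxy - cyx) = (x - cx) * y + cx * (y - cy) - (y - cy) * x - cy * (x - cx)
     + (cx * cy - cxy) - (cy * cx - cyx) by rewrite lieE; ncring.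
  idl.
have [||P HP] := @vspace_of_pred _ _ (fun h => h \in H /\ K h).
- by split; [exact: mem0v | idl].
- by move=> k x y [xH Kx] [yH Ky]; split; [rewrite rpredD ?rpredZ | apply: KD => //; apply: KZ].
have Hq h : h \in H -> h \in q by move=> /HH [].
exists H, P; split.
- by split=> //; apply/subvP => x /HP [].
- split; first by apply/subvP => h /Hq.
  by move=> x y xH /HP [yH Ky]; apply/HP; split; [apply: HL | apply: lieK => //; apply: Hq].
- by move=> x xX; apply/HH; split; [apply: Xq | apply: XsX | apply: shiftv].
- by move=> x /HP [].
apply: (@whitehead_preimg m m H P pr sX HL prlin _ _ _ sXW).
- by move=> x y /Hq xq /Hq yq; apply: pr_hom.
- move=> y; split=> [ys|[x /HH [_ h _] ->]] //.
  (* The preimage of [y] is the exponential of [ad v] up to second order. It stays in [q] because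
     [v] is in [N], and it differs from [conj y] by half of [v v y + y v v]. *)
  set l1 := lie v y; set l2 := lie v l1.
  have l1N : l1 \in N by rewrite /l1 lieC rpredN; apply: Nq_ideal => //; apply: sXq.
  have l2N : l2 \in N by apply: Nq_ideal => //; apply: (subvP Nq).
  have py : pr (y + l1 + 2^-1 *: l2) = y.
    apply: pr_eq; first by apply: (subvP sXs).
    have -> : y + l1 + 2^-1 *: l2 - y = l1 + 2^-1 *: l2 by zmod.
    by rewrite rpredD ?rpredZ.
  exists (y + l1 + 2^-1 *: l2) => //; apply/HH; rewrite py; split=> //.
    by rewrite rpredD ?rpredD ?rpredZ ?(subvP Nq _ l1N) ?(subvP Nq _ l2N) ?sXq //; apply: sXq.
  have [k1 k2] := Kvvy y ys.
  have -> : y + l1 + 2^-1 *: l2 - conj y = 2^-1 *: (v * v * y + y * v * v).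
    have e2 : l2 = v * v * y + y * v * v - (v * y * v) *+ 2 by rewrite /l2 /l1 !lieE mulr2n; ncring.
    rewrite e2 scalerBr -scaler_nat scalerA mulVf ?scale1r; last by have := complex_pchar0 2; rewrite !inE /= => ->.
    move: (2^-1 *: (v * v * y + y * v * v)) => t.
    by rewrite /l1 /conj lieE; ncring.
  by apply: KZ; idl.
- move=> x xH px; apply/HP; split=> //.
  by have /HH [_ _] := xH; rewrite px /conj mulr0 mul0r subr0.
Qed.
End Conjugate.

(** The stable term of the derived series is perfect, hence zero by Engel's theorem and
    [perfect_word_nil]. *)
Lemma nil_solvable m (P : {vspace 'M[C]_m.+1}) : lie_closed P -> (forall x, x \in P -> nil x) ->
  exists k, dser P k = 0%VS.
Proof.
move=> PL Pnil; have [l Pl] := engel PL Pnil; have [k Hk] := dser_stable PL.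
exists k; apply: (@perfect_word_nil _ _ _ l); first exact: Hk.
move=> w /allP wP; apply: Pl; apply/allP => x /wP /= xk.
by have /subvP := dser_sub k PL; apply.
Qed.

(* D stands for the corners of the envelopes of all larger algebras; on X they act
   like elements of A. *)
Lemma capture_levi m (S s0 : {vspace 'M[C]_m.+1}) (D : 'M[C]_m.+1 -> Prop) (X : seq 'M[C]_m.+1) :
  lie_closed S ->
  let A := env (brv S S) in
  (forall a, A a -> D a) -> (forall a d, A a -> D d -> D (a * d)) ->
  (forall a d, A a -> D d -> D (d * a)) ->
  (forall x, x \in X -> x \in brv S S) ->
  (forall d, D d -> exists a, [/\ A a, forall x, x \in X -> \tr (x * d) = \tr (x * a) &
     forall x y, x \in X -> y \in X -> x * d * y = x * a * y]) ->
  lie_closed s0 -> whitehead s0 0%VS -> (s0 <= <<X>>)%VS ->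
  exists s : {vspace 'M[C]_m.+1}, [/\ lie_closed s, whitehead s 0%VS, (s0 <= s)%VS,
    (s <= brv S S)%VS & forall x, x \in X -> exists2 y, y \in s & tr_orth A D (x - y)].
Proof.
move=> SL; have SS : (brv S S <= S)%VS by apply: brv_sub.
have [s [N [[sL sW] sq Nq NI [qsN trN]]]] := levi_linear SL.
set q := brv S S in SS sq Nq qsN *.
have qL : lie_closed q by move=> x y xq yq; apply: mem_brv; apply: (subvP SS).
move=> A AD DAl DAr Xq capt s0L s0W s0X.
have sA : subalg A by exact: env_subalg.
have [A1 AL AM] := sA.
have XA x : x \in X -> A x by move=> /Xq; apply: env_gen.
have NIq : lie_ideal_in q N by move=> x y xq; apply: NI; apply: (subvP SS).
pose K := tr_orth A D; pose R := tr_orth A A.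
have iK : two_sided A K by apply: tr_orth_two_sided.
have iR : two_sided A R by apply: tr_orth_two_sided => // a d Aa Ad; apply: AM.
have KR x : K x -> R x by case=> Ax hx; split=> // a /AD; apply: hx.
have Rnil : forall r, R r -> nil r by exact: tr_orth_nil.
have NR z : z \in N -> R z.
  move=> zN; split=> [|b Ab]; first by apply: env_gen; apply: (subvP Nq).
  by apply: trN => //; apply: env_sub Ab.
pose B := env s.
have sB : subalg B by exact: env_subalg.
have BA b : B b -> A b by move=> h; apply: env_sub h.
(* [A = B + R] is checked along the generation of [A], from [q <= s + N] and the inclusion of [N] in
   [R]. *)
have AR a : A a -> exists2 b, B b & R (a - b).
  elim=> [|x /(subvP qsN) /memv_addP [y ys [z zN ->]]|k x y Ax [b Bb Rb] Ay [c Bc Rc]|x y Ax [b Bb Rb] Ay [c Bc Rc]].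
  - by exists 1; [case: sB | rewrite subrr; apply: two_sided0 iR].
  - by exists y; [apply: env_gen | rewrite [y + z]addrC addrK; apply: NR].
  - exists (k *: b + c); first by case: sB => _ h _; apply: h.
    have -> : k *: x + y - (k *: b + c) = k *: (x - b) + (y - c) by rewrite scalerBr; zmod.
    by apply: (two_sidedD iR) => //; apply: (two_sidedZ iR).
  - exists (b * c); first by case: sB => _ _ h; apply: h.
    have -> : x * y - b * c = (x - b) * y + b * (y - c) by ncring.
    by apply: (two_sidedD iR); [apply: (two_sidedMr iR) | apply: (two_sidedMl iR) => //; apply: BA].
(* [B] meets [R] in a nil two-sided ideal of the envelope of the semisimple [s]. *)
have BR b : B b -> R b -> b = 0.
  move=> Bb Rb.
  have [||P HP] := @vspace_of_pred _ _ (fun b => B b /\ R b).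
  - by split; [exact: sub_alg0 | exact: two_sided0 iR].
  - move=> k x y [Bx Rx] [By Ry]; split; first by case: sB => _ h _; apply: h.
    by apply: (two_sidedD iR) => //; apply: (two_sidedZ iR).
  have P0 : P = 0%VS.
    apply: (nil_ideal_env_eq0 sW) => [x /HP [_ /Rnil] //|a x Ba /HP [Bx Rx]|x /HP [] //].
    have [_ _ BM] := sB; split; apply/HP; split; try exact: BM.
      by apply: (two_sidedMl iR) => //; apply: BA.
    by apply: (two_sidedMr iR) => //; apply: BA.
  by apply/eqP; rewrite -memv0 -P0; apply/HP.
have sN0 : (s :&: N)%VS = 0%VS.
  apply/eqP; rewrite -subv0; apply/subvP => x /memv_capP [xs xN]; rewrite memv0.
  by apply/eqP; apply: BR; [apply: env_gen | apply: NR].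
pose pr := daddv_pi s N.
have pr_s x : x \in q -> pr x \in s by move=> _; apply: memv_pi.
have pr_eq x y : y \in s -> x - y \in N -> pr x = y.
  move=> ys zN; rewrite -[x](subrK y) linearD /=.
  have NsI : (N :&: s)%VS = 0%VS by rewrite capvC.
  have h := daddv_pi_add sN0 (subvP (addvSr s N) _ zN).
  rewrite (daddv_pi_id NsI zN) in h; move/eqP: h; rewrite -[eqbRHS]add0r (inj_eq (addIr _)) => /eqP ->.
  by rewrite add0r (daddv_pi_id sN0 ys).
have pr_N x : x \in q -> x - pr x \in N.
  by move=> /(subvP qsN) /memv_addP [y ys [z zN ->]]; rewrite (pr_eq (y + z) y) // [y + z]addrC addrK.
have [f [f' [[fX ff] [f'X ff'] fK f'K fRf']]] := capture_units sA XA capt.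
have XR x : x \in X -> R (x - pr x) by move=> /Xq xq; apply: NR; apply: pr_N.
have XB x : x \in X -> B (pr x) by move=> /Xq xq; apply: env_gen; apply: pr_s.
have [J [w [f0' [[J0 JL JMl JMr [JB JRJ]] [Jf0' Jb] Rw shiftX]]]] :=
  shift sA sB BA iK iR KR Rnil AR BR XA XB XR fX f'X ff ff' fK f'K fRf'.
have [H [P [[HL PH] [Hq PI] XH PK HW]]] := @conjugate_subalgebra m q s N pr A K R J w f0' X
  qL sL sW sq Nq NIq (lfun_lin pr) pr_s pr_N pr_eq sA (fun x => @env_gen _ _ q x) iK iR KR NR J0 JL
  (fun a x ha => JMl a x (env_gen ha)) (fun a x ha => JMr a x (env_gen ha))
  (fun x h => BA _ (JB x h)) JRJ Jf0' Rw Xq (fun x h => proj1 (Jb x h))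
  (fun x h => proj2 (Jb x h)) shiftX.
have PL : lie_closed P by move=> x y xP yP; apply: PI => //; apply: (subvP PH).
have [k Pk] : exists k, dser P k = 0%VS by apply: nil_solvable => // x /PK /KR /Rnil.
have [|s1 [s1L s1W s01 s1H [Hs1 _]]] := levi_relative HL PH PI Pk HW _ s0L s0W.
  by apply: subv_trans s0X _; apply/span_subvP.
exists s1; split=> //; first exact: subv_trans Hq.
move=> x xX; have /(subvP Hs1) /memv_addP [y ys [z zP ->]] := XH x xX.
by exists y => //; rewrite [y + z]addrC addrK; apply: PK.
Qed.

(** * Corners of matrices *)

Section Corners.
(** For [n <= m], [up] pads with zeros and [down] takes the upper left corner; [tr_up] makes them
    adjoint for the trace. *)
Definition up n m (a : 'M[C]_n.+1) : 'M[C]_m.+1 := pid_mx n.+1 *m a *m pid_mx n.+1.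
Definition down n m (d : 'M[C]_m.+1) : 'M[C]_n.+1 := pid_mx n.+1 *m d *m pid_mx n.+1.

Lemma up_linear n m : linear (@up n m).
Proof. by move=> k x y; rewrite /up mulmxDr mulmxDl -scalemxAr -scalemxAl. Qed.
Lemma down_linear n m : linear (@down n m).
Proof. by move=> k x y; rewrite /down mulmxDr mulmxDl -scalemxAr -scalemxAl. Qed.

Lemma pid_mx_down_up n m : (n <= m)%N ->
  (pid_mx n.+1 : 'M[C]_(n.+1, m.+1)) *m (pid_mx n.+1 : 'M_(m.+1, n.+1)) = 1%:M.
Proof. by move=> nm; rewrite pid_mx_id ?pid_mx_1. Qed.

Lemma up_mul n m (a b : 'M[C]_n.+1) : (n <= m)%N -> up m (a * b) = up m a * up m b.
Proof.
move=> nm; rewrite -!mulmxE.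
have -> : up m a *m up m b = pid_mx n.+1 *m a *m
    ((pid_mx n.+1 : 'M_(n.+1, m.+1)) *m pid_mx n.+1) *m b *m pid_mx n.+1.
  by rewrite /up !mulmxA.
by rewrite pid_mx_down_up // mulmx1 /up !mulmxA.
Qed.

Lemma up_lie n m (a b : 'M[C]_n.+1) : (n <= m)%N -> up m (lie a b) = lie (up m a) (up m b).
Proof.
by move=> nm; rewrite !lieE (linB (@up_linear n m)) !up_mul.
Qed.

Lemma tr_up n m (a : 'M[C]_n.+1) (d : 'M[C]_m.+1) : \tr (up m a * d) = \tr (a * down n d).
Proof.
by rewrite /up /down -!mulmxE -!mulmxA mxtrace_mulC -!mulmxA.
Qed.

Lemma up_sandwich n m (x y : 'M[C]_n.+1) (d : 'M[C]_m.+1) :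
  up m x * d * up m y = up m (x * down n d * y).
Proof. by rewrite /up /down -!mulmxE !mulmxA. Qed.

Lemma down_down n m p (d : 'M[C]_p.+1) : (n <= m <= p)%N -> down n (down m d) = down n d.
Proof.
move=> /andP [nm mp].
have e1 : (pid_mx n.+1 : 'M[C]_(n.+1, m.+1)) *m (pid_mx m.+1 : 'M_(m.+1, p.+1)) = pid_mx n.+1.
  by rewrite mul_pid_mx; congr pid_mx; lia.
have e2 : (pid_mx m.+1 : 'M[C]_(p.+1, m.+1)) *m (pid_mx n.+1 : 'M_(m.+1, n.+1)) = pid_mx n.+1.
  by rewrite mul_pid_mx; congr pid_mx; lia.
by rewrite /down !mulmxA e1 -mulmxA e2.
Qed.

Lemma down_id n (d : 'M[C]_n.+1) : down n d = d.
Proof. by rewrite /down pid_mx_1 mul1mx mulmx1. Qed.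

(* up m a + c *: (1 - up m 1) is the block diagonal matrix with blocks a and c%:M. *)
Lemma down_mull n m (a : 'M[C]_n.+1) c (d : 'M[C]_m.+1) : (n <= m)%N ->
  down n ((up m a + c *: (1 - up m (1 : 'M[C]_n.+1))) * d) = a * down n d.
Proof.
move=> nm; rewrite mulrDl -scalerAl mulrBl mul1r.
have h b : down n (up m b * d) = b * down n d.
  by rewrite /down /up -!mulmxE !mulmxA pid_mx_down_up // mul1mx.
have lD := linD (@down_linear n m); rewrite lD (linZ (@down_linear n m)).
by rewrite (linB (@down_linear n m)) !h mul1r subrr scaler0 addr0.
Qed.

Lemma down_mulr n m (a : 'M[C]_n.+1) c (d : 'M[C]_m.+1) : (n <= m)%N ->
  down n (d * (up m a + c *: (1 - up m (1 : 'M[C]_n.+1)))) = down n d * a.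
Proof.
move=> nm; rewrite mulrDr -scalerAr mulrBr mulr1.
have h b : down n (d * up m b) = down n d * b.
  by rewrite /down /up -!mulmxE -!mulmxA pid_mx_down_up // mulmx1.
have lD := linD (@down_linear n m); rewrite lD (linZ (@down_linear n m)).
by rewrite (linB (@down_linear n m)) !h mulr1 subrr scaler0 addr0.
Qed.

(** [up m] is not unital in general, so it carries one envelope into the other only up to a scalar
    [c] on the complementary diagonal block: [c = 0] for generators, [c = 1] for the identity. *)
Lemma env_up n m (Q : {vspace 'M[C]_n.+1}) (Q' : {vspace 'M[C]_m.+1}) a : (n <= m)%N ->
  (forall x, x \in Q -> up m x \in Q') -> env Q a ->
  exists c, env Q' (up m a + c *: (1 - up m (1 : 'M[C]_n.+1))).
Proof.
move=> nm QQ'; have upD := linD (@up_linear n m).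
elim=> [|x xQ|k x y _ [c Hc] _ [d Hd]|x y _ [c Hc] _ [d Hd]].
- by exists 1; rewrite scale1r addrC subrK; apply: env_one.
- by exists 0; rewrite scale0r addr0; apply: env_gen; apply: QQ'.
- exists (k * c + d).
  have -> : up m (k *: x + y) + (k * c + d) *: (1 - up m (1 : 'M[C]_n.+1)) =
     k *: (up m x + c *: (1 - up m (1 : 'M[C]_n.+1))) + (up m y + d *: (1 - up m (1 : 'M[C]_n.+1))).
    by move: (1 - _) => o; rewrite (up_linear m k x y) scalerDl -scalerA [in RHS]scalerDr; zmod.
  exact: env_lin.
- exists (c * d).
  have -> : up m (x * y) + (c * d) *: (1 - up m (1 : 'M[C]_n.+1)) =
     (up m x + c *: (1 - up m (1 : 'M[C]_n.+1))) * (up m y + d *: (1 - up m (1 : 'M[C]_n.+1))).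
    have e1 (z : 'M[C]_n.+1) : up m z * (1 - up m (1 : 'M[C]_n.+1)) = 0 by rewrite mulrBr mulr1 -up_mul // mulr1 subrr.
    have e2 (z : 'M[C]_n.+1) : (1 - up m (1 : 'M[C]_n.+1)) * up m z = 0 by rewrite mulrBl mul1r -up_mul // mul1r subrr.
    have e3 : (1 - up m (1 : 'M[C]_n.+1)) * (1 - up m (1 : 'M[C]_n.+1)) = 1 - up m (1 : 'M[C]_n.+1) :> 'M[C]_m.+1.
      by rewrite mulrBr mulr1 e2 subr0.
    by rewrite mulrDl !mulrDr -!scalerAr -!scalerAl e1 e2 e3 !scaler0 addr0 add0r scalerA (up_mul x y nm) (mulrC c d).
  exact: env_mul.
Qed.
End Corners.

(** * The locally solvable radical *)

Section Spans.
Variables (F : fieldType) (V : lmodType F).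
Implicit Types (P Q : V -> Prop) (s t : seq V).

Lemma in_spanP s v : in_span s v <-> exists f : nat -> F, v = \sum_(i < size s) f i *: s`_i.
Proof.
split=> [[c ->]|[f ->]]; first by exists (nth 0 c).
by exists (mkseq f (size s)); apply: eq_bigr => i _; rewrite nth_mkseq.
Qed.

Lemma subspaceL P k x y : subspace P -> P x -> P y -> P (k *: x + y).
Proof. by move=> [_ [PD PZ]] Px Py; apply: PD => //; apply: PZ. Qed.

Lemma in_span_sub P s v : subspace P -> (forall w, w \in s -> P w) -> in_span s v -> P v.
Proof.
move=> [P0 [PD PZ]] sP [c ->]; rewrite /lincomb; elim/big_ind: _ => // i _.
by apply: PZ; apply: sP; apply: mem_nth.
Qed.

Lemma in_span_subspace s : subspace (in_span s).
Proof.
split; first by apply/in_spanP; exists (fun=> 0); rewrite big1 // => i _; rewrite scale0r.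
split=> [x y /in_spanP [f ->] /in_spanP [g ->]|k x /in_spanP [f ->]]; apply/in_spanP.
  by exists (fun i => f i + g i); rewrite -big_split; apply: eq_bigr => i _; rewrite scalerDl.
by exists (fun i => k * f i); rewrite scaler_sumr; apply: eq_bigr => i _; rewrite scalerA.
Qed.

Lemma in_span_mem s v : v \in s -> in_span s v.
Proof.
move=> vs; apply/in_spanP; exists (fun i => (i == index v s)%:R).
have iv : (index v s < size s)%N by rewrite index_mem.
rewrite (bigD1 (Ordinal iv)) //= eqxx scale1r nth_index // big1 ?addr0 // => i.
by rewrite -val_eqE /= => /negPf ->; rewrite scale0r.
Qed.

Lemma in_span_mono s t v : {subset s <= t} -> in_span s v -> in_span t v.
Proof.
move=> st; apply: in_span_sub; first exact: in_span_subspace.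
by move=> w /st; apply: in_span_mem.
Qed.

Lemma span_set_subspace P : subspace (span_set P).
Proof.
split; first by exists [::]; split=> //; case: (in_span_subspace [::]).
split=> [x y [s [sP xs]] [t [tP yt]]|k x [s [sP xs]]].
  exists (s ++ t); split=> [w|]; first by rewrite mem_cat => /orP [/sP|/tP].
  have [_ [D _]] := in_span_subspace (s ++ t).
  by apply: D; [apply: in_span_mono xs | apply: in_span_mono yt] => w ws; rewrite mem_cat ws ?orbT.
by exists s; split=> //; have [_ [_ Z]] := in_span_subspace s; apply: Z.
Qed.

Lemma span_set_gen P v : P v -> span_set P v.
Proof.
move=> Pv; exists [:: v]; split=> [w|]; first by rewrite inE => /eqP ->.
by apply: in_span_mem; rewrite inE.
Qed.

Lemma span_set_sub P Q v : subspace Q -> (forall w, P w -> Q w) -> span_set P v -> Q v.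
Proof. by move=> sQ PQ [s [sP vs]]; apply: in_span_sub vs => // w /sP /PQ. Qed.

(** The subspace is pulled back to coefficient vectors, where [vspace_of_pred] provides a basis. *)
Lemma finite_dim_sub P Q : finite_dim P -> subspace Q -> (forall x, Q x -> P x) -> finite_dim Q.
Proof.
move=> [s sP] sQ QP; have [Q0 _] := sQ.
pose comb (u : 'rV[F]_(size s)) := \sum_(i < size s) u 0 i *: s`_i.
have combL (k : F) u v : comb (k *: u + v) = k *: comb u + comb v.
  rewrite /comb scaler_sumr -big_split; apply: eq_bigr => i _.
  by rewrite !mxE scalerDl scalerA.
have [||U HU] := @vspace_of_pred _ _ (fun u => Q (comb u)).
- by rewrite /comb big1 // => i _; rewrite mxE scale0r.
- by move=> k u v Qu Qv; rewrite combL; apply: subspaceL.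
exists [seq comb u | u <- vbasis U] => v; split=> [Qv|]; last first.
  by apply: in_span_sub => // w /mapP [u uU ->]; apply/HU; apply: vbasis_mem uU.
have /QP /sP /in_spanP [f vE] := Qv.
have vc : v = comb (\row_i f i) by rewrite vE; apply: eq_bigr => i _; rewrite mxE.
have uU : \row_i f i \in U by apply/HU; rewrite -vc.
rewrite vc (coord_vbasis uU).
have [T0 [TD TZ]] := in_span_subspace [seq comb u | u <- vbasis U].
have c0 : comb 0 = 0 by rewrite /comb big1 // => i _; rewrite mxE scale0r.
apply: (big_ind (fun u => in_span [seq comb u | u <- vbasis U] (comb u))) => [|u w Iu Iw|i _].
- by rewrite c0.
- by rewrite -[u]scale1r combL scale1r; apply: TD.
- rewrite -[_ *: _]addr0 combL c0 addr0; apply: TZ; apply: in_span_mem.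
  by apply: map_f; apply: mem_nth; rewrite size_tuple.
Qed.
End Spans.

Section Radical.
Variables (F : fieldType) (L : lmodType F) (br : L -> L -> L).
Hypothesis brL : is_lie_bracket br.
Implicit Types (S T I J : L -> Prop).

Lemma brDl x y z : br (x + y) z = br x z + br y z.
Proof. by case: brL => h _; rewrite -[x]scale1r h !scale1r. Qed.
Lemma brDr x y z : br x (y + z) = br x y + br x z.
Proof. by case: brL => _ [h _]; rewrite -[y]scale1r h !scale1r. Qed.
Lemma br0l x : br 0 x = 0.
Proof. by apply: (addrI (br 0 x)); rewrite addr0 -brDl addr0. Qed.
Lemma br0r x : br x 0 = 0.
Proof. by apply: (addrI (br x 0)); rewrite addr0 -brDr addr0. Qed.
Lemma brZl k x y : br (k *: x) y = k *: br x y.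
Proof. by case: brL => h _; rewrite -[k *: x]addr0 h br0l addr0. Qed.
Lemma brZr k x y : br x (k *: y) = k *: br x y.
Proof. by case: brL => _ [h _]; rewrite -[k *: y]addr0 h br0r addr0. Qed.
Lemma brC x y : br x y = - br y x.
Proof.
case: brL => _ [_ [h _]]; have := h (x + y); rewrite brDl !brDr !h addr0 add0r.
by move/eqP; rewrite addr_eq0 => /eqP.
Qed.

Lemma derived_mono S T k x : (forall x, S x -> T x) -> derived br S k x -> derived br T k x.
Proof.
move=> ST; elim: k x => [|k IH] x /=; first exact: ST.
apply: span_set_sub; first exact: span_set_subspace.
by move=> _ [a [b [/IH Ta /IH Tb ->]]]; apply: span_set_gen; exists a, b.
Qed.

Lemma derived_sub S k x : subalgebra br S -> derived br S k x -> S x.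
Proof.
move=> [sS Sbr]; elim: k x => [|k IH] x //=; apply: span_set_sub => //.
by move=> _ [a [b [/IH Sa /IH Sb ->]]]; apply: Sbr.
Qed.

Lemma derived_addn S k l : derived br S (k + l) = derived br (derived br S k) l.
Proof. by elim: l => [|l IH]; rewrite ?addn0 // addnS /= IH. Qed.

Lemma solvable_mono S T : (forall x, S x -> T x) -> solvable_subalg br T -> solvable_subalg br S.
Proof. by move=> ST [k Tk]; exists k => v /(derived_mono ST) /Tk. Qed.

(** The [j]-th derived term of the sum lies in that of [S] plus [T], so after [k] steps only [T] is
    left. *)
Lemma solvable_sum S T : (forall x y, S x -> T y -> T (br x y)) -> subalgebra br S -> subspace T ->
  (forall x y, T x -> T y -> T (br x y)) -> solvable_subalg br S -> solvable_subalg br T ->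
  solvable_subalg br (fun x => exists a b, [/\ S a, T b & x = a + b]).
Proof.
move=> ST sS sT Tbr [k Sk] [l Tl].
have [T0 [TD TZ]] := sT.
have H j x : derived br (fun x => exists a b, [/\ S a, T b & x = a + b]) j x ->
    exists a b, [/\ derived br S j a, T b & x = a + b].
  elim: j x => // j IH x; have [D0 [DD DZ]] : subspace (derived br S j.+1) := span_set_subspace _.
  apply: (@span_set_sub _ _ _ (fun x => exists a b, [/\ derived br S j.+1 a, T b & x = a + b])) => [|_ [c [d [/IH [a [b [Sa Tb ->]]] /IH [a' [b' [Sa' Tb' ->]]] ->]]]].
    split; first by exists 0, 0; split; rewrite ?addr0.
    split=> [y z [a [b [Sa Tb ->]]] [a' [b' [Sa' Tb' ->]]]|c y [a [b [Sa Tb ->]]]].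
      exists (a + a'), (b + b'); split; [exact: DD|exact: TD|by rewrite addrACA].
    exists (c *: a), (c *: b); split; [exact: DZ|exact: TZ|by rewrite scalerDr].
  exists (br a a'), (br a b' + (br b a' + br b b')); split.
  - by apply: span_set_gen; exists a, a'.
  - have Sa0 := derived_sub sS Sa; have Sa0' := derived_sub sS Sa'.
    apply: (TD); first exact: ST.
    by apply: (TD); [rewrite brC -scaleN1r; apply: TZ; apply: ST | apply: Tbr].
  - by rewrite brDl !brDr -addrA.
exists (k + l)%N => v; rewrite derived_addn => dv; apply: Tl; apply: derived_mono dv.
by move=> x /H [a [b [/Sk -> Tb ->]]]; rewrite add0r.
Qed.

Lemma subalgebraI S T : subalgebra br S -> subalgebra br T -> subalgebra br (fun x => S x /\ T x).
Proof.
move=> [[S0 [SD SZ]] Sb] [[T0 [TD TZ]] Tb]; split; last by move=> x y [? ?] [? ?]; auto.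
by split=> //; split=> [x y [? ?] [? ?]|k x [? ?]]; auto.
Qed.

Lemma lie_ideal_subalgebra I : lie_ideal br I -> subalgebra br I.
Proof. by case=> sI Ib; split=> // x y _; apply: Ib. Qed.

Lemma locally_solvable_finite_dim I S : locally_solvable br I -> finite_dim S -> (forall x, S x -> I x) ->
  solvable_subalg br S.
Proof.
move=> Isol [t tS] SI.
have [x xt|T [[sT _] _ Tsol _ tT]] := Isol t; first by apply/SI/tS; apply: in_span_mem.
by apply: solvable_mono Tsol => x /tS; apply: in_span_sub.
Qed.

Lemma lie_ideal_sum I J : lie_ideal br I -> lie_ideal br J ->
  lie_ideal br (fun x => exists a b, [/\ I a, J b & x = a + b]).
Proof.
move=> [[I0 [ID IZ]] Ib] [[J0 [JD JZ]] Jb]; split.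
  split; first by exists 0, 0; rewrite addr0.
  split=> [_ _ [a [b [Ia Jb0 ->]]] [a' [b' [Ia' Jb' ->]]]|k _ [a [b [Ia Jb0 ->]]]].
    by exists (a + a'), (b + b'); split; auto; rewrite addrACA.
  by exists (k *: a), (k *: b); split; auto; rewrite scalerDr.
by move=> x _ [a [b [Ia Jb0 ->]]]; exists (br x a), (br x b); split; auto; rewrite brDr.
Qed.

Hypothesis lfL : locally_finite br.

(** A finite set splits into parts in [I] and in [J], all inside one finite-dimensional subalgebra
    [G]; there [I] and [J] cut out solvable ideals, whose sum is solvable. *)
Lemma locally_solvable_sum I J : lie_ideal br I -> lie_ideal br J ->
  locally_solvable br I -> locally_solvable br J ->
  locally_solvable br (fun x => exists a b, [/\ I a, J b & x = a + b]).
Proof.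
move=> iI iJ Isol Jsol s sIJ.
have [t [tI tIJ]] : exists t : seq (L * L), (forall p, p \in t -> I p.1 /\ J p.2) /\
    forall x, x \in s -> exists2 p, p \in t & x = p.1 + p.2.
  elim: s sIJ => [|x s IH] sIJ; first by exists [::].
  have [y ys|t [t1 t2]] := IH; first by apply: sIJ; rewrite inE ys orbT.
  have [|a [b [Ia Jb xE]]] := sIJ x; first by rewrite inE eqxx.
  exists ((a, b) :: t); split=> [p|y]; first by rewrite inE => /orP [/eqP ->|/t1].
  rewrite inE => /orP [/eqP ->|/t2 [p pt ->]]; first by exists (a, b); rewrite ?inE ?eqxx.
  by exists p; rewrite // inE pt orbT.
have [G [sG fG tG]] := lfL ([seq p.1 | p <- t] ++ [seq p.2 | p <- t]).
have sIG := subalgebraI (lie_ideal_subalgebra iI) sG.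
have sJG := subalgebraI (lie_ideal_subalgebra iJ) sG.
have fI : finite_dim (fun x => I x /\ G x) by apply: (finite_dim_sub fG) => [|x []//]; case: sIG.
have fJ : finite_dim (fun x => J x /\ G x) by apply: (finite_dim_sub fG) => [|x []//]; case: sJG.
have solI := locally_solvable_finite_dim Isol fI (fun x h => proj1 h).
have solJ := locally_solvable_finite_dim Jsol fJ (fun x h => proj1 h).
have [sGs Gbr] := sG; have [G0 [GD GZ]] := sGs.
exists (fun x => exists a b, [/\ I a /\ G a, J b /\ G b & x = a + b]).
have sub : subalgebra br (fun x => exists a b, [/\ I a /\ G a, J b /\ G b & x = a + b]).
  have [[_ [iID iIZ]] iIb] := iI; have [[_ [iJD iJZ]] iJb] := iJ.
  split; first split.
  - by exists 0, 0; have [[? _] _] := sIG; have [[? _] _] := sJG; rewrite addr0.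
  - split=> [_ _ [a [b [[? ?] [? ?] ->]]] [a' [b' [[? ?] [? ?] ->]]]|k _ [a [b [[? ?] [? ?] ->]]]].
      by exists (a + a'), (b + b'); split; auto; rewrite addrACA.
    by exists (k *: a), (k *: b); split; auto; rewrite scalerDr.
  - move=> _ _ [a [b [[? ?] [? ?] ->]]] [a' [b' [[? ?] [? ?] ->]]].
    exists (br (a + b) a'), (br (a + b) b'); split; [by auto|by auto|by rewrite brDr].
split=> //.
- apply: (finite_dim_sub fG); first by case: sub.
  by move=> _ [a [b [[? ?] [? ?] ->]]]; auto.
- apply: solvable_sum => //; last by case: sJG.
    by move=> x y [? ?] [? ?]; split; [case: iJ => _; apply | auto].
  by case: sJG.
- by move=> x [a [b [[? ?] [? ?] ->]]]; exists a, b.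
- move=> x /tIJ [p pt ->]; have [? ?] := tI p pt.
  by exists p.1, p.2; split=> //; split=> //; apply: tG; rewrite mem_cat map_f ?orbT.
Qed.

(** This union is closed under addition because two locally solvable ideals lie in a common one,
    their sum. *)
Definition loc_solv_rad x := exists I, [/\ lie_ideal br I, locally_solvable br I & I x].

Lemma loc_solv_rad_seq (s : seq L) : (forall x, x \in s -> loc_solv_rad x) ->
  exists I, [/\ lie_ideal br I, locally_solvable br I & forall x, x \in s -> I x].
Proof.
elim: s => [|x s IH] sr.
  exists (fun x => x = 0); split=> //.
    split; last by move=> x _ ->; apply: br0r.
    by split=> //; split=> [x y -> ->|k x ->]; rewrite ?addr0 ?scaler0.
  move=> t t0; exists (fun x => x = 0); split=> //.
  - split; last by move=> x y -> ->; apply: br0r.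
    by split=> //; split=> [x y -> ->|k x ->]; rewrite ?addr0 ?scaler0.
  - exists [::] => v; split=> [->|]; first by apply/in_spanP; exists (fun=> 0); rewrite big_ord0.
    by case/in_spanP => f ->; rewrite big_ord0.
  - by exists 0%N.
have [y ys|I [iI solI sI]] := IH; first by apply: sr; rewrite inE ys orbT.
have [|J [iJ solJ xJ]] := sr x; first by rewrite inE eqxx.
have [[I0 _] _] := iI; have [[J0 _] _] := iJ.
exists (fun x => exists a b, [/\ I a, J b & x = a + b]); split.
- exact: lie_ideal_sum.
- exact: locally_solvable_sum.
- move=> y; rewrite inE => /orP [/eqP ->|/sI Iy]; first by exists 0, x; rewrite add0r.
  by exists y, 0; rewrite addr0.
Qed.

Lemma loc_solv_radP : loc_solv_radical br loc_solv_rad.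
Proof.
split; last by move=> I iI solI x Ix; exists I.
- split; last by move=> x y [I [[sI iI] solI Iy]]; exists I; split=> //; apply: iI.
  split.
    have [x|I [iI solI _]] := @loc_solv_rad_seq [::]; first by rewrite in_nil.
    by exists I; have [[I0 _] _] := iI.
  split=> [x y rx ry|k x [I [[[I0 [ID IZ]] Ib] solI Ix]]].
    have [z|I [iI solI xyI]] := @loc_solv_rad_seq [:: x; y].
      by rewrite !inE => /orP [] /eqP ->.
    exists I; split=> //; have [[_ [ID _]] _] := iI.
    by apply: ID; apply: xyI; rewrite !inE eqxx ?orbT.
  by exists I; split=> //; apply: IZ.
move=> s /loc_solv_rad_seq [I [iI solI sI]].
have [S [sS fS solS SI sS']] := solI s sI; exists S; split=> // x /SI Ix; by exists I.
Qed.
End Radical.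

(** * Exhaustion by matrix Lie algebras *)

Lemma brv_env_stable n (S : {vspace 'M[C]_n.+1}) y a : lie_closed S -> y \in S ->
  env (brv S S) a -> env (brv S S) (lie a y).
Proof.
move=> SL yS; have qi : lie_ideal_in S (brv S S) by apply: brv_ideal.
elim=> [|x xq|k x z _ IH1 _ IH2|x z Ax IH1 Az IH2].
- by rewrite lieE mul1r mulr1 subrr; apply: env0.
- by rewrite lieC; apply/envN/env_gen/qi.
- by rewrite lieDl lieZl; apply: env_lin.
- by rewrite lieMl; apply: envD; apply: env_mul.
Qed.

Section Levels.
Variables (L : lmodType C) (br : L -> L -> L) (Phi : L -> nat -> nat -> C).
(** The index [n] itself is allowed: [supp n] belongs to matrices of size [n.+1]. *)
Definition supp n x := forall i j, (n < i)%N || (n < j)%N -> Phi x i j = 0.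
Hypothesis brL : is_lie_bracket br.
Hypothesis PhiL : forall k x y i j, Phi (k *: x + y) i j = k * Phi x i j + Phi y i j.
Hypothesis Phi_inj : forall x, (forall i j, Phi x i j = 0) -> x = 0.
Hypothesis Phi_supp : forall x, exists n, supp n x.
Hypothesis Phi_br : forall n x y, supp n x -> supp n y -> forall i j,
  Phi (br x y) i j = \sum_(k < n.+1) (Phi x i k * Phi y k j - Phi y i k * Phi x k j).

Lemma supp_mono n m x : supp n x -> (n <= m)%N -> supp m x.
Proof. by move=> nx nm i j h; apply: nx; lia. Qed.

Lemma supp0 n : supp n 0.
Proof. by move=> i j _; have := PhiL (-1) 0 0 i j; rewrite scaler0 addr0 mulN1r addNr. Qed.

Lemma suppL n k x y : supp n x -> supp n y -> supp n (k *: x + y).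
Proof. by move=> hx hy i j h; rewrite PhiL hx ?hy // mulr0 addr0. Qed.

Lemma supp_subspace n : subspace (supp n).
Proof.
split; first exact: supp0.
split=> [x y hx hy|k x hx]; first by rewrite -[x]scale1r; apply: suppL.
by rewrite -[k *: x]addr0; apply: suppL => //; apply: supp0.
Qed.

Lemma supp_br n x y : supp n x -> supp n y -> supp n (br x y).
Proof.
move=> hx hy i j h; rewrite (Phi_br hx hy) big1 // => k _.
have [hi|hi] := boolP (n < i)%N; first by rewrite (hx i k) ?hi // (hy i k) ?hi // !mul0r subrr.
rewrite (negPf hi) /= in h.
by rewrite (hx k j) ?h ?orbT // (hy k j) ?h ?orbT // !mulr0 subrr.
Qed.

Lemma supp_seq (s : seq L) : exists n, forall x, x \in s -> supp n x.
Proof.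
elim: s => [|x s [n hn]]; first by exists 0%N.
have [k hk] := Phi_supp x; exists (maxn n k) => y; rewrite inE => /orP [/eqP ->|/hn h].
  by apply: supp_mono hk _; apply: leq_maxr.
by apply: supp_mono h _; apply: leq_maxl.
Qed.

Definition toM n x : 'M[C]_n.+1 := \matrix_(i, j) Phi x i j.

Lemma toM_linear n : linear (toM n).
Proof. by move=> k x y; apply/matrixP => i j; rewrite !mxE PhiL. Qed.

Lemma toM_inj n x : supp n x -> toM n x = 0 -> x = 0.
Proof.
move=> hx x0; apply: Phi_inj => i j.
have [h|] := boolP ((n < i)%N || (n < j)%N); first exact: hx.
rewrite negb_or -!leqNgt => /andP [hi hj].
have /matrixP /(_ (Ordinal (hi : i < n.+1)%N) (Ordinal (hj : j < n.+1)%N)) := x0; by rewrite !mxE.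
Qed.

Lemma toM_inj2 n x y : supp n x -> supp n y -> toM n x = toM n y -> x = y.
Proof.
move=> hx hy xy; apply/eqP; rewrite -subr_eq0; apply/eqP; apply: (@toM_inj n).
  by rewrite -scaleN1r addrC; apply: suppL.
by rewrite (linB (@toM_linear n)) xy subrr.
Qed.

Lemma toM_br n x y : supp n x -> supp n y -> toM n (br x y) = lie (toM n x) (toM n y).
Proof.
move=> hx hy; apply/matrixP => i j; rewrite lieE -!mulmxE !mxE (Phi_br hx hy) sumrB.
by congr (_ - _); apply: eq_bigr => k _; rewrite !mxE.
Qed.

Lemma toM_up n m x : supp n x -> (n <= m)%N -> toM m x = up m (toM n x).
Proof.
move=> hx nm; have Ex (a b : nat) : (\sum_(k < n.+1) (a == k)%:R * Phi x k b) = Phi x a b.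
  have [an|na] := leqP a n; last first.
    rewrite hx ?na // big1 // => k _; rewrite (_ : (a == k) = false) ?mul0r //.
    by apply/eqP => ak; have := ltn_ord k; lia.
  rewrite (bigD1 (Ordinal (an : a < n.+1)%N)) //= eqxx mul1r big1 ?addr0 // => k.
  by rewrite -val_eqE /= eq_sym => /negPf ->; rewrite mul0r.
have Ey (a b : nat) : (\sum_(k < n.+1) Phi x a k * (k == b :> nat)%:R) = Phi x a b.
  have [an|na] := leqP b n; last first.
    rewrite hx ?na ?orbT // big1 // => k _; rewrite (_ : (k == b :> nat) = false) ?mulr0 //.
    by apply/eqP => ak; have := ltn_ord k; lia.
  rewrite (bigD1 (Ordinal (an : b < n.+1)%N)) //= eqxx mulr1 big1 ?addr0 // => k.
  by rewrite -val_eqE /= => /negPf ->; rewrite mulr0.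
apply/matrixP => i j; rewrite /up !mxE -(Ey i j); apply: eq_bigr => k _.
rewrite !mxE -Ex ltn_ord andbT; congr (_ * _); apply: eq_bigr => l _; rewrite !mxE.
have [il|] := eqVneq (i : nat) l; last by rewrite !mul0r.
by rewrite il ltn_ord.
Qed.

Lemma Lvl_ex n : exists S : {vspace 'M[C]_n.+1}, forall M, M \in S <-> exists2 x, supp n x & M = toM n x.
Proof.
apply: vspace_of_pred; first by exists 0; [exact: supp0 | rewrite (lin0 (@toM_linear n))].
move=> k _ _ [x hx ->] [y hy ->]; exists (k *: x + y); first exact: suppL.
by rewrite toM_linear.
Qed.

Definition Lvl n := sval (cid (Lvl_ex n)).
Lemma LvlP n M : M \in Lvl n <-> exists2 x, supp n x & M = toM n x.
Proof. exact: svalP (cid (Lvl_ex n)) M. Qed.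

Lemma Lvl_toM n x : supp n x -> toM n x \in Lvl n.
Proof. by move=> hx; apply/LvlP; exists x. Qed.

Lemma Lvl_closed n : lie_closed (Lvl n).
Proof.
move=> _ _ /LvlP [x hx ->] /LvlP [y hy ->]; rewrite -toM_br //.
by apply/Lvl_toM/supp_br.
Qed.

Definition dLvl n := brv (Lvl n) (Lvl n).

Lemma dLvl_sub n : (dLvl n <= Lvl n)%VS.
Proof. by apply: brv_sub; apply: Lvl_closed. Qed.

Lemma dLvl_up n m M : (n <= m)%N -> M \in dLvl n -> up m M \in dLvl m.
Proof.
move=> nm; apply: (@brv_ind _ _ _ _ (fun M => up m M \in dLvl m)) => [|k x y hx hy|_ _ /LvlP [x hx ->] /LvlP [y hy ->]].
- by rewrite (lin0 (@up_linear n m)) mem0v.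
- by rewrite up_linear rpredD ?rpredZ.
- by rewrite up_lie // -!toM_up //; apply: mem_brv; apply: Lvl_toM; apply: supp_mono nm.
Qed.

Lemma derived_dLvl x : derived_alg br x -> exists n, supp n x /\ toM n x \in dLvl n.
Proof.
apply: (@span_set_sub _ _ _ (fun x => exists n, supp n x /\ toM n x \in dLvl n)); last first.
  move=> _ [a [b ->]]; have [n h] := supp_seq [:: a; b].
  have ha : supp n a by apply: h; rewrite inE eqxx.
  have hb : supp n b by apply: h; rewrite !inE eqxx orbT.
  by exists n; split; [apply: supp_br | rewrite toM_br //; apply: mem_brv; apply: Lvl_toM].
have lev n m y : (n <= m)%N -> supp n y /\ toM n y \in dLvl n -> supp m y /\ toM m y \in dLvl m.
  by move=> nm [hx xq]; split; [apply: supp_mono nm | rewrite (toM_up hx nm); apply: dLvl_up].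
split; first by exists 0%N; split; [exact: supp0 | rewrite (lin0 (@toM_linear _)) mem0v].
split=> [y z [n hy] [m hz]|k y [n [hy yq]]].
  have [h1 h2] := lev _ _ _ (leq_maxl n m) hy; have [h3 h4] := lev _ _ _ (leq_maxr n m) hz.
  exists (maxn n m); have [_ [D _]] := supp_subspace (maxn n m); split; first exact: D.
  by rewrite (linD (@toM_linear _)) rpredD.
exists n; have [_ [_ Z]] := supp_subspace n; split; first exact: Z.
by rewrite (linZ (@toM_linear _)) rpredZ.
Qed.

Lemma supp_finite_dim n : finite_dim (supp n).
Proof.
have [|pre Hpre] := @choice 'M[C]_n.+1 L (fun M x => M \in Lvl n -> supp n x /\ toM n x = M).
  move=> M; have [/LvlP [x hx ->]|] := boolP (M \in Lvl n); first by exists x.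
  by exists 0.
exists [seq pre b | b <- vbasis (Lvl n)] => x; split=> [hx|]; last first.
  apply: in_span_sub; first exact: supp_subspace.
  by move=> _ /mapP [b /vbasis_mem bL ->]; have [] := Hpre b bL.
have xL := Lvl_toM hx; set c := coord (vbasis (Lvl n)) ^~ (toM n x).
have {1}-> : x = \sum_i c i *: pre (vbasis (Lvl n))`_i.
  have bL (i : 'I_(\dim (Lvl n))) : (vbasis (Lvl n))`_i \in Lvl n by apply: vbasis_mem; apply: mem_nth; rewrite size_tuple.
  have [_ [D Z]] := supp_subspace n.
  apply: (toM_inj2 hx).
    elim/big_ind: _ => [||i _]; [exact: supp0|exact: D|apply: Z].
    by have [] := Hpre _ (bL i).
  rewrite {1}(coord_vbasis xL) (big_morph (toM n) (linD (@toM_linear n)) (lin0 (@toM_linear n))).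
  apply: eq_bigr => i _; rewrite (linZ (@toM_linear n)); congr (_ *: _).
  by have [] := Hpre _ (bL i).
have [T0 [TD TZ]] := in_span_subspace [seq pre b | b <- vbasis (Lvl n)].
elim/big_ind: _ => // i _; apply: TZ; apply: in_span_mem; apply: map_f.
by apply: mem_nth; rewrite size_tuple.
Qed.

Definition tr_null n x := [/\ supp n x, toM n x \in dLvl n & forall a, env (dLvl n) a -> \tr (toM n x * a) = 0].
(** A part of the radical described by traces alone. The ideals [K] feed into it, because
    orthogonality to the corners of later envelopes is orthogonality at every later level. *)
Definition rad0 x := exists n, forall m, (n <= m)%N -> tr_null m x.

Lemma tr_null_subspace n : subspace (tr_null n).
Proof.
have [s0 [sD sZ]] := supp_subspace n.
split; first by split; rewrite ?(lin0 (@toM_linear n)) ?mem0v // => a _; rewrite mul0r mxtrace0.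
split=> [x y [hx qx tx] [hy qy ty]|k x [hx qx tx]].
  split; [exact: sD | by rewrite (linD (@toM_linear n)) rpredD | move=> a Aa].
  by rewrite (linD (@toM_linear n)) mulrDl mxtraceD tx ?ty // addr0.
split; [exact: sZ | by rewrite (linZ (@toM_linear n)) rpredZ | move=> a Aa].
by rewrite (linZ (@toM_linear n)) -scalerAl mxtraceZ tx // mulr0.
Qed.

Lemma tr_null_br n x y : supp n x -> tr_null n y -> tr_null n (br x y).
Proof.
move=> hx [hy qy ty]; have xL := Lvl_toM hx.
split; first exact: supp_br.
  by rewrite toM_br //; apply: (brv_ideal (S := Lvl n)) => //; apply: Lvl_closed.
move=> a Aa; rewrite toM_br //.
have -> : lie (toM n x) (toM n y) * a = toM n x * (toM n y * a) - toM n y * (toM n x * a).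
  by rewrite lieE; ncring.
rewrite linearB /= [X in X - _]trC -linearB /=.
have -> : toM n y * a * toM n x - toM n y * (toM n x * a) = toM n y * lie a (toM n x).
  by rewrite lieE; ncring.
by apply: ty; apply: brv_env_stable => //; apply: Lvl_closed.
Qed.

Lemma rad0_ideal : lie_ideal br rad0.
Proof.
split; first split; first by exists 0%N => m _; case: (tr_null_subspace m).
  split=> [x y [n hn] [m hm]|k x [n hn]].
    exists (maxn n m) => p; rewrite geq_max => /andP [np mp].
    by have [_ [D _]] := tr_null_subspace p; apply: D; [apply: hn | apply: hm].
  by exists n => m nm; have [_ [_ Z]] := tr_null_subspace m; apply: Z; apply: hn.
move=> x y [n hn]; have [m hm] := Phi_supp x.
exists (maxn n m) => p; rewrite geq_max => /andP [np mp].
by apply: tr_null_br; [apply: supp_mono hm mp | apply: hn].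
Qed.

(** A finite subset of [rad0] is trace-null from some level [n] on. Then [T] is a finite-dimensional
    subalgebra whose matrices are nilpotent, all their powers having trace 0, and Engel's theorem
    makes it solvable. *)
Lemma rad0_locally_solvable : locally_solvable br rad0.
Proof.
move=> s sr.
have [n hn] : exists n, forall x, x \in s -> forall m, (n <= m)%N -> tr_null m x.
  elim: s sr => [|x s IH] sr; first by exists 0%N.
  have [y ys|n hn] := IH; first by apply: sr; rewrite inE ys orbT.
  have [|k hk] := sr x; first by rewrite inE eqxx.
  exists (maxn n k) => y; rewrite inE => /orP [/eqP ->|ys] m; rewrite geq_max => /andP [nm km].
    exact: hk.
  exact: hn.
pose T x := rad0 x /\ tr_null n x.
have sT : subspace T.
  have [[r0 [rD rZ]] _] := rad0_ideal; have [t0 [tD tZ]] := tr_null_subspace n.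
  by split=> //; split=> [x y [? ?] [? ?]|k x [? ?]]; split; auto.
have Tbr x y : T x -> T y -> T (br x y).
  move=> [rx [hx _ _]] [ry ty]; split; last exact: tr_null_br.
  by have [_ h] := rad0_ideal; apply: h.
have [||Tm HTm] := @vspace_of_pred _ _ (fun M => exists2 x, T x & M = toM n x).
- by exists 0; [case: sT | rewrite (lin0 (@toM_linear n))].
- by move=> k _ _ [x Tx ->] [y Ty ->]; exists (k *: x + y); [apply: subspaceL | rewrite toM_linear].
have TmL : lie_closed Tm.
  move=> _ _ /HTm [x Tx ->] /HTm [y Ty ->]; have [_ [hx _ _]] := Tx; have [_ [hy _ _]] := Ty.
  by rewrite -toM_br //; apply/HTm; exists (br x y) => //; apply: Tbr.
have Tmnil M : M \in Tm -> nil M.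
  move=> /HTm [x [_ [_ xq tx]] ->]; apply: tr_pow_nil; first exact: complex_pchar0.
  by move=> k; rewrite exprS; apply: tx; apply: envX; apply: env_gen.
have [k Tk] := nil_solvable TmL Tmnil.
exists T; split.
- by split.
- by apply: (finite_dim_sub (supp_finite_dim n)) => // x [_ []].
- exists k => v dv; have [_ [hv _ _]] : T v by apply: (derived_sub _ dv).
  apply: (toM_inj hv); apply/eqP; rewrite -memv0 -Tk.
  elim: k v {Tk hv} dv => [|k IH] v /=; first by move=> Tv; apply/HTm; exists v.
  move=> dv; suff [] : supp n v /\ toM n v \in dser Tm k.+1 by [].
  move: v dv; have [s0 [sD sZ]] := supp_subspace n.
  move=> v; apply: (@span_set_sub _ _ _ (fun v => supp n v /\ toM n v \in dser Tm k.+1)).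
    split; first by rewrite (lin0 (@toM_linear n)) mem0v.
    split=> [x y [? ?] [? ?]|c x [? ?]].
      by rewrite (linD (@toM_linear n)) rpredD; auto.
    by rewrite (linZ (@toM_linear n)) rpredZ; auto.
  move=> _ [a [b [da db ->]]].
  have [_ [ha _ _]] : T a by apply: (derived_sub _ da).
  have [_ [hb _ _]] : T b by apply: (derived_sub _ db).
  split; first exact: supp_br.
  by rewrite toM_br // /dser iterS; apply: mem_brv; apply: IH.
- by move=> x [].
- by move=> x xs; split; [exists n; apply: hn | apply: hn].
Qed.

(** The semisimple subalgebras of the construction as predicates on [L], so that those from
    different levels can be compared by inclusion. *)
Definition good (P : L -> Prop) := exists n (s : {vspace 'M[C]_n.+1}),
  [/\ lie_closed s, whitehead s 0%VS, (s <= Lvl n)%VS & forall x, P x <-> supp n x /\ toM n x \in s].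

Lemma good_subalgebra P : good P -> subalgebra br P.
Proof.
move=> [n [s [sL _ _ HP]]]; have [s0 [sD sZ]] := supp_subspace n.
split; last by move=> x y /HP [hx xs] /HP [hy ys]; apply/HP; split; [apply: supp_br | rewrite toM_br //; apply: sL].
split; first by apply/HP; rewrite (lin0 (@toM_linear n)) mem0v.
split=> [x y /HP [hx xs] /HP [hy ys]|k x /HP [hx xs]]; apply/HP.
  by rewrite (linD (@toM_linear n)) rpredD //; auto.
by rewrite (linZ (@toM_linear n)) rpredZ //; auto.
Qed.

Lemma good_derived P x : good P -> P x -> derived_alg br x.
Proof.
move=> [n [s [sL sW sn HP]]] /HP [hx xs].
have [D0 [DD DZ]] : subspace (derived_alg br) := span_set_subspace _.
have [s0 [sD sZ]] := supp_subspace n.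
suff [y [hy dy xy]] : exists y, [/\ supp n y, derived_alg br y & toM n x = toM n y].
  by rewrite (toM_inj2 hx hy xy).
move: xs; rewrite -(whitehead_perfect sL sW).
apply: (@brv_ind _ _ _ _ (fun M => exists y, [/\ supp n y, derived_alg br y & M = toM n y])).
- by exists 0; rewrite (lin0 (@toM_linear n)).
- move=> k _ _ [a [ha da ->]] [b [hb db ->]]; exists (k *: a + b); split; [exact: suppL| |by rewrite toM_linear].
  by apply: DD => //; apply: DZ.
- move=> M M' /(subvP sn) /LvlP [a ha ->] /(subvP sn) /LvlP [b hb ->].
  exists (br a b); split; [exact: supp_br| |by rewrite toM_br].
  by apply: span_set_gen; exists a, b.
Qed.

Lemma good_rad P x : good P -> P x -> loc_solv_rad br x -> x = 0.
Proof.
move=> [n [s [sL sW sn HP]]] /HP [hx xs] [I [[sI Ibr] solI Ix]].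
have [s0 [sD sZ]] := supp_subspace n.
have [||c Hc] := @vspace_of_pred _ _ (fun M => M \in s /\ exists x, [/\ supp n x, I x & M = toM n x]).
- by split; [exact: mem0v | exists 0; split=> //; [case: sI | rewrite (lin0 (@toM_linear n))]].
- move=> k M M' [Ms [a [ha Ia Ma]]] [M's [b [hb Ib Mb]]]; split; first by rewrite rpredD ?rpredZ.
  by exists (k *: a + b); split; [apply: suppL | apply: subspaceL | rewrite Ma Mb toM_linear].
have cs : (c <= s)%VS by apply/subvP => M /Hc [].
have ci : lie_ideal_in s c.
  move=> M M' Ms /Hc [M's [b [hb Ib M'E]]]; have /(subvP sn) /LvlP [a ha Ma] := Ms.
  apply/Hc; split; first exact: sL.
  by exists (br a b); split; [apply: supp_br | apply: Ibr | rewrite Ma M'E toM_br].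
have fS : finite_dim (fun x => I x /\ supp n x).
  apply: (finite_dim_sub (supp_finite_dim n)); last by move=> y [].
  by have [I0 [ID IZ]] := sI; split=> //; split=> [y z [? ?] [? ?]|k y [? ?]]; auto.
have [k Ik] := locally_solvable_finite_dim solI fS (fun x h => proj1 h).
have c0 : c = 0%VS.
  apply: (whitehead_no_solvable (k := k) sL sW cs ci).
  suff H j M : M \in dser c j -> exists y, [/\ derived br (fun x => I x /\ supp n x) j y, supp n y & M = toM n y].
    apply/eqP; rewrite -subv0; apply/subvP => M /H [y [/Ik -> _ ->]].
    by rewrite (lin0 (@toM_linear n)) memv0.
  elim: j M => [|j IH] M /=; first by move=> /Hc [_ [y [hy Iy ->]]]; exists y.
  have [D0 [DD DZ]] : subspace (derived br (fun x => I x /\ supp n x) j.+1) := span_set_subspace _.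
  apply: (@brv_ind _ _ _ _ (fun M => exists y, [/\ derived br (fun x => I x /\ supp n x) j.+1 y, supp n y & M = toM n y])).
  - by exists 0; rewrite (lin0 (@toM_linear n)).
  - move=> k' _ _ [a [da ha ->]] [b [db hb ->]]; exists (k' *: a + b); split; [|exact: suppL|by rewrite toM_linear].
    by apply: DD => //; apply: DZ.
  - move=> _ _ /IH [a [da ha ->]] /IH [b [db hb ->]]; exists (br a b); split; [|exact: supp_br|by rewrite toM_br].
    by apply: span_set_gen; exists a, b.
apply: (toM_inj hx); apply/eqP; rewrite -memv0 -c0; apply/Hc; split=> //; by exists x.
Qed.

Lemma up_whitehead n m (s : {vspace 'M[C]_n.+1}) : (n <= m)%N -> lie_closed s -> whitehead s 0%VS ->
  exists t : {vspace 'M[C]_m.+1}, [/\ lie_closed t, whitehead t 0%VS &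
    forall M, M \in t <-> exists2 a, a \in s & M = up m a].
Proof.
move=> nm sL sW; have lin := @up_linear n m.
have hom : hom_on (up m) s by move=> x y _ _; apply: up_lie.
have [t Ht] := vspace_img s lin; exists t; split=> //; first exact: (img_lie_closed sL hom Ht).
by apply: (whitehead_img lin hom Ht _ sW) => x; rewrite memv0 => /eqP ->; apply: lin0.
Qed.

(** The spaces of corners of size [n.+1] increase with the level inside one matrix space; [m] is a
    level at which their dimension is maximal. *)
Lemma stable_corners n : exists2 m, (n <= m)%N & forall p, (m <= p)%N -> forall a, env (dLvl p) a ->
  exists2 b, env (dLvl m) b & down n a = down n b.
Proof.
have exC p : exists U : {vspace 'M[C]_n.+1}, forall M, M \in U <-> exists2 a, env (dLvl p) a & M = down n a.
  apply: vspace_of_pred; first by exists 0; [exact: env0 | rewrite (lin0 (@down_linear n p))].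
  move=> k _ _ [a Aa ->] [b Ab ->]; exists (k *: a + b); first exact: env_lin.
  by rewrite (@down_linear n p).
pose Cut p := sval (cid (exC p)).
have CutP p M : M \in Cut p <-> exists2 a, env (dLvl p) a & M = down n a by exact: svalP (cid (exC p)) M.
have mono p p' : (n <= p)%N -> (p <= p')%N -> (Cut p <= Cut p')%VS.
  move=> np pp'; apply/subvP => _ /CutP [a Aa ->]; apply/CutP.
  have [c Ac] := env_up pp' (fun x => dLvl_up pp') Aa.
  exists (up p' a + c *: (1 - up p' (1 : 'M[C]_p.+1))) => //.
  rewrite -(@down_down n p p') ?np // -[X in down p X]mulr1 down_mull //.
  by rewrite /down mulmx1 pid_mx_down_up // mulr1.
have ex : exists k, `[< exists2 m, (n <= m)%N & \dim (Cut m) = k >].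
  by exists (\dim (Cut n)); apply/asboolP; exists n.
have bound k : `[< exists2 m, (n <= m)%N & \dim (Cut m) = k >] -> (k <= \dim {:'M[C]_n.+1})%N.
  by move=> /asboolP [m _ <-]; apply: dimvS; apply: subvf.
case: (ex_maxnP ex bound) => k /asboolP [m nm mk] kmax.
exists m => // p mp a Aa.
have np := leq_trans nm mp.
have : Cut m == Cut p.
  rewrite eqEdim mono //= mk; apply: kmax; apply/asboolP; by exists p.
move/eqP => mp_eq; have : down n a \in Cut p by apply/CutP; exists a.
by rewrite -mp_eq => /CutP [b Ab ->]; exists b.
Qed.

(** Level [n] contains [P] and [z], and at level [m] the corners of size [n.+1] are stable. As [X]
    lives in that corner, traces and sandwiches with [d] only see [down n d], which an element of
    the envelope at level [m] realizes. *)
Lemma extend_good P z : good P -> derived_alg br z ->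
  exists P', [/\ good P', forall x, P x -> P' x & exists2 y, P' y & rad0 (z - y)].
Proof.
move=> gP dz; have := gP; move=> [n1 [s1 [s1L s1W s1n HP1]]].
have [n2 [hz2 zq2]] := derived_dLvl dz.
set n := maxn n1 n2; have n1n : (n1 <= n)%N := leq_maxl _ _; have n2n : (n2 <= n)%N := leq_maxr _ _.
have [m nm Hm] := stable_corners n.
have n1m := leq_trans n1n nm.
have [s0 [s0L s0W Hs0]] := up_whitehead n1m s1L s1W.
have [xs Hxs] : finite_dim P.
  apply: (finite_dim_sub (supp_finite_dim n1)); last by move=> x /HP1 [].
  by have [] := good_subalgebra gP.
have xsP x : x \in xs -> P x by move=> xxs; apply/Hxs; apply: in_span_mem.
have s1q : (s1 <= dLvl n1)%VS by rewrite -(whitehead_perfect s1L s1W); apply: brvS.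
have xzn x : x \in z :: xs -> supp n x /\ toM n x \in dLvl n.
  rewrite inE => /orP [/eqP ->|/xsP /HP1 [hx xs1]].
    by split; [apply: supp_mono hz2 n2n | rewrite (toM_up hz2 n2n); apply: dLvl_up].
  split; first exact: supp_mono hx n1n.
  by rewrite (toM_up hx n1n); apply: dLvl_up => //; apply: (subvP s1q).
pose D d := exists2 p, (m <= p)%N & exists2 a, env (dLvl p) a & d = down m a.
(* Including the spanning family [xs] of [P] puts the old subalgebra into the span of [X], so that
   the new one can contain it. *)
pose X := [seq toM m x | x <- z :: xs].
have dup p : (m <= p)%N -> forall x, x \in dLvl m -> up p x \in dLvl p.
  by move=> mp x; apply: dLvl_up.
have [|||||||||s [sL sW s0s sq Xs]] := @capture_levi m (Lvl m) s0 D X.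
- exact: (@Lvl_closed m).
- by move=> a Aa; exists m => //; exists a; rewrite ?down_id.
- move=> a d Aa [p mp [b Ab ->]]; exists p => //.
  have [c Ac] := env_up mp (dup p mp) Aa.
  by rewrite -(down_mull a c b mp); eexists; [apply: env_mul Ac Ab|].
- move=> a d Aa [p mp [b Ab ->]]; exists p => //.
  have [c Ac] := env_up mp (dup p mp) Aa.
  by rewrite -(down_mulr a c b mp); eexists; [apply: env_mul Ab Ac|].
- move=> _ /mapP [x /xzn [hx xq] ->]; rewrite (toM_up hx nm); exact: dLvl_up.
- move=> d [p mp [b Ab dE]]; have [a Aa ab] := Hm p mp b Ab.
  have da : down n d = down n a by rewrite dE down_down ?nm // ab.
  exists a; split=> // [_ /mapP [x /xzn [hx xq] ->]|_ _ /mapP [x /xzn [hx _] ->] /mapP [y /xzn [hy _] ->]].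
    by rewrite (toM_up hx nm) !tr_up da.
  by rewrite (toM_up hx nm) (toM_up hy nm) !up_sandwich da.
- exact: s0L.
- exact: s0W.
- apply/subvP => _ /Hs0 [a as1 ->].
  have /(subvP s1n) /LvlP [x hx ax] := as1.
  have /Hxs xsp : P x by apply/HP1; rewrite -ax.
  rewrite ax -(toM_up hx n1m).
  suff [] : True /\ toM m x \in <<X>>%VS by [].
  apply: (in_span_sub (P := fun x => True /\ toM m x \in <<X>>%VS) _ _ xsp).
    split; first by rewrite (lin0 (@toM_linear _)) mem0v.
    split=> [u v [_ hu] [_ hv]|k u [_ hu]].
      by rewrite (linD (@toM_linear _)) rpredD.
    by rewrite (linZ (@toM_linear _)) rpredZ.
  by move=> w wxs; split=> //; apply: memv_span; apply: map_f; rewrite inE wxs orbT.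
have sLvl : (s <= Lvl m)%VS by apply: subv_trans sq _; apply: dLvl_sub.
exists (fun x => supp m x /\ toM m x \in s); split.
- by exists m, s; split.
- move=> x /HP1 [hx xs1]; split; first exact: supp_mono hx n1m.
  by rewrite (toM_up hx n1m); apply: (subvP s0s); apply/Hs0; exists (toM n1 x).
have [|M Ms [AM MD]] := Xs (toM m z); first by apply: map_f; rewrite inE eqxx.
have /(subvP sLvl) /LvlP [y hy ME] := Ms.
exists y; first by rewrite -ME.
have [hz zq] : supp n z /\ toM n z \in dLvl n by apply: xzn; rewrite inE eqxx.
have hzm := supp_mono hz nm.
have hzy : supp m (z - y).
  by rewrite -scaleN1r addrC; apply: suppL.
have Ezy : toM m (z - y) = toM m z - M by rewrite (linB (@toM_linear _)) ME.
(* By adjointness of [up] and [down], orthogonality to [D] at level [m] is orthogonality to the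
   envelope at each level [p >= m]. *)
exists m => p mp; split; first exact: supp_mono hzy mp.
  rewrite (toM_up hzy mp); apply: dLvl_up => //; rewrite Ezy rpredB //; last exact: (subvP sq).
  by rewrite (toM_up hz nm); apply: dLvl_up.
move=> a Aa; rewrite (toM_up hzy mp) tr_up Ezy; apply: MD.
by exists p => //; exists a.
Qed.

Lemma good0 : good (fun x => x = 0).
Proof.
exists 0%N, 0%VS; split.
- by move=> x y; rewrite !memv0 => /eqP -> _; rewrite lie0x.
- by move=> n rho U _ _ h _ v; exists 0 => [|x /h ->]; [exact: sub0mx | rewrite mulmx0].
- exact: sub0v.
- move=> x; rewrite memv0; split=> [->|[hx /eqP]]; last exact: toM_inj.
  by split; [exact: supp0 | rewrite (lin0 (@toM_linear _))].
Qed.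

Lemma levi_of_matrices : countable_dim L -> locally_finite br ->
  exists l, levi_component br (loc_solv_rad br) l.
Proof.
move=> [e He] lfL.
(* The brackets of the spanning sequence, enumerated by coding pairs; the default 0 keeps every
   [z k] in the derived algebra. *)
pose z k := if unpickle k is Some (i, j) then br (e i) (e j) else 0.
have [D0 [DD DZ]] : subspace (derived_alg br) := span_set_subspace _.
have dz k : derived_alg br (z k).
  rewrite /z; case: unpickle => [[i j]|]; last exact: D0.
  by apply: span_set_gen; exists (e i), (e j).
(* The step number is part of the argument of the choice function, so the chain becomes a plain
   recursion. *)
have [|f Hf] := @choice (nat * {P | good P}) {P | good P} (fun a P' =>
  (forall x, sval a.2 x -> sval P' x) /\ exists2 y, sval P' y & rad0 (z a.1 - y)).
  move=> [k [P gP]] /=; have [P' [gP' h1 h2]] := extend_good gP (dz k).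
  by exists (exist _ P' gP').
pose chain := fix chain k := if k is k'.+1 then f (k', chain k') else exist _ _ good0.
have chainS k x : sval (chain k) x -> sval (chain k.+1) x by have [h _] := Hf (k, chain k); apply: h.
have chain_mono k k' x : (k <= k')%N -> sval (chain k) x -> sval (chain k') x.
  move=> /subnKC <-; elim: (k' - k)%N => [|d IH]; first by rewrite addn0.
  by rewrite addnS => /IH /chainS.
pose l x := exists k, sval (chain k) x.
have gc k : good (sval (chain k)) := svalP (chain k).
have sub k := good_subalgebra (gc k).
have both x y : l x -> l y -> exists k, sval (chain k) x /\ sval (chain k) y.
  move=> [i hi] [j hj]; exists (maxn i j); split.
    by apply: chain_mono hi; apply: leq_maxl.
  by apply: chain_mono hj; apply: leq_maxr.
have lsub : subalgebra br l.
  split; last by move=> x y lx ly; have [k [hx hy]] := both x y lx ly; exists k; have [_ h] := sub k; apply: h.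
  split; first by exists 0%N; have [[h _] _] := sub 0%N.
  split=> [x y lx ly|c x [k hk]].
    by have [k [hx hy]] := both x y lx ly; exists k; have [[_ [h _]] _] := sub k; apply: h.
  by exists k; have [[_ [_ h]] _] := sub k; apply: h.
have ld x : l x -> derived_alg br x by move=> [k hk]; apply: good_derived (gc k) hk.
have [rI rsol rmax] := loc_solv_radP brL lfL.
have rad0r x : rad0 x -> loc_solv_rad br x.
  by apply: (rmax (rad0)); [exact: rad0_ideal | exact: rad0_locally_solvable].
have [[r0 [rD rZ]] rbr] := rI; have [[l0 [lD lZ]] lbr] := lsub.
exists l; split=> //; last by move=> x rx _ [k hk]; apply: good_rad (gc k) hk rx.
pose Q x := exists a b, [/\ loc_solv_rad br a, derived_alg br a, l b & x = a + b].
have sQ : subspace Q.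
  split; first by exists 0, 0; rewrite addr0.
  split=> [_ _ [a [b [ra da lb ->]]] [a' [b' [ra' da' lb' ->]]]|c _ [a [b [ra da lb ->]]]].
    by exists (a + a'), (b + b'); split; auto; rewrite addrACA.
  by exists (c *: a), (c *: b); split; auto; rewrite scalerDr.
have Qe i j : Q (br (e i) (e j)).
  have [_ [y hy ry]] := Hf (pickle (i, j), chain (pickle (i, j))).
  rewrite /= /z pickleK in ry; have ly : l y by exists (pickle (i, j)).+1.
  exists (br (e i) (e j) - y), y; split=> //; [exact: rad0r| |by rewrite subrK].
  apply: DD; first by apply: span_set_gen; exists (e i), (e j).
  by rewrite -scaleN1r; apply: DZ; apply: ld.
move=> x; apply: (@span_set_sub _ _ _ Q) => // _ [a [b ->]].
have [Q0 [QD QZ]] := sQ.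
have [n an] := He a; have [k bk] := He b.
apply: (in_span_sub (P := fun a => Q (br a b)) _ _ an).
  split; first by rewrite br0l.
  by split=> [u v hu hv|c u hu]; rewrite ?brDl ?brZl //; auto.
move=> _ /mapP [i _ ->]; apply: (in_span_sub (P := fun b => Q (br (e i) b)) _ _ bk).
  split; first by rewrite br0r.
  by split=> [u v hu hv|c u hu]; rewrite ?brDr ?brZr //; auto.
by move=> _ /mapP [j _ ->].
Qed.
End Levels.

(** * Matrix coefficients of a finitary representation *)

Lemma sum_ord_trunc (V : zmodType) (f : nat -> V) a b :
  (forall k, (a <= k)%N -> f k = 0) -> (a <= b)%N -> \sum_(k < b) f k = \sum_(k < a) f k.
Proof.
move=> fa /subnKC <-; rewrite big_split_ord /= [X in _ + X]big1 ?addr0 // => i _.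
by apply: fa; apply: leq_addr.
Qed.

Section MatrixCoefficients.
Variables (F : fieldType) (L W : lmodType F) (br : L -> L -> L) (rho : L -> W -> W) (B : W -> Prop).
Hypotheses (rep : lie_rep br rho) (basisB : is_basis B) (G : nat -> seq W).
Hypotheses (GU : forall n, uniq (G n)) (GB : forall n b, b \in G n -> B b)
  (Gcat : forall n m, (n <= m)%N -> exists t, G m = G n ++ t).

(** Since [G m] extends [G n] at its end, indices keep their meaning and the same [M] serves all
    larger [n]. *)
Definition matrix_of n x (M : nat -> nat -> F) :=
  [/\ forall i j, (size (G n) <= i)%N || (size (G n) <= j)%N -> M i j = 0,
      forall j, (j < size (G n))%N -> rho x (G n)`_j = \sum_(i < size (G n)) M i j *: (G n)`_i &
      forall b, B b -> b \notin G n -> rho x b = 0].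

Lemma rho_lin k x y w : rho (k *: x + y) w = k *: rho x w + rho y w.
Proof. by case: rep. Qed.
Lemma rho_linr x : linear (rho x).
Proof. by case: rep => _ h _ a v w; apply: h. Qed.

Lemma rho0r x : rho x 0 = 0.
Proof.
apply: (addrI (rho x 0)); have := rho_linr x 1 0 0; rewrite !scale1r !addr0 => e.
exact: esym e.
Qed.

Lemma matrix_of_mono n m x M : matrix_of n x M -> (n <= m)%N -> matrix_of m x M.
Proof.
move=> [h1 h2 h3] /Gcat [t Gm].
have sz : (size (G n) <= size (G m))%N by rewrite Gm size_cat leq_addr.
split=> [i j h|j jm|b Bb].
    by apply: h1; case/orP: h => h; rewrite (leq_trans sz h) ?orbT.
  rewrite (sum_ord_trunc (a := size (G n)) (f := fun i => M i j *: (G m)`_i)) // => [|k hk]; last first.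
    by rewrite h1 ?hk // scale0r.
  have [jn|nj] := ltnP j (size (G n)).
    have -> : (G m)`_j = (G n)`_j by rewrite Gm nth_cat jn.
    by rewrite h2 //; apply: eq_bigr => i _; rewrite Gm nth_cat ltn_ord.
  have jt : (j - size (G n) < size t)%N by move: jm; rewrite Gm size_cat; lia.
  rewrite h3; first by rewrite big1 // => i _; rewrite h1 ?nj ?orbT // scale0r.
    by apply: (@GB m); apply: mem_nth.
  have := GU m; rewrite Gm cat_uniq => /and3P [_ /hasPn h _].
  by rewrite nth_cat ltnNge nj /=; apply: h; apply: mem_nth.
by rewrite Gm mem_cat negb_or => /andP [hb _]; apply: h3.
Qed.

Lemma matrix_of_uniq n x M M' : matrix_of n x M -> matrix_of n x M' -> forall i j, M i j = M' i j.
Proof.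
move=> [h1 h2 _] [h1' h2' _] i j.
have [h|] := boolP ((size (G n) <= i)%N || (size (G n) <= j)%N); first by rewrite h1 // h1'.
rewrite negb_or -!ltnNge => /andP [hi hj].
have [ind _] := basisB.
have := ind (G n) (GU n) (@GB n) (mkseq (fun i => M i j - M' i j) (size (G n))) _ i hi.
rewrite nth_mkseq // => /(_ _)/eqP; rewrite subr_eq0 => e; apply/eqP; apply: e.
rewrite /lincomb (eq_bigr (fun k : 'I_(size (G n)) => M k j *: (G n)`_k - M' k j *: (G n)`_k)).
  by rewrite sumrB -h2 // -h2' // subrr.
by move=> k _; rewrite nth_mkseq // scalerBl.
Qed.

Lemma matrix_of_lin n k x y M N : matrix_of n x M -> matrix_of n y N ->
  matrix_of n (k *: x + y) (fun i j => k * M i j + N i j).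
Proof.
move=> [h1 h2 h3] [g1 g2 g3]; split=> [i j h|j hj|b Bb hb].
- by rewrite h1 // g1 // mulr0 addr0.
- rewrite rho_lin h2 // g2 // scaler_sumr -big_split; apply: eq_bigr => i _.
  by rewrite scalerDl scalerA.
- by rewrite rho_lin h3 // g3 // scaler0 addr0.
Qed.

Lemma matrix_of_mul n x y M N : matrix_of n x M -> matrix_of n y N -> forall j, (j < size (G n))%N ->
  rho x (rho y (G n)`_j) = \sum_(i < size (G n)) (\sum_(k < size (G n)) M i k * N k j) *: (G n)`_i.
Proof.
move=> [h1 h2 h3] [g1 g2 g3] j hj; rewrite g2 //.
have l0 := rho0r x.
have lD u v : rho x (u + v) = rho x u + rho x v by have := rho_linr x 1 u v; rewrite !scale1r.
rewrite (big_morph (rho x) lD l0).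
rewrite (eq_bigr (fun k : 'I_(size (G n)) => \sum_(i < size (G n)) (M i k * N k j) *: (G n)`_i)) => [|k _].
  by rewrite exchange_big; apply: eq_bigr => i _; rewrite scaler_suml.
have lZ a u : rho x (a *: u) = a *: rho x u by have := rho_linr x a u 0; rewrite l0 !addr0.
rewrite lZ h2 // scaler_sumr; apply: eq_bigr => i _; by rewrite scalerA mulrC.
Qed.

Lemma matrix_of_br n x y M N : matrix_of n x M -> matrix_of n y N ->
  matrix_of n (br x y) (fun i j => \sum_(k < size (G n)) (M i k * N k j - N i k * M k j)).
Proof.
move=> hx hy; have [h1 h2 h3] := hx; have [g1 g2 g3] := hy.
have [_ _ rbr] := rep.
split=> [i j /orP [] h|j hj|b Bb hb].
- by rewrite big1 // => k _; rewrite (h1 i k) ?h // (g1 i k) ?h // !mul0r subrr.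
- by rewrite big1 // => k _; rewrite (h1 k j) ?h ?orbT // (g1 k j) ?h ?orbT // !mulr0 subrr.
- rewrite rbr (matrix_of_mul hx hy) // (matrix_of_mul hy hx) // -sumrB.
  by apply: eq_bigr => i _; rewrite -scalerBl -sumrB.
- by rewrite rbr (h3 b) // (g3 b) // !rho0r subrr.
Qed.
End MatrixCoefficients.

(** The basis [B] may be uncountable, but the finite sets attached to a countable spanning sequence
    of [L] contain every basis vector on which [L] acts nontrivially. They are listed one after the
    other, new vectors being appended, and [Phi x] is the matrix of [x] in this list; faithfulness
    gives injectivity. *)
Lemma finitary_matrices (F : fieldType) (L : lmodType F) (br : L -> L -> L) :
  countable_dim L -> finitary_lie br -> exists Phi : L -> nat -> nat -> F,
  [/\ forall k x y i j, Phi (k *: x + y) i j = k * Phi x i j + Phi y i j,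
      forall x, (forall i j, Phi x i j = 0) -> x = 0,
      forall x, exists n, forall i j, (n < i)%N || (n < j)%N -> Phi x i j = 0 &
      forall n x y, (forall i j, (n < i)%N || (n < j)%N -> Phi x i j = 0) ->
        (forall i j, (n < i)%N || (n < j)%N -> Phi y i j = 0) -> forall i j,
        Phi (br x y) i j = \sum_(k < n.+1) (Phi x i k * Phi y k j - Phi y i k * Phi x k j)].
Proof.
move=> [e He] [W [rho [B [rep faith basisB fin]]]].
have [R HR] := choice fin.
pose G := fix G n := if n is k.+1 then G k ++ [seq w <- undup (R (e k)) | w \notin G k] else [::].
have GU n : uniq (G n).
  elim: n => //= n IH; rewrite cat_uniq IH filter_uniq ?undup_uniq // andbT.
  by apply/hasPn => w; rewrite mem_filter => /andP [].
have GB n b : b \in G n -> B b.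
  elim: n => //= n IH; rewrite mem_cat => /orP [/IH //|].
  by rewrite mem_filter mem_undup => /andP [_]; have [h _ _] := HR (e n); apply: h.
have Gcat n m : (n <= m)%N -> exists t, G m = G n ++ t.
  move/subnKC => <-; elim: (m - n)%N => [|d [t IH]]; first by exists [::]; rewrite addn0 cats0.
  by rewrite addnS /= IH -catA; eexists.
have RG k n : (k < n)%N -> {subset R (e k) <= G n}.
  move=> /Gcat [t ->] w wR; rewrite mem_cat /= mem_cat mem_filter mem_undup wR andbT.
  by case: (w \in G k).
have mat_ex x : exists M n, matrix_of rho B G n x M.
  have [n xn] := He x.
  have H : forall b, B b -> in_span (G n) (rho x b) /\ (b \notin G n -> rho x b = 0).
    apply: (in_span_sub (P := fun x => forall b, B b -> in_span (G n) (rho x b) /\ (b \notin G n -> rho x b = 0)) _ _ xn).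
      have r0 b : rho 0 b = 0.
        by have := rho_lin rep (-1) 0 0 b; rewrite scaler0 addr0 scaleN1r addNr.
      have rD u v b : rho (u + v) b = rho u b + rho v b.
        by have := rho_lin rep 1 u v b; rewrite !scale1r.
      have rZ k u b : rho (k *: u) b = k *: rho u b.
        by have := rho_lin rep k u 0 b; rewrite r0 !addr0.
      have [s0 [sD sZ]] := in_span_subspace (G n).
      split; first by move=> b _; rewrite r0.
      split=> [u v hu hv|k u hu] b Bb.
        have [u1 u2] := hu b Bb; have [v1 v2] := hv b Bb; rewrite rD.
        by split=> [|hb]; [apply: sD | rewrite u2 // v2 // addr0].
      have [u1 u2] := hu b Bb; rewrite rZ.
      by split=> [|hb]; [apply: sZ | rewrite u2 // scaler0].
    move=> w /mapP [k]; rewrite mem_iota /= => kn -> b Bb.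
    have [_ h1 h2] := HR (e k); have sub := RG k n kn.
    split; first by apply: in_span_mono (h2 b Bb).
    by move=> hb; apply: h1 => //; apply: contra hb => /sub.
  have [|f Hf] := @choice nat (nat -> F) (fun j f => (j < size (G n))%N ->
      rho x (G n)`_j = \sum_(i < size (G n)) f i *: (G n)`_i).
    move=> j; case: (ltnP j (size (G n))) => [hj|hj]; last by exists (fun=> 0).
    have [/in_spanP [f hf] _] := H _ (GB _ _ (mem_nth 0 hj)); by exists f.
  exists (fun i j => if (i < size (G n))%N && (j < size (G n))%N then f j i else 0), n; split.
  - by move=> i j h; case: ifP => // /andP [h1 h2]; by move: h; rewrite leqNgt h1 leqNgt h2.
  - by move=> j hj; rewrite (Hf j hj); apply: eq_bigr => i _; rewrite (ltn_ord i) hj.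
  - by move=> b Bb; have [_ h] := H b Bb.
have [Phi HPhi] := choice mat_ex.
have two x y : exists n, matrix_of rho B G n x (Phi x) /\ matrix_of rho B G n y (Phi y).
  have [n hn] := HPhi x; have [m hm] := HPhi y; exists (maxn n m).
  have mono := matrix_of_mono GU GB Gcat.
  by split; [apply: mono hn (leq_maxl _ _) | apply: mono hm (leq_maxr _ _)].
have PhiE x n M : matrix_of rho B G n x M -> forall i j, Phi x i j = M i j.
  move=> hM i j; have [m hm] := HPhi x; have mono := matrix_of_mono GU GB Gcat.
  apply: (matrix_of_uniq basisB GU GB (n := maxn n m) (x := x) (rho := rho)).
    exact: mono hm (leq_maxr _ _).
  exact: mono hM (leq_maxl _ _).
exists Phi; split.
- move=> k x y i j; have [n [hx hy]] := two x y.
  exact: (PhiE _ _ _ (matrix_of_lin rep k hx hy) i j).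
- move=> x x0; apply: faith => w; have [n [h1 h2 h3]] := HPhi x.
  have [_ /(_ w) wB] := basisB.
  have [l1 l2] : subspace (fun w => rho x w = 0).
    have r0 := rho0r rep x.
    split=> //; split=> [u v hu hv|k u hu].
      by have := rho_linr rep x 1 u v; rewrite !scale1r hu hv addr0.
    by have := rho_linr rep x k u 0; rewrite hu r0 scaler0 !addr0.
  apply: (@span_set_sub _ _ B (fun w => rho x w = 0)) wB => // b Bb.
  have [bG|] := boolP (b \in G n); last exact: h3.
  rewrite -[b](nth_index 0 bG) h2 ?index_mem // big1 // => i _; by rewrite x0 scale0r.
- move=> x; have [n [h1 _ _]] := HPhi x; exists (size (G n)) => i j h; apply: h1; case/orP: h => h; rewrite (ltnW h) ?orbT //.
- move=> n x y hx hy i j; have [m [mx my]] := two x y.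
  rewrite (PhiE _ _ _ (matrix_of_br rep mx my) i j).
  have [h1 _ _] := mx; have [g1 _ _] := my.
  pose f k := Phi x i k * Phi y k j - Phi y i k * Phi x k j.
  have e1 := @sum_ord_trunc _ f (size (G m)) (maxn n.+1 (size (G m))).
  have e2 := @sum_ord_trunc _ f n.+1 (maxn n.+1 (size (G m))).
  rewrite -e1 ?leq_maxr ?e2 ?leq_maxl // => k hk; rewrite /f.
    by rewrite (hx i k) ?hk ?orbT // (hy i k) ?hk ?orbT // !mul0r subrr.
  by rewrite (h1 i k) ?hk ?orbT // (g1 i k) ?hk ?orbT // !mul0r subrr.
Qed.

Theorem theorem4p2 (L : lmodType complex) (br : L -> L -> L) :
  is_lie_bracket br -> countable_dim L -> locally_finite br -> finitary_lie br ->
  exists r : L -> Prop, loc_solv_radical br r /\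
    exists l : L -> Prop, levi_component br r l.
Proof.
move=> brL cL lfL /(finitary_matrices cL) [Phi [PhiL Phi_inj Phi_supp Phi_br]].
exists (loc_solv_rad br); split; first exact: loc_solv_radP.
exact: (levi_of_matrices brL PhiL Phi_inj Phi_supp Phi_br).
Qed.
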